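(* Given a unit disk graph $G$ on $n$ vertices (with its geometric representation) and an integer $k$, one can solve 2-Bounded-Degree Vertex Deletion on $(G,k)$, i.e., decide whether there is a set $S\subseteq V(G)$ with $|S|\le k$ such that $G\setminus S$ has maximum degree at most two (and find such $S$), in time $2^{O(\sqrt{k})}n^{O(1)}$.
   Context: A unit disk graph on a point set $V\subset\mathbb{R}^2$ has an edge between two points iff their Euclidean distance is at most one; the geometric representation is the point set. *)

(* Defs.v *)
From HB Require Import structures.
From mathcomp Require Import all_boot all_order all_algebra.
From mathcomp Require Import reals exp.

Set Implicit Arguments.
Unset Strict Implicit.
Unset Printing Implicit Defensive.

Import Order.TTheory GRing.Theory Num.Theory.
Local Open Scope ring_scope.

(** * Unit disk graphs and bounded-degree vertex deletion *)

(* [R * R] carries the sup norm in the library, so the Euclidean distance is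
   spelled out. *)
Definition edist (R : realType) (p q : R * R) : R :=
  Num.sqrt ((p.1 - q.1) ^+ 2 + (p.2 - q.2) ^+ 2).

(* A finite point set V is given by an enumeration without repetition
   [p : 'I_n -> R * R]; the vertex [i] of the graph is the point [p i]. *)
Definition unit_disk_graph (R : realType) (n : nat) (p : 'I_n -> R * R) :
    rel 'I_n :=
  fun u v => (u != v) && (edist (p u) (p v) <= 1).

(* Maximum degree of the subgraph of [e] induced by [A]. *)
Definition max_degree (T : finType) (e : rel T) (A : {set T}) : nat :=
  \max_(v in A) #|[set w in A | e v w]|.

(* [S] is a solution of the instance [(e, k)] of d-Bounded-Degree Vertex
   Deletion. *)
Definition bdd_solution (T : finType) (d : nat) (e : rel T) (k : int)
    (S : {set T}) : bool :=
  (#|S|%:Z <= k) && (max_degree e (~: S) <= d)%N.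

(** * The real RAM

   A program manipulates an integer memory and a real memory, both addressed
   by integers (indirect addressing is allowed).  Integers can only be added,
   subtracted and compared; in particular there is no unit-cost integer
   multiplication.  Reals can be added, subtracted, multiplied, divided and
   compared, exactly and at unit cost.  There is no conversion between the two
   memories (no floor or rounding), and the only real literals are the natural
   numbers. *)

Inductive iexp : Type :=
| IConst of int
| ILoad of iexp
| IAdd of iexp & iexp
| ISub of iexp & iexp.

Inductive rexp : Type :=
| RConst of nat
| RLoad of iexp
| RAdd of rexp & rexp
| RSub of rexp & rexp
| RMul of rexp & rexp
| RDiv of rexp & rexp.

Inductive bexp : Type :=
| BILe of iexp & iexp
| BRLe of rexp & rexp
| BNot of bexp
| BAnd of bexp & bexp.

Inductive cmd : Type :=
| CSkip
| CIStore of iexp & iexp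
| CRStore of iexp & rexp
| CSeq of cmd & cmd
| CIf of bexp & cmd & cmd
| CWhile of bexp & cmd.

Record state (R : realType) : Type := State {
  imem : int -> int;
  rmem : int -> R
}.

Definition upd (A : Type) (m : int -> A) (a : int) (x : A) : int -> A :=
  fun b => if b == a then x else m b.

Fixpoint ieval (R : realType) (s : state R) (e : iexp) : int :=
  match e with
  | IConst z => z
  | ILoad a => imem s (ieval s a)
  | IAdd e1 e2 => ieval s e1 + ieval s e2
  | ISub e1 e2 => ieval s e1 - ieval s e2
  end.

(* Division by zero returns zero. *)
Fixpoint reval (R : realType) (s : state R) (e : rexp) : R :=
  match e with
  | RConst m => m%:R
  | RLoad a => rmem s (ieval s a)
  | RAdd e1 e2 => reval s e1 + reval s e2
  | RSub e1 e2 => reval s e1 - reval s e2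
  | RMul e1 e2 => reval s e1 * reval s e2
  | RDiv e1 e2 => reval s e1 / reval s e2
  end.

Fixpoint beval (R : realType) (s : state R) (b : bexp) : bool :=
  match b with
  | BILe e1 e2 => ieval s e1 <= ieval s e2
  | BRLe e1 e2 => reval s e1 <= reval s e2
  | BNot b1 => ~~ beval s b1
  | BAnd b1 b2 => beval s b1 && beval s b2
  end.

(* Evaluating an expression costs one step per operation, load or literal. *)
Fixpoint icost (e : iexp) : nat :=
  match e with
  | IConst _ => 1
  | ILoad a => (icost a).+1
  | IAdd e1 e2 | ISub e1 e2 => (icost e1 + icost e2).+1%N
  end.

Fixpoint rcost (e : rexp) : nat :=
  match e with
  | RConst _ => 1
  | RLoad a => (icost a).+1
  | RAdd e1 e2 | RSub e1 e2 | RMul e1 e2 | RDiv e1 e2 =>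
      (rcost e1 + rcost e2).+1%N
  end.

Fixpoint bcost (b : bexp) : nat :=
  match b with
  | BILe e1 e2 => (icost e1 + icost e2).+1%N
  | BRLe e1 e2 => (rcost e1 + rcost e2).+1%N
  | BNot b1 => (bcost b1).+1
  | BAnd b1 b2 => (bcost b1 + bcost b2).+1%N
  end.

(* [exec c s t s']: started in [s], the program [c] halts in [s'] after exactly
   [t] steps. *)
Inductive exec (R : realType) : cmd -> state R -> nat -> state R -> Prop :=
| ExecSkip s :
    exec CSkip s 1 s
| ExecIStore s a e :
    exec (CIStore a e) s (icost a + icost e).+1%N
      (State (upd (imem s) (ieval s a) (ieval s e)) (rmem s))
| ExecRStore s a e :
    exec (CRStore a e) s (icost a + rcost e).+1%N
      (State (imem s) (upd (rmem s) (ieval s a) (reval s e)))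
| ExecSeq c1 c2 s1 t1 s2 t2 s3 :
    exec c1 s1 t1 s2 -> exec c2 s2 t2 s3 ->
    exec (CSeq c1 c2) s1 (t1 + t2)%N s3
| ExecIfTrue b c1 c2 s t s' :
    beval s b -> exec c1 s t s' ->
    exec (CIf b c1 c2) s (bcost b + t).+1%N s'
| ExecIfFalse b c1 c2 s t s' :
    ~~ beval s b -> exec c2 s t s' ->
    exec (CIf b c1 c2) s (bcost b + t).+1%N s'
| ExecWhileFalse b c s :
    ~~ beval s b ->
    exec (CWhile b c) s (bcost b).+1 s
| ExecWhileTrue b c s1 t1 s2 t2 s3 :
    beval s1 b -> exec c s1 t1 s2 -> exec (CWhile b c) s2 t2 s3 ->
    exec (CWhile b c) s1 (bcost b + t1 + t2).+1%N s3.

(* Executions are deterministic, so the running time and the output of a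
   halting program are well defined. *)
Lemma exec_det (R : realType) (c : cmd) (s : state R) (t1 t2 : nat)
    (s1 s2 : state R) :
  exec c s t1 s1 -> exec c s t2 s2 -> t1 = t2 /\ s1 = s2.
Proof.
move=> E1; elim: E1 t2 s2 => {c s t1 s1}.
- by move=> s t2 s2 E; inversion E.
- by move=> s a e t2 s2 E; inversion E.
- by move=> s a e t2 s2 E; inversion E.
- move=> c1 c2 s1 t1 s2 t2 s3 _ IH1 _ IH2 t s E.
  inversion E as [| | |? ? ? u1 r1 u2 r2 E1 E2| | | |]; subst.
  by have [-> ?] := IH1 _ _ E1; subst r1; have [-> ->] := IH2 _ _ E2.
- move=> b c1 c2 s t s' Hb _ IH t2 s2 E.
  inversion E as [| | | |? ? ? ? ? ? Hb' E1|? ? ? ? ? ? Hb' E1| |]; subst.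
    by have [-> ->] := IH _ _ E1.
  by rewrite Hb in Hb'.
- move=> b c1 c2 s t s' Hb _ IH t2 s2 E.
  inversion E as [| | | |? ? ? ? ? ? Hb' E1|? ? ? ? ? ? Hb' E1| |]; subst.
    by rewrite Hb' in Hb.
  by have [-> ->] := IH _ _ E1.
- move=> b c s Hb t2 s2 E.
  inversion E as [| | | | | | |? ? ? ? ? ? ? Hb' E1 E2]; subst => //.
  by rewrite Hb' in Hb.
- move=> b c s1 t1 s2 t2 s3 Hb _ IH1 _ IH2 t s E.
  inversion E as [| | | | | |? ? ? Hb'|? ? ? u1 r1 u2 r2 Hb' E1 E2]; subst.
    by rewrite Hb in Hb'.
  by have [-> ?] := IH1 _ _ E1; subst r1; have [-> ->] := IH2 _ _ E2.
Qed.

(** * Input and output conventions *)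

(* Integer cells 0 and 1 hold [n] and [k]; real cells 2i and 2i+1 hold the
   coordinates of the i-th point; every other cell holds 0. *)
Definition input_state (R : realType) (n : nat) (p : 'I_n -> R * R) (k : int) :
    state R :=
  State
    (fun a => if a == 0 then n%:Z else if a == 1 then k else 0)
    (fun a =>
       if a is Posz m then
         if insub m./2 is Some i then
           if odd m then (p i).2 else (p i).1
         else 0
       else 0).

(* The vertex set written in the integer cells 1, ..., n, in binary. *)
Definition output_set (R : realType) (n : nat) (s : state R) : {set 'I_n} :=
  [set i : 'I_n | imem s i.+1%:Z == 1].

(* Cell 0 holds the answer (1 for yes, 0 for no); when the answer is yes, a
   solution is also returned. *)
Definition correct_output (R : realType) (n : nat) (P : pred {set 'I_n})
    (s : state R) : Prop :=
  ((exists S, P S) -> imem s 0 = 1 /\ P (output_set n s)) /\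
  (~ (exists S, P S) -> imem s 0 = 0).

(* Main.v *)
(* After deleting a solution, every cell of diameter at most 1 keeps at most 3
   points.  Only the points of degree at least 3 and their neighbours matter,
   and they lie near the solution, so there are O(k) of them in a yes-instance.
   A dynamic program adds these points one by one in a fixed order; its state
   records which points having a neighbour still to come are kept, and their
   degrees.  A cell with m points contributes a factor polynomial in m, that is
   O(log4 m) bits.

   The order is as follows.  Let 2^J be about the square root of the number of
   points and shift the dyadic grid by a.  A cell with about 4^l points is put
   in the separator when it lies near a grid line of level J + 1 - l (spacing
   2^(J + 1 - l)).  On average over a, such a cell is in the separator with
   probability O(2^l / 2^J), and since l 2^l = O(4^l), some shift a gives the
   separator O(2^J) bits.  The separator comes first and the other points follow
   in Z-order.  Then a frontier point outside the separator is near a line of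
   some level j < J, in the square of level j + 1 that contains the current
   point; there are O(2^j) such cells, each with O(J - j) bits, and the sum over
   j is O(2^J).

   The program is written in a small language of integer expressions with
   bounded folds, which is compiled to the real RAM. *)
Require Import Defs.
From mathcomp Require Import all_boot all_order all_algebra.
From mathcomp Require Import reals exp.
From mathcomp Require Import zify lra.

Set Implicit Arguments.
Unset Strict Implicit.
Unset Printing Implicit Defensive.

Import Order.TTheory GRing.Theory Num.Theory.
Local Open Scope ring_scope.

(** * Expressions and programs compiled to the real RAM *)

(** The obstacle is a logarithm: a frontier of O(sqrt k) cells at O(log k) bits each would only give
    the exponent sqrt k log k. Dense cells cost more bits, but they are few; sending them to the
    separator already near finer grid lines keeps only cheap cells near the fine lines on the
    frontier, and the number of bits then follows a geometric sum. The kernel size ties the number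
    of points to k: one deleted point accounts for at most 244 relevant points, itself and three in
    each cell of a 9 by 9 window. When there are more than 256 k relevant points the program answers
    no without running the dynamic program; otherwise 2^J is at most 32 sqrt k + 1. The machine
    cannot round or multiply integers, but its integers are unbounded. So a set of points is kept as
    one integer, powers are obtained by doubling, and bits are read by repeated subtraction. A
    single number bounds all loops and the time is polynomial in it, so only the number of states
    contributes to the exponent. *)

Inductive name := NX | NY | NR | NL | ND | NK | NP | NT | NS.

(** [NX] and [NY] hold the columns of the points in the two directions, [NR] the relevant points,
    [NL] the weights, [ND] the leaders, [NK] the keys, [NP] the positions, [NT] the table of states
    and [NS] the solution. *)
Definition code (a : name) : nat :=
  match a with
  | NX => 1 | NY => 2 | NR => 3 | NL => 4 | ND => 5
  | NK => 6 | NP => 7 | NT => 8 | NS => 9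
  end.

(* The memory of the compiled programs lies at negative addresses, the cells of
   the array of code c being the addresses -1 - c modulo 16; the nonnegative
   addresses are left to the input and the output.  Code 0 is for the variables
   and code 15 for the temporaries of the compiler. *)
Definition addr (c : nat) (z : int) : int := - (16 * z + c%:Z + 1).
Definition vaddr (x : nat) : int := addr 0 x%:Z.
Definition tmp (j : nat) : int := addr 15 j%:Z.

Inductive rtest := TAdj | TX | TY.

(** Truth values are the integers 0 and 1. In [EFold b x y e0 e1] the variable [b] gives the number
    of rounds, [x] is the index and [y] the accumulator, which starts at [e0]. *)
Inductive ex :=
| EC of int
| EV of nat
| EL of name & ex
| EAdd of ex & ex
| ESub of ex & ex
| EIf of ex & ex & ex & ex
| ER of rtest & ex & ex
| EFold of nat & nat & nat & ex & ex.

Definition setv (x : nat) (z : int) (env : nat -> int) : nat -> int :=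
  fun y => if eqn y x then z else env y.

Definition name_eqb (a b : name) : bool := eqn (code a) (code b).

Definition seta (a : name) (i z : int) (arr : name -> int -> int) :
    name -> int -> int :=
  fun b t => if name_eqb b a && (t == i) then z else arr b t.

Definition iters (z : int) : nat := if z is Posz n then n else 0.

Fixpoint foldn (A : Type) (f : nat -> A -> A) (a : A) (n : nat) : A :=
  if n is m.+1 then f m (foldn f a m) else a.

Definition rxc (c : bool) (u : iexp) : rexp :=
  RLoad (if c then IAdd (IAdd u u) (IConst 1) else IAdd u u).

(** Squaring the distance avoids the square root, which is not an instruction. [TX] and [TY] ask
    whether the second point exceeds the first by more than 1/2 in one coordinate; doubling makes
    the literals integral. *)
Definition rtestb (t : rtest) (u v : iexp) : bexp :=
  match t with
  | TAdj => BRLe (RAdd (RMul (RSub (rxc false u) (rxc false v))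
                             (RSub (rxc false u) (rxc false v)))
                       (RMul (RSub (rxc true u) (rxc true v))
                             (RSub (rxc true u) (rxc true v)))) (RConst 1)
  | TX => BNot (BRLe (RAdd (rxc false v) (rxc false v))
                     (RAdd (RAdd (rxc false u) (rxc false u)) (RConst 1)))
  | TY => BNot (BRLe (RAdd (rxc true v) (rxc true v))
                     (RAdd (RAdd (rxc true u) (rxc true u)) (RConst 1)))
  end.

Section Semantics.
Variables (R : realType) (r : int -> R).

Definition rtestv (t : rtest) (u v : int) : bool :=
  beval (State (fun=> 0) r) (rtestb t (IConst u) (IConst v)).

Fixpoint ev (arr : name -> int -> int) (env : nat -> int) (e : ex) : int :=
  match e with
  | EC z => z
  | EV x => env x
  | EL a e1 => arr a (ev arr env e1)
  | EAdd e1 e2 => ev arr env e1 + ev arr env e2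
  | ESub e1 e2 => ev arr env e1 - ev arr env e2
  | EIf e1 e2 e3 e4 => if ev arr env e1 <= ev arr env e2 then ev arr env e3
                       else ev arr env e4
  | ER t e1 e2 => (rtestv t (ev arr env e1) (ev arr env e2) : nat)%:Z
  | EFold b x y e0 e1 =>
      foldn (fun i acc => ev arr (setv y acc (setv x i%:Z env)) e1)
            (ev arr env e0) (iters (env b))
  end.
End Semantics.

Definition dbl (e : iexp) := IAdd e e.
(** Without multiplication, the factor 16 is reached by four doublings. *)
Definition aE (c : nat) (e : iexp) : iexp :=
  ISub (IConst (- (c%:Z + 1))) (dbl (dbl (dbl (dbl e)))).
Definition ld (a : int) : iexp := ILoad (IConst a).
Definition store (a : int) (e : iexp) : cmd := CIStore (IConst a) e.

(** The value ends in temporary [j], and no temporary below [j] is touched. A fold saves the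
    variables that it rebinds in the temporaries [j + 1] and [j + 2] and restores them at the end;
    [j + 3] holds the bound and [j + 4] the counter. *)
Fixpoint comp (e : ex) (j : nat) : cmd :=
  match e with
  | EC z => store (tmp j) (IConst z)
  | EV x => store (tmp j) (ld (vaddr x))
  | EL a e1 => CSeq (comp e1 j) (store (tmp j) (ILoad (aE (code a) (ld (tmp
    j)))))
  | EAdd e1 e2 => CSeq (comp e1 j) (CSeq (comp e2 j.+1)
      (store (tmp j) (IAdd (ld (tmp j)) (ld (tmp j.+1)))))
  | ESub e1 e2 => CSeq (comp e1 j) (CSeq (comp e2 j.+1)
      (store (tmp j) (ISub (ld (tmp j)) (ld (tmp j.+1)))))
  | EIf e1 e2 e3 e4 => CSeq (comp e1 j) (CSeq (comp e2 j.+1)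
      (CIf (BILe (ld (tmp j)) (ld (tmp j.+1))) (comp e3 j) (comp e4 j)))
  | ER t e1 e2 => CSeq (comp e1 j) (CSeq (comp e2 j.+1)
      (CIf (rtestb t (ld (tmp j)) (ld (tmp j.+1)))
           (store (tmp j) (IConst 1)) (store (tmp j) (IConst 0))))
  | EFold b x y e0 e1 =>
      CSeq (comp e0 j)
     (CSeq (store (tmp j.+1) (ld (vaddr x)))
     (CSeq (store (tmp j.+2) (ld (vaddr y)))
     (CSeq (store (tmp j.+3) (ld (vaddr b)))
     (CSeq (store (tmp j.+4) (IConst 0))
     (CSeq (CWhile (BILe (IAdd (ld (tmp j.+4)) (IConst 1)) (ld (tmp j.+3)))
        (CSeq (store (vaddr x) (ld (tmp j.+4)))
        (CSeq (store (vaddr y) (ld (tmp j)))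
        (CSeq (comp e1 j.+4.+1)
        (CSeq (store (tmp j) (ld (tmp j.+4.+1)))
              (store (tmp j.+4) (IAdd (ld (tmp j.+4)) (IConst 1))))))))
     (CSeq (store (vaddr y) (ld (tmp j.+2)))
           (store (vaddr x) (ld (tmp j.+1)))))))))
  end.

(** An upper bound with slack in the constants: both branches of a conditional are charged, and
    every fold is charged [B] rounds, which makes the cost polynomial in [B]. *)
Fixpoint ecost (B : nat) (e : ex) : nat :=
  match e with
  | EC _ | EV _ => 100
  | EL _ e1 => ecost B e1 + 100
  | EAdd e1 e2 | ESub e1 e2 | ER _ e1 e2 => ecost B e1 + ecost B e2 + 200
  | EIf e1 e2 e3 e4 =>
      ecost B e1 + ecost B e2 + ecost B e3 + ecost B e4 + 100
  | EFold _ _ _ e0 e1 => ecost B e0 + (B * (ecost B e1 + 100) + 100)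
  end.

(* The variables below 8 bound the loops; they are not rebound inside an
   expression, so that a bound on their values bounds all the loops. *)
Fixpoint wfe (e : ex) : bool :=
  match e with
  | EC _ | EV _ => true
  | EL _ e1 => wfe e1
  | EAdd e1 e2 | ESub e1 e2 | ER _ e1 e2 => wfe e1 && wfe e2
  | EIf e1 e2 e3 e4 => [&& wfe e1, wfe e2, wfe e3 & wfe e4]
  | EFold b x y e0 e1 => [&& b < 8, 8 <= x, 8 <= y, wfe e0 & wfe e1]%N
  end.

Definition bok (B : nat) (env : nat -> int) : Prop :=
  forall b, (b < 8)%N -> (iters (env b) <= B)%N.

Section Exec.
Variable R : realType.
Implicit Types (S : state R) (r : int -> R).

Definition wpx (c : cmd) (T : nat) (Q : state R -> Prop) (S : state R) : Prop :=
  exists t S', [/\ exec c S t S', (t <= T)%N & Q S'].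

Lemma wpx_seq c1 c2 T1 T2 Q S :
  wpx c1 T1 (wpx c2 T2 Q) S -> wpx (CSeq c1 c2) (T1 + T2) Q S.
Proof.
move=> [t1 [S1 [E1 le1 [t2 [S2 [E2 le2 HQ]]]]]].
exists (t1 + t2)%N, S2; split=> //; first exact: ExecSeq E1 E2.
exact: leq_add.
Qed.

Lemma wpx_conseq c T1 T2 (Q1 Q2 : state R -> Prop) S :
  (T1 <= T2)%N -> (forall S', Q1 S' -> Q2 S') -> wpx c T1 Q1 S -> wpx c T2 Q2 S.
Proof.
move=> leT QQ [t [S' [E le HQ]]]; exists t, S'; split=> //; last exact: QQ.
exact: leq_trans leT.
Qed.

Lemma wpx_st a e T Q S :
  ((icost e).+2 <= T)%N -> Q (State (upd (imem S) a (ieval S e)) (rmem S)) ->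
  wpx (store a e) T Q S.
Proof.
move=> le HQ; eexists; eexists; split; first exact: ExecIStore.
  by rewrite /=; lia.
exact: HQ.
Qed.

Lemma wpx_if b c1 c2 T' T Q S :
  (bcost b + T' < T)%N -> wpx (if beval S b then c1 else c2) T' Q S ->
  wpx (CIf b c1 c2) T Q S.
Proof.
move=> ltT [t [S' [E le HQ]]]; exists (bcost b + t).+1, S'; split=> //.
  case: (boolP (beval S b)) E => [Hb|Hb] E; first exact: ExecIfTrue.
  exact: ExecIfFalse.
by apply: leq_trans ltT; rewrite ltnS leq_add2l.
Qed.

Lemma wpx_while (b : bexp) (c : cmd) (I : nat -> state R -> Prop) N T T' S :
  (N * (bcost b + T + 1) + (bcost b + 1) <= T')%N ->
  (forall i S', (i < N)%N -> I i S' -> beval S' b /\ wpx c T (I i.+1) S') ->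
  (forall S', I N S' -> ~~ beval S' b) ->
  I 0%N S -> wpx (CWhile b c) T' (I N) S.
Proof.
move=> leT Hstep Hend.
suff main q i S' : (i + q)%N = N -> I i S' ->
    wpx (CWhile b c) (q * (bcost b + T + 1) + (bcost b + 1)) (I N) S'.
  by move=> I0; apply: wpx_conseq leT _ (main N 0%N _ _ I0).
elim: q i S' => [|q IH] i S' Eq Ii.
  rewrite addn0 in Eq; subst i.
  exists (bcost b).+1, S'; split; [|by lia|by []].
  by apply: ExecWhileFalse; apply: Hend.
have ltiN : (i < N)%N by lia.
have [Hb [t1 [S1 [E1 le1 I1]]]] := Hstep i S' ltiN Ii.
have [|t2 [S2 [E2 le2 I2]]] := IH i.+1 S1 _ I1; first by lia.
exists (bcost b + t1 + t2).+1, S2; split=> //; first exact: ExecWhileTrue E2.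
by rewrite mulSn; lia.
Qed.

Definition ahi (j : nat) (a : int) : Prop := exists2 i, (j <= i)%N & a = tmp i.

Definition keep (j : nat) (S S' : state R) : Prop :=
  rmem S' = rmem S /\ forall a, ~ ahi j a -> imem S' a = imem S a.

Lemma keep_trans j S1 S2 S3 : keep j S1 S2 -> keep j S2 S3 -> keep j S1 S3.
Proof. by move=> [r1 k1] [r2 k2]; split=> [|a na]; rewrite ?r2 // k2 // k1. Qed.

Lemma keep_le i j S S' : (i <= j)%N -> keep j S S' -> keep i S S'.
Proof.
move=> le [rr k]; split=> // a na; apply: k => -[l lel Ea].
by apply: na; exists l => //; apply: leq_trans lel.
Qed.

Lemma keep_upd j i S z :
  (j <= i)%N -> keep j S (State (upd (imem S) (tmp i) z) (rmem S)).
Proof.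
move=> le; split=> // a na /=; rewrite /upd; case: eqP => // Ea.
by case: na; exists i.
Qed.

Lemma vaddr_ahi j x : ~ ahi j (vaddr x).
Proof. by case=> i _; rewrite /vaddr /tmp /addr; lia. Qed.

Lemma code_lt a : (0 < code a < 10)%N. Proof. by case: a. Qed.

Lemma arr_ahi j a z : ~ ahi j (addr (code a) z).
Proof. by case=> i _; rewrite /tmp /addr; have := code_lt a; lia. Qed.

Lemma tmp_ahi i j : (i < j)%N -> ~ ahi j (tmp i).
Proof. by move=> lt [l le]; rewrite /tmp /addr; lia. Qed.

Lemma tmp_eq i j : (tmp i == tmp j) = (i == j).
Proof. by apply/eqP/eqP => [|-> //]; rewrite /tmp /addr; lia. Qed.

Lemma vaddr_eq i j : (vaddr i == vaddr j) = (i == j).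
Proof. by apply/eqP/eqP => [|-> //]; rewrite /vaddr /addr; lia. Qed.

Lemma vaddr_tmp i j : (vaddr i == tmp j) = false.
Proof. by apply/eqP; rewrite /vaddr /tmp /addr; lia. Qed.

Lemma tmp_vaddr i j : (tmp i == vaddr j) = false.
Proof. by apply/eqP; rewrite /vaddr /tmp /addr; lia. Qed.

Lemma arr_vaddr a z j : (addr (code a) z == vaddr j) = false.
Proof. by apply/eqP; rewrite /vaddr /addr; have := code_lt a; lia. Qed.

Lemma vaddr_arr a z j : (vaddr j == addr (code a) z) = false.
Proof. by rewrite eq_sym arr_vaddr. Qed.

(** Codes are smaller than 16, so an address determines both the code and the index. *)
Lemma arr_arr a b z t :
  (addr (code a) z == addr (code b) t) = name_eqb a b && (z == t).
Proof.
have ca := code_lt a; have cb := code_lt b; rewrite /name_eqb /addr.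
apply/eqP/andP => [E|[/eqnP -> /eqP ->]] //.
by split; [apply/eqnP|apply/eqP]; lia.
Qed.

Definition rel_st (S : state R) (arr : name -> int -> int) (env : nat -> int) :=
  (forall x, imem S (vaddr x) = env x) /\
  (forall a z, imem S (addr (code a) z) = arr a z).

Lemma rel_keep j S S' arr env :
  keep j S S' -> rel_st S arr env -> rel_st S' arr env.
Proof.
move=> [_ k] [hv ha]; split=> [x|a z]; rewrite k //; first exact: vaddr_ahi.
exact: arr_ahi.
Qed.

Lemma rel_setv S arr env x z :
  rel_st S arr env ->
  rel_st (State (upd (imem S) (vaddr x) z) (rmem S)) arr (setv x z env).
Proof.
move=> [hv ha]; split=> [y|a t] /=; rewrite /upd.
  by rewrite vaddr_eq /setv hv; case: eqnP; case: eqP.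
by rewrite arr_vaddr.
Qed.

Lemma rel_seta S arr env a z v :
  rel_st S arr env ->
  rel_st (State (upd (imem S) (addr (code a) z) v) (rmem S))
    (seta a z v arr) env.
Proof.
move=> [hv ha]; split=> [y|b t] /=; rewrite /upd; first by rewrite vaddr_arr.
by rewrite arr_arr /seta ha.
Qed.

Lemma rtestb_ld S t i j :
  beval S (rtestb t (ld i) (ld j)) = rtestv (rmem S) t (imem S i) (imem S j).
Proof. by case: t. Qed.

Lemma ieval_aE S c e : ieval S (aE c e) = addr c (ieval S e).
Proof. by rewrite /= /addr; lia. Qed.

Lemma bok_set B x z env : (8 <= x)%N -> bok B env -> bok B (setv x z env).
Proof.
move=> le8 Hb b ltb; rewrite /setv; case: eqnP => [E|_]; last exact: Hb.
by lia.
Qed.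

Lemma comp_ok e : forall B arr env j S, wfe e -> bok B env ->
  rel_st S arr env ->
  wpx (comp e j) (ecost B e)
    (fun S' => keep j S S' /\ imem S' (tmp j) = ev (rmem S) arr env e) S.
Proof.
(* Common prefix of the binary constructs: the second operand is compiled one temporary higher and
   so preserves the value of the first. *)
have bin e1 e2 B arr env j S (T : nat) c (Q : state R -> Prop) :
   (forall B arr env j S, wfe e1 -> bok B env -> rel_st S arr env ->
      wpx (comp e1 j) (ecost B e1)
    (fun S' => keep j S S' /\ imem S' (tmp j) = ev (rmem S) arr env e1) S) ->
   (forall B arr env j S, wfe e2 -> bok B env -> rel_st S arr env ->
      wpx (comp e2 j) (ecost B e2)
    (fun S' => keep j S S' /\ imem S' (tmp j) = ev (rmem S) arr env e2) S) ->
   wfe e1 && wfe e2 -> bok B env -> rel_st S arr env ->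
   (forall S', keep j S S' -> rel_st S' arr env ->
      imem S' (tmp j) = ev (rmem S) arr env e1 ->
      imem S' (tmp j.+1) = ev (rmem S) arr env e2 -> wpx c T Q S') ->
   wpx (CSeq (comp e1 j) (CSeq (comp e2 j.+1) c))
     (ecost B e1 + (ecost B e2 + T)) Q S.
  move=> IH1 IH2 /andP[w1 w2] Hb Hr HQ; apply: wpx_seq.
  apply: wpx_conseq (IH1 _ _ _ j _ w1 Hb Hr) => // S1 [k1 E1].
  have Hr1 := rel_keep k1 Hr.
  apply: wpx_seq; apply: wpx_conseq (IH2 _ _ _ j.+1 _ w2 Hb Hr1) => //.
  move=> S2 [k2 E2]; have k12 := keep_trans k1 (keep_le (leqnSn j) k2).
  apply: HQ => //; first exact: rel_keep k12 Hr.
    by rewrite (proj2 k2) //; apply: tmp_ahi.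
  by rewrite E2 (proj1 k1).
elim: e.
- move=> z B arr env j S _ _ _; apply: wpx_st => //=.
  by split; [exact: keep_upd|rewrite /upd eqxx].
- move=> x B arr env j S _ _ [hv _]; apply: wpx_st => //=.
  by split; [exact: keep_upd|rewrite /upd eqxx hv].
- move=> a e IH B arr env j S wf Hb Hr /=; apply: wpx_seq.
  apply: wpx_conseq (IH _ _ _ j _ wf Hb Hr) => // S1 [k1 E1].
  apply: wpx_st => //; split.
    by apply: keep_trans k1 _; exact: keep_upd.
  have := ieval_aE S1 (code a) (ld (tmp j)).
  rewrite /= /upd eqxx E1 => ->.
  by have [_ ->] := rel_keep k1 Hr.
- move=> e1 IH1 e2 IH2 B arr env j S wf Hb Hr /=.
  rewrite -addnA; apply: (bin _ _ B arr env) => // S' k _ E1 E2.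
  apply: wpx_st => //=; split; last by rewrite /upd eqxx E1 E2.
  by apply: keep_trans k _; exact: keep_upd.
- move=> e1 IH1 e2 IH2 B arr env j S wf Hb Hr /=.
  rewrite -addnA; apply: (bin _ _ B arr env) => // S' k _ E1 E2.
  apply: wpx_st => //=; split; last by rewrite /upd eqxx E1 E2.
  by apply: keep_trans k _; exact: keep_upd.
- move=> e1 IH1 e2 IH2 e3 IH3 e4 IH4 B arr env j S /= /and4P[w1 w2 w3 w4] Hb Hr.
  rewrite -!addnA; apply: (bin _ _ B arr env) => //; first by rewrite w1.
  move=> S' k Hr' E1 E2; rewrite addnA addnC.
  apply: (@wpx_if _ _ _ (ecost B e3 + ecost B e4)) => /=; first by lia.
  rewrite E1 E2.
  case: ifP => _.
    apply: wpx_conseq (IH3 _ _ _ j _ w3 Hb Hr') => [|S'' [k' ->]]; first by lia.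
    by split; [exact: keep_trans k k'|rewrite (proj1 k)].
  apply: wpx_conseq (IH4 _ _ _ j _ w4 Hb Hr') => [|S'' [k' ->]]; first by lia.
  by split; [exact: keep_trans k k'|rewrite (proj1 k)].
- move=> t e1 IH1 e2 IH2 B arr env j S wf Hb Hr /=.
  rewrite -addnA; apply: (bin _ _ B arr env) => // S' k Hr' E1 E2.
  apply: (@wpx_if _ _ _ 100); first by case: t {wf}.
  rewrite rtestb_ld E1 E2 (proj1 k).
  case: (rtestv _ _ _ _); apply: wpx_st => //=; split; rewrite /upd ?eqxx //.
    by apply: keep_trans k _; exact: keep_upd.
  by apply: keep_trans k _; exact: keep_upd.
- move=> b x y e0 IH0 e1 IH1 B arr env j S /= /and5P[ltb lex ley w0 w1] Hb Hr.
  apply: wpx_seq; apply: wpx_conseq (IH0 _ _ _ j _ w0 Hb Hr) => // S0 [k0 E0].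
  have Hr0 := rel_keep k0 Hr.
  (* The budget is split along the sequence: the four initial stores, the loop and the two
     restores. *)
  have -> : (B * (ecost B e1 + 100) + 100 =
     10 + (10 + (10 + (10 + ((B * (ecost B e1 + 100) + 20)
       + (20 + 20))))))%N by lia.
  apply: wpx_seq; apply: wpx_st => //=; set S1 := State _ _.
  have k1 : keep j S0 S1 by apply: keep_upd.
  apply: wpx_seq; apply: wpx_st => //=; set S2 := State _ _.
  have k2 : keep j S1 S2 by apply: keep_upd; lia.
  apply: wpx_seq; apply: wpx_st => //=; set S3 := State _ _.
  have k3 : keep j S2 S3 by apply: keep_upd; lia.
  apply: wpx_seq; apply: wpx_st => //=; set S4 := State _ _.
  have k4 : keep j S3 S4 by apply: keep_upd; lia.
  have k04 : keep j S S4.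
    do 4![apply: keep_trans; last eassumption]; exact: k0.
  have [hv ha] := Hr.
  have M0 : imem S4 (tmp j) = ev (rmem S) arr env e0.
    by rewrite /S4 /S3 /S2 /S1 /= /upd !tmp_eq /=; do ?case: eqP => [|_]; lia.
  have M1 : imem S4 (tmp j.+1) = env x.
    rewrite /S4 /S3 /S2 /S1 /= /upd !tmp_eq /= !vaddr_tmp -(proj1 Hr0).
    by do ?case: eqP => [|_] //; lia.
  have M2 : imem S4 (tmp j.+2) = env y.
    rewrite /S4 /S3 /S2 /S1 /= /upd !tmp_eq /= !vaddr_tmp -(proj1 Hr0).
    by do ?case: eqP => [|_] //; lia.
  have M3 : imem S4 (tmp j.+3) = env b.
    rewrite /S4 /S3 /S2 /S1 /= /upd !tmp_eq /= !vaddr_tmp -(proj1 Hr0).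
    by do ?case: eqP => [|_] //; lia.
  have M4 : imem S4 (tmp j.+4) = 0.
    by rewrite /S4 /= /upd eqxx.
  clearbody S4; clear S1 S2 S3 k1 k2 k3 k4 S0 k0 E0 Hr0.
  set f := fun i acc => ev (rmem S) arr (setv y acc (setv x i%:Z env)) e1.
  set a0 := ev (rmem S) arr env e0 in M0 *.
  (* The rebound variables are exempt from the frame condition during the loop; afterwards the saved
     values put them back. *)
  pose I i (S' : state R) :=
    [/\ rmem S' = rmem S,
        (forall a, ~ ahi j a -> a <> vaddr x -> a <> vaddr y ->
            imem S' a = imem S a),
        imem S' (tmp j) = foldn f a0 i,
        imem S' (tmp j.+4) = i%:Z &
        [/\ imem S' (tmp j.+1) = env x, imem S' (tmp j.+2) = env y &
            imem S' (tmp j.+3) = env b]].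
  apply: wpx_seq.
  apply: (@wpx_conseq _ (B * (ecost B e1 + 100) + 20) _ (I (iters (env b)))) =>
    //.
  + move=> S5 [r5 m5 T0 T4 [T1 T2 T3]].
    apply: wpx_seq; apply: wpx_st => //=.
    apply: wpx_st => //=; split; last first.
      by rewrite /upd !tmp_vaddr.
    split=> //= a na; rewrite /upd tmp_vaddr T1 T2.
    case: eqP => [->|nx]; first by rewrite hv.
    case: eqP => [->|ny]; first by rewrite hv.
    exact: m5.
  + apply: (@wpx_while (BILe (IAdd (ld (tmp j.+4)) (IConst 1)) (ld (tmp j.+3)))
      _ I
        _ (10 + (10 + (ecost B e1 + (10 + 10))))).
    * apply: leq_add => //; apply: leq_mul; first exact: Hb.
      by rewrite /=; lia.
    * move=> i S' lti [r5 m5 T0 T4 [T1 T2 T3]]; split.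
        by rewrite /= T4 T3; case: (env b) lti => //= q; lia.
      apply: wpx_seq; apply: wpx_st => //=.
      apply: wpx_seq; apply: wpx_st => //=.
      set S6 := State _ _.
      have Hr6 : rel_st S6 arr (setv y (foldn f a0 i) (setv x i%:Z env)).
        split=> [z|a z]; rewrite /S6 /= /upd !tmp_vaddr ?arr_vaddr.
          rewrite !vaddr_eq T0 T4 /setv.
          case: eqnP; case: eqP => // nzy _; case: eqnP; case: eqP => // nzx _.
          rewrite m5 ?hv //; first exact: vaddr_ahi.
          by move/eqP; rewrite vaddr_eq => /eqP.
          by move/eqP; rewrite vaddr_eq => /eqP.
        rewrite m5 ?ha //; first exact: arr_ahi.
        by move/eqP; rewrite arr_vaddr.
        by move/eqP; rewrite arr_vaddr.
      have T6 l z : imem S' (tmp l) = z -> imem S6 (tmp l) = z.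
        by move=> <-; rewrite /S6 /= /upd !tmp_vaddr.
      have m6 a : ~ ahi j a -> a <> vaddr x -> a <> vaddr y ->
           imem S6 a = imem S a.
        move=> na nx ny; rewrite /S6 /= /upd.
        by case: eqP => //; case: eqP => // *; apply: m5.
      have r6 : rmem S6 = rmem S by [].
      apply T6 in T0; apply T6 in T1; apply T6 in T2; apply T6 in T3;
        apply T6 in T4; clear T6; clearbody S6.
      apply: wpx_seq.
      apply: wpx_conseq (IH1 B _ _ j.+4.+1 _ w1 _ Hr6) => //; last first.
        by apply: bok_set => //; apply: bok_set.
      move=> S7 [[r7 k7] E7].
      have T7 l z : (l < j.+4.+1)%N -> imem S6 (tmp l) = z ->
        imem S7 (tmp l) = z.
        by move=> ltl <-; rewrite k7 //; apply: tmp_ahi.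
      apply T7 in T0; last by lia.
      apply T7 in T1; last by lia.
      apply T7 in T2; last by lia.
      apply T7 in T3; last by lia.
      apply T7 in T4; last by lia.
      apply: wpx_seq; apply: wpx_st => //=.
      apply: wpx_st => //=.
      split=> //=; rewrite ?r7 //.
      -- move=> a na nx ny; rewrite /upd !tmp_eq.
         case: eqP => [Ea|_]; first by case: na; exists j.+4 => //; lia.
         case: eqP => [Ea|_]; first by case: na; exists j => //; lia.
         rewrite k7 ?m6 // => -[l lel Ea]; case: na; exists l => //; lia.
      -- rewrite /upd !tmp_eq; case: eqP => [|_]; first by lia.
         by rewrite eqxx E7 r6.
      -- by rewrite /upd !tmp_eq eqxx T4; case: eqP => [|_]; lia.
      -- by split; rewrite /upd !tmp_eq; do ?case: eqP => [|_] //; lia.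
    * move=> S' [_ _ _ T4 [_ _ T3]] /=; rewrite T4 T3.
      by case: (env b) => //= q; lia.
    * split=> //; first exact: (proj1 k04).
      by move=> a na _ _; apply: (proj2 k04).
Qed.

End Exec.

(** * Statements and their program logic with time budgets *)

Inductive stmt :=
| SSkip
| SV of nat & ex
| SA of name & ex & ex
| SSeq of stmt & stmt
| SIf of ex & ex & stmt & stmt
| SFor of nat & nat & stmt.

(** A loop keeps its bound and counter in temporaries, so its body may overwrite the variables [b]
    and [x]. *)
Fixpoint scomp (s : stmt) (j : nat) : cmd :=
  match s with
  | SSkip => CSkip
  | SV x e => CSeq (comp e j) (store (vaddr x) (ld (tmp j)))
  | SA a e1 e2 => CSeq (comp e1 j) (CSeq (comp e2 j.+1)
      (CIStore (aE (code a) (ld (tmp j))) (ld (tmp j.+1))))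
  | SSeq s1 s2 => CSeq (scomp s1 j) (scomp s2 j)
  | SIf e1 e2 s1 s2 => CSeq (comp e1 j) (CSeq (comp e2 j.+1)
      (CIf (BILe (ld (tmp j)) (ld (tmp j.+1))) (scomp s1 j) (scomp s2 j)))
  | SFor b x s1 =>
      CSeq (store (tmp j) (ld (vaddr b)))
     (CSeq (store (tmp j.+1) (IConst 0))
     (CWhile (BILe (IAdd (ld (tmp j.+1)) (IConst 1)) (ld (tmp j)))
        (CSeq (store (vaddr x) (ld (tmp j.+1)))
        (CSeq (scomp s1 j.+2)
              (store (tmp j.+1) (IAdd (ld (tmp j.+1)) (IConst 1)))))))
  end.

Fixpoint scost (B : nat) (s : stmt) : nat :=
  match s with
  | SSkip => 1
  | SV _ e => ecost B e + 10
  | SA _ e1 e2 => ecost B e1 + ecost B e2 + 100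
  | SSeq s1 s2 => scost B s1 + scost B s2
  | SIf e1 e2 s1 s2 =>
      ecost B e1 + ecost B e2 + scost B s1 + scost B s2 + 100
  | SFor _ _ s1 => B * (scost B s1 + 100) + 100
  end.

Section Hoare.
Variables (R : realType) (r : int -> R) (B : nat).
Implicit Types (S : state R) (arr : name -> int -> int) (env : nat -> int).
Implicit Type Q : (name -> int -> int) -> (nat -> int) -> Prop.

(** The temporaries below [j] must survive because they hold the bounds and counters of the
    enclosing loops. *)
Definition sok (j : nat) (S : state R) Q (S' : state R) : Prop :=
  [/\ rmem S' = r, forall i, (i < j)%N -> imem S' (tmp i) = imem S (tmp i) &
      exists arr env, rel_st S' arr env /\ Q arr env].

Definition ok (s : stmt) arr env Q : Prop :=
  forall j S, rmem S = r -> rel_st S arr env ->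
  wpx (scomp s j) (scost B s) (sok j S Q) S.

Lemma ok_conseq s arr env Q1 Q2 :
  (forall arr' env', Q1 arr' env' -> Q2 arr' env') ->
  ok s arr env Q1 -> ok s arr env Q2.
Proof.
move=> QQ H j S rS HS; apply: wpx_conseq (H j S rS HS) =>
  // S' [r' T [a [e [h q]]]].
by split=> //; exists a, e; split=> //; apply: QQ.
Qed.

Lemma ok_skip arr env Q : Q arr env -> ok SSkip arr env Q.
Proof.
move=> HQ j S rS HS; exists 1%N, S; split=> //; first exact: ExecSkip.
by split=> //; exists arr, env.
Qed.

Lemma ok_seq s1 s2 arr env Q :
  ok s1 arr env (fun arr' env' => ok s2 arr' env' Q) ->
  ok (SSeq s1 s2) arr env Q.
Proof.
move=> H j S rS HS; apply: wpx_seq.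
apply: wpx_conseq (H j S rS HS) => // S1 [r1 T1 [a1 [e1 [h1 q1]]]].
apply: wpx_conseq (q1 j S1 r1 h1) => // S2 [r2 T2 HQ].
by split=> // i lti; rewrite T2 // T1.
Qed.

Lemma ok_set x e arr env Q :
  wfe e -> bok B env -> Q arr (setv x (ev r arr env e) env) ->
  ok (SV x e) arr env Q.
Proof.
move=> wf Hb HQ j S rS HS; apply: wpx_seq.
apply: wpx_conseq (comp_ok j wf Hb HS) => // S1 [k1 E1].
apply: wpx_st => //=; split=> /=.
- by rewrite (proj1 k1).
- move=> i lti; rewrite /upd tmp_vaddr (proj2 k1) //; exact: tmp_ahi.
- exists arr, (setv x (ev r arr env e) env); split=> //.
  rewrite E1 rS; apply: rel_setv; exact: rel_keep k1 HS.
Qed.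

Lemma comp2_ok e1 e2 arr env j S T c (Q : state R -> Prop) :
  wfe e1 -> wfe e2 -> bok B env -> rmem S = r -> rel_st S arr env ->
  (forall S', keep j S S' -> rel_st S' arr env ->
     imem S' (tmp j) = ev r arr env e1 ->
     imem S' (tmp j.+1) = ev r arr env e2 -> wpx c T Q S') ->
  wpx (CSeq (comp e1 j) (CSeq (comp e2 j.+1) c))
    (ecost B e1 + (ecost B e2 + T)) Q S.
Proof.
move=> w1 w2 Hb rS HS H; apply: wpx_seq.
apply: wpx_conseq (comp_ok j w1 Hb HS) => // S1 [k1 E1].
have HS1 := rel_keep k1 HS.
apply: wpx_seq; apply: wpx_conseq (comp_ok j.+1 w2 Hb HS1) => // S2 [k2 E2].
have k12 := keep_trans k1 (keep_le (leqnSn j) k2).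
apply: H => //; first exact: rel_keep k12 HS.
  by rewrite (proj2 k2) ?E1 ?rS //; apply: tmp_ahi.
by rewrite E2 (proj1 k1) rS.
Qed.

Lemma ok_sta a e1 e2 arr env Q :
  wfe e1 -> wfe e2 -> bok B env ->
  Q (seta a (ev r arr env e1) (ev r arr env e2) arr) env ->
  ok (SA a e1 e2) arr env Q.
Proof.
move=> w1 w2 Hb HQ j S rS HS; rewrite /= -addnA.
apply: (comp2_ok w1 w2 Hb rS HS) => S' k HS' E1 E2.
exists ((icost (aE (code a) (ld (tmp j))) + icost (ld (tmp j.+1))).+1),
  (State (upd (imem S') (ieval S' (aE (code a) (ld (tmp j)))) (ieval S' (ld
  (tmp j.+1)))) (rmem S')); split.
- exact: ExecIStore.
- by [].
- rewrite ieval_aE /=; split=> /=.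
  + by rewrite (proj1 k).
  + move=> i lti; rewrite /upd; case: eqP => [E|_].
      by case: (@arr_ahi i a (imem S' (tmp j))); exists i.
    by rewrite (proj2 k) //; apply: tmp_ahi.
  + exists (seta a (ev r arr env e1) (ev r arr env e2) arr), env; split=> //.
    by rewrite E1 E2; apply: rel_seta.
Qed.

Lemma ok_if e1 e2 s1 s2 arr env Q :
  wfe e1 -> wfe e2 -> bok B env ->
  (if ev r arr env e1 <= ev r arr env e2 then ok s1 arr env Q
   else ok s2 arr env Q) ->
  ok (SIf e1 e2 s1 s2) arr env Q.
Proof.
move=> w1 w2 Hb HQ j S rS HS; rewrite /= -!addnA.
apply: (comp2_ok w1 w2 Hb rS HS) => S' k HS' E1 E2.
apply: (@wpx_if _ _ _ _ (scost B s1 + scost B s2)) => /=; first by lia.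
have rS' : rmem S' = r by rewrite (proj1 k).
have Hk S'' : sok j S' Q S'' -> sok j S Q S''.
  case=> ? T ?; split=> // i lti; rewrite T // (proj2 k) //; exact: tmp_ahi.
rewrite E1 E2; case: ifP HQ => _ HQ.
  by apply: wpx_conseq (HQ j S' rS' HS') => //; exact: leq_addr.
by apply: wpx_conseq (HQ j S' rS' HS') => //; exact: leq_addl.
Qed.

Lemma ok_for b x s arr env Q (I : nat -> _ -> _ -> Prop) N :
  iters (env b) = N -> (N <= B)%N -> I 0%N arr env ->
  (forall i arr' env', (i < N)%N -> I i arr' env' ->
     ok s arr' (setv x i%:Z env') (I i.+1)) ->
  (forall arr' env', I N arr' env' -> Q arr' env') ->
  ok (SFor b x s) arr env Q.
Proof.
move=> EN leN I0 Hstep IQ j S rS HS.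
apply: (@wpx_conseq _ _ (4 + (4 + (B * (scost B s + 100) + 20)))) => [||];
  last first.
- apply: wpx_seq; apply: wpx_st => //=; set S1 := State _ _.
  have k1 : keep j S S1 by apply: keep_upd.
  apply: wpx_seq; apply: wpx_st => //=; set S2 := State _ _.
  have k2 : keep j S1 S2 by apply: keep_upd; lia.
  have M0 : imem S2 (tmp j) = env b.
    by rewrite /S2 /S1 /= /upd !tmp_eq eqxx (proj1 HS); case: eqP => //; lia.
  have M1 : imem S2 (tmp j.+1) = 0 by rewrite /S2 /= /upd eqxx.
  have k := keep_trans k1 k2; clearbody S2; clear S1 k1 k2.
  pose J i (S' : state R) := [/\ rmem S' = r, imem S' (tmp j) = env b,
      imem S' (tmp j.+1) = i%:Z,
      forall l, (l < j)%N -> imem S' (tmp l) = imem S (tmp l) &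
      exists arr' env', rel_st S' arr' env' /\ I i arr' env'].
  apply: (@wpx_while _ _ _ J N (4 + (scost B s + 10))).
  + apply: leq_add => //; apply: leq_mul => //=; lia.
  + move=> i S' lti [r' m0 m1 ml [arr' [env' [h' i']]]]; split.
      by rewrite /= m0 m1; case: (env b) EN => //= q; lia.
    apply: wpx_seq; apply: wpx_st => //=; set S3 := State _ _.
    apply: wpx_seq.
    have h3 : rel_st S3 arr' (setv x i%:Z env') by rewrite /S3 m1;
      apply: rel_setv.
    apply: wpx_conseq (Hstep _ _ _ lti i' j.+2 S3 r' h3) => // S4.
    move=> [r4 m4 [arr4 [env4 [h4 i4]]]].
    have n0 l : (l < j.+2)%N -> imem S4 (tmp l) = imem S' (tmp l).
      by move=> ltl; rewrite m4 // /S3 /= /upd tmp_vaddr.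
    apply: wpx_st => //=; split=> /=.
    * by rewrite r4.
    * rewrite /upd tmp_eq; case: eqP => [|_]; first by lia.
      by rewrite n0 ?m0 //; lia.
    * by rewrite /upd eqxx n0 ?m1 //; lia.
    * move=> l ltl; rewrite /upd tmp_eq; case: eqP => [|_]; first by lia.
      by rewrite n0 ?ml //; lia.
    * exists arr4, env4; split=> //.
      by apply: (@rel_keep _ j S4) h4; apply: keep_upd; lia.
  + move=> S' [_ m0 m1 _ _] /=; rewrite m0 m1.
    by case: (env b) EN => //= q; lia.
  + split=> //; first by rewrite (proj1 k).
      by move=> l ltl; rewrite (proj2 k) //; apply: tmp_ahi.
    by exists arr, env; split=> //; apply: rel_keep k HS.
- by move=> S' [r' _ _ m [arr' [env' [h' i']]]]; split=> //; exists arr', env';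
    split=> //; apply: IQ.
- by rewrite /=; lia.
Qed.

End Hoare.

(** * Costs are polynomial in the loop bound *)

Definition polyb (f : nat -> nat) : Prop :=
  exists K d, forall B, (f B <= K * B.+1 ^ d)%N.

Lemma polyb_cst c : polyb (fun=> c).
Proof. by exists c, 0%N => B; rewrite expn0 muln1. Qed.

Lemma polyb_id : polyb id.
Proof. by exists 1%N, 1%N => B; rewrite expn1 mul1n. Qed.

Lemma polyb_add f g : polyb f -> polyb g -> polyb (fun B => f B + g B)%N.
Proof.
move=> [K1 [d1 H1]] [K2 [d2 H2]]; exists (K1 + K2)%N, (d1 + d2)%N => B.
rewrite mulnDl; apply: leq_add.
  by apply: leq_trans (H1 B) _; rewrite leq_mul2l leq_pexp2l ?leq_addr ?orbT.
by apply: leq_trans (H2 B) _; rewrite leq_mul2l leq_pexp2l ?leq_addl ?orbT.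
Qed.

Lemma polyb_mul f g : polyb f -> polyb g -> polyb (fun B => f B * g B)%N.
Proof.
move=> [K1 [d1 H1]] [K2 [d2 H2]]; exists (K1 * K2)%N, (d1 + d2)%N => B.
by rewrite expnD mulnACA; apply: leq_mul.
Qed.

Lemma polyb_ecost e : polyb (ecost^~ e).
Proof.
elim: e => /= *; do ?[exact: polyb_cst | assumption | exact: polyb_id
  | apply: polyb_add | apply: polyb_mul].
Qed.

Lemma polyb_scost s : polyb (scost^~ s).
Proof.
elim: s => /= *; do ?[exact: polyb_cst | assumption | exact: polyb_id
  | exact: polyb_ecost | apply: polyb_add | apply: polyb_mul].
Qed.

(** * Dynamic program and number of states *)

Section Counting.
Local Open Scope nat_scope.

(** By induction: a set of size at most k + 1 arises from one of size at most k by adding an element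
    of [A] or nothing, and this choice has one more option than [A] has elements. *)
Lemma card_small_subsets (T : finType) (A : {set T}) k :
  #|[set X : {set T} | (X \subset A) && (#|X| <= k)]| <= #|A|.+1 ^ k.
Proof.
elim: k => [|k IH].
  rewrite expn0 -(cards1 (set0 : {set T})); apply/subset_leq_card/subsetP => X.
  by rewrite !inE leqn0 cards_eq0 => /andP[].
pose O : {set option T} := None |: [set Some x | x in A].
have cO : #|O| <= #|A|.+1.
  rewrite /O cardsU1; case: (None \notin _); rewrite ?add1n ?ltnS
    ?leq_imset_card //.
  by rewrite leqW // leq_imset_card.
pose D := setX O [set X : {set T} | (X \subset A) && (#|X| <= k)].
pose f (z : option T * {set T}) := if z.1 is Some x then x |: z.2 else z.2.
apply: (@leq_trans #|f @: D|); last first.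
  apply: leq_trans (leq_imset_card _ _) _.
  by rewrite cardsX expnS leq_mul.
apply/subset_leq_card/subsetP => X; rewrite inE => /andP[sXA leX].
case: (set_0Vmem X) => [X0|[x xX]].
  apply/imsetP; exists (None, X) => //.
  by rewrite in_setX !inE eqxx sXA X0 cards0.
apply/imsetP; exists (Some x, X :\ x); last by rewrite /f /= setD1K.
rewrite in_setX !inE /= (subset_trans (subD1set _ _) sXA) /=.
rewrite (mem_imset _ _ (@Some_inj _)) (subsetP sXA) //=.
by rewrite (cardsD1 x) xX in leX.
Qed.

(** A function is determined by the part of its graph with nonzero values. Inside one cell this is a
    set of at most [k] pairs, chosen among [q] values for each point of [F] in the cell. *)
Lemma card_local_functions (T C : finType) (cell : T -> C) (F : {set T}) q k :
  #|[set f : {ffun T -> 'I_q.+1} |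
      [forall u, (f u != ord0) ==> (u \in F)] &&
      [forall c, #|[set u | (cell u == c) && (f u != ord0)]| <= k]]|
  <= \prod_c (q * #|[set u in F | cell u == c]|).+1 ^ k.
Proof.
set FF := [set f | _].
pose A c := setX [set u in F | cell u == c] [set~ (ord0 : 'I_q.+1)].
have cA c : #|A c| = q * #|[set u in F | cell u == c]|.
  by rewrite cardsX cardsC1 card_ord mulnC.
pose G c := [set X : {set T * 'I_q.+1} | (X \subset A c) && (#|X| <= k)].
pose h (f : {ffun T -> 'I_q.+1}) : {ffun C -> {set T * 'I_q.+1}} :=
  [ffun c => [set z | [&& cell z.1 == c, f z.1 == z.2 & z.2 != ord0]]].
have inj_h : injective h.
  move=> f f' E; apply/ffunP => u.
  have Eu x : x != ord0 -> (f u == x) = (f' u == x).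
    move=> nx; have := congr1 (fun H : {ffun C ->
      {set T * 'I_q.+1}} => (u, x) \in H (cell u)) E.
    by rewrite /h /= !ffunE !inE /= eqxx nx !andbT.
  case: (eqVneq (f u) ord0) => [E0|n0].
    case: (eqVneq (f' u) ord0) => [->|n0']; first by [].
    by have := Eu _ n0'; rewrite eqxx => /eqP.
  by have := Eu _ n0; rewrite eqxx => /esym/eqP.
rewrite -(card_imset _ inj_h).
apply: (@leq_trans #|family (fun c => mem (G c))|).
  apply/subset_leq_card/subsetP => _ /imsetP[f + ->].
  rewrite inE => /andP[/forallP Hf /forallP Hk].
  apply/familyP => c; suff: h f c \in G c by []; rewrite inE; apply/andP; split.
    apply/subsetP => -[u x]; rewrite /h ffunE !inE /= => /and3P[-> /eqP <- n0].
    by rewrite n0 !andbT; apply: (implyP (Hf u)).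
  apply: leq_trans (Hk c); rewrite /h ffunE.
  set X := [set z | _].
  suff -> : #|X| = #|[set z.1 | z in X]|.
    apply/subset_leq_card/subsetP => _ /imsetP[[u x] + ->].
    by rewrite !inE /= => /and3P[-> /eqP -> ->].
  rewrite card_in_imset // => -[u x] [v y]; rewrite !inE /=.
  by move=> /and3P[_ /eqP <- _] /and3P[_ /eqP <- _] ->.
rewrite card_family; rewrite -[foldr _ _ _]/(foldr muln 1 [seq #|G c| | c : C]).
rewrite foldrE big_map big_enum /=; apply: leq_prod => c _.
by rewrite -cA card_small_subsets.
Qed.

End Counting.

Section DynamicProgram.
Local Open Scope nat_scope.
Variables (n : nat) (e : rel 'I_n) (R : {set 'I_n}) (pos : 'I_n -> nat).
Hypothesis esym : symmetric e.
Hypothesis pos_inj : {in R &, injective pos}.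

Definition dg (K : {set 'I_n}) (u : 'I_n) : nat := #|[set w in K | e u w]|.
Definition valid (K : {set 'I_n}) : bool := [forall u in K, dg K u <= 2].

Definition before (t : nat) : {set 'I_n} := [set u in R | pos u < t].
Definition at_time (t : nat) : {set 'I_n} := [set u in R | pos u == t].
Definition front (t : nat) : {set 'I_n} :=
  [set u in before t | [exists w, [&& w \in R, t <= pos w & e u w]]].

(** Degrees are shifted by one so that 0 is free to mean a deleted vertex. *)
Definition dval (K : {set 'I_n}) (u : 'I_n) : nat :=
  if u \in K then (dg K u).+1 else 0.
Definition sig (t : nat) (K : {set 'I_n}) : nat * {ffun 'I_n -> nat} :=
  (#|K|, [ffun u => if u \in front t then dval K u else 0]).

(** [K] is a set of kept vertices. One representative per signature is enough, by [sig_step]. *)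
Definition tryadd (t : nat) (L : seq {set 'I_n}) (K : {set 'I_n}) :=
  if valid K && ~~ has (fun K' => sig t K' == sig t K) L then rcons L K else L.
Definition dpstep (t : nat) (L L' : seq {set 'I_n}) : seq {set 'I_n} :=
  foldl (fun L1 K => tryadd t.+1 (tryadd t.+1 L1 K) (K :|: at_time t)) L' L.
Fixpoint dp (t : nat) : seq {set 'I_n} :=
  if t is t'.+1 then dpstep t' (dp t') [::] else [:: set0].

Lemma dg_mono (K K' : {set 'I_n}) u : K \subset K' -> dg K u <= dg K' u.
Proof.
move=> s; apply/subset_leq_card/subsetP => w; rewrite !inE => /andP[wK ->].
by rewrite (subsetP s).
Qed.

Lemma valid_sub (K K' : {set 'I_n}) : K \subset K' -> valid K' -> valid K.
Proof.
move=> s /forall_inP H; apply/forall_inP => u uK.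
exact: leq_trans (dg_mono u s) (H u (subsetP s u uK)).
Qed.

Lemma dgU (K X : {set 'I_n}) u : [disjoint K & X] ->
  dg (K :|: X) u = dg K u + dg X u.
Proof.
move=> dis; rewrite /dg -cardsUI.
have -> : [set w in K | e u w] :&: [set w in X | e u w] = set0.
  apply/setP => w; rewrite !inE; apply/negbTE/negP =>
    /andP[/andP[wK _] /andP[wX _]].
  by rewrite (disjointFr dis wK) in wX.
rewrite cards0 addn0; apply: eq_card => w; rewrite !inE.
by case: (w \in K); case: (w \in X); case: (e u w).
Qed.

Lemma at_time_le1 t : #|at_time t| <= 1.
Proof.
rewrite leqNgt; apply/negP => /card_gt1P[x [y [+ + /eqP]]].
rewrite !inE => /andP[xR /eqP Ex] /andP[yR /eqP Ey]; apply.
by apply: pos_inj => //; rewrite Ex Ey.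
Qed.

Lemma disjoint_at (K X : {set 'I_n}) t : K \subset before t ->
  X \subset at_time t ->
  [disjoint K & X].
Proof.
move=> sK sX; rewrite disjoints_subset; apply/subsetP => u uK.
rewrite inE; apply/negP => uX.
have := subsetP sK u uK; have := subsetP sX u uX; rewrite !inE.
by move=> /andP[_ /eqP ->] /andP[_]; rewrite ltnn.
Qed.

Lemma sig_front t K K' u : sig t K = sig t K' -> u \in front t ->
  (u \in K) = (u \in K') /\ (u \in K -> dg K u = dg K' u).
Proof.
move=> [_ /ffunP/(_ u)]; rewrite !ffunE => + uf; rewrite uf /dval.
by case: (u \in K); case: (u \in K') => // -[->].
Qed.

(** Equal signatures survive the same extension. A past vertex adjacent to the new one lies on the
    frontier, where [K] and [K'] agree on membership and degrees; a past vertex not adjacent to it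
    keeps its degree, which is small because [K'] is valid. *)
Lemma sig_step t (K K' X : {set 'I_n}) :
  K \subset before t -> K' \subset before t -> X \subset at_time t ->
  sig t K = sig t K' -> valid K' -> valid (K :|: X) ->
  valid (K' :|: X) /\ sig t.+1 (K' :|: X) = sig t.+1 (K :|: X).
Proof.
move=> sK sK' sX Es vK' vKX.
have dK := disjoint_at sK sX; have dK' := disjoint_at sK' sX.
(* All past neighbours of the new vertex are on the frontier, so its degree does not depend on the
   representative. *)
have dgX u : u \in X -> dg K' u = dg K u.
  move=> uX; have := subsetP sX u uX; rewrite inE => /andP[uR /eqP pu].
  apply: eq_card => w; rewrite !inE; case: (boolP (e u w));
    rewrite ?andbF // !andbT.
  move=> euw; case: (boolP (w \in before t)) => wb.
    have wf : w \in front t.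
      by rewrite inE wb; apply/existsP; exists u; rewrite uR pu leqnn esym.
    by have [->] := sig_front Es wf.
  by rewrite (negbTE (contra (subsetP sK w) wb)) (negbTE (contra (subsetP sK'
    w) wb)).
have dgF u : u \in front t -> u \in K -> dg (K' :|: X) u = dg (K :|: X) u.
  by move=> uf uK; have [_ /(_ uK) E] := sig_front Es uf; rewrite !dgU // E.
have memF u : u \in front t -> (u \in K' :|: X) = (u \in K :|: X).
  by move=> uf; have [E _] := sig_front Es uf; rewrite !inE E.
split.
  apply/forall_inP => u; rewrite inE => /orP[uK'|uX]; last first.
    rewrite dgU // dgX // -dgU //; apply: (forall_inP vKX).
    by rewrite inE uX orbT.
  case: (posnP (dg X u)) => [d0|/card_gt0P[x]].
    by rewrite dgU // d0 addn0; apply: (forall_inP vK').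
  rewrite inE => /andP[xX eux].
  have uf : u \in front t.
    have := subsetP sX x xX; rewrite !inE => /andP[xR /eqP px].
    have := subsetP sK' u uK'; rewrite inE => /andP[-> ->] /=.
    by apply/existsP; exists x; rewrite xR px leqnn.
  have [E _] := sig_front Es uf.
  by rewrite dgF ?E //; apply: (forall_inP vKX); rewrite inE E uK'.
congr pair.
  have [cK _] := Es.
  by rewrite !cardsU !disjoint_setI0 // cards0 cK.
apply/ffunP => u; rewrite !ffunE; case: ifP => // uf1.
move: uf1; rewrite inE => /andP[ub /existsP[w /and3P[wR ltw euw]]].
(* A vertex of the next frontier is either placed at time [t] or already on the frontier of time
   [t]. *)
move: ub; rewrite inE ltnS leq_eqVlt => /andP[uR /orP[/eqP pu|pu]].
  have nK : (u \in K) = false.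
    by apply/negbTE/negP => /(subsetP sK); rewrite inE pu ltnn andbF.
  have nK' : (u \in K') = false.
    by apply/negbTE/negP => /(subsetP sK'); rewrite inE pu ltnn andbF.
  rewrite /dval !inE nK nK' /=; case: ifP => // uX.
  by rewrite !dgU // dgX.
have uf : u \in front t.
  by rewrite !inE uR pu; apply/existsP; exists w; rewrite wR (ltnW ltw) euw.
rewrite /dval memF //; case: ifP => //; rewrite inE => /orP[uK|uX].
  by rewrite dgF.
by have := subsetP sX u uX; rewrite inE => /andP[_ /eqP E];
  rewrite E ltnn in pu.
Qed.

Lemma mem_tryadd t L K K0 :
  (K0 \in tryadd t L K) = (K0 \in L) ||
    [&& K0 == K, valid K & ~~ has (fun K' => sig t K' == sig t K) L].
Proof.
rewrite /tryadd; case: ifP => _.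
  by rewrite mem_rcons in_cons andbT orbC.
by rewrite andbF orbF.
Qed.

Lemma sig_tryadd t L K : valid K -> sig t K \in map (sig t) (tryadd t L K).
Proof.
move=> vK; rewrite /tryadd vK /=; case: ifP => [_|/negbFE/hasP[K' K'L /eqP <-]].
  by rewrite map_rcons mem_rcons inE eqxx.
exact: map_f.
Qed.

Lemma uniq_tryadd t L K : uniq (map (sig t) L) ->
  uniq (map (sig t) (tryadd t L K)).
Proof.
move=> u; rewrite /tryadd; case: ifP => // /andP[_ /hasPn H].
rewrite map_rcons rcons_uniq u andbT; apply/mapP => -[K' K'L E].
by have := H K' K'L; rewrite E eqxx.
Qed.

Lemma size_tryadd t L K : size (tryadd t L K) <= (size L).+1.
Proof. by rewrite /tryadd; case: ifP; rewrite ?size_rcons. Qed.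

Lemma size_dpstep t L L' : size (dpstep t L L') <= size L' + 2 * size L.
Proof.
elim: L L' => [|K L IH] L' /=; first by rewrite muln0 addn0.
apply: leq_trans (IH _) _.
have := size_tryadd t.+1 L' K.
have := size_tryadd t.+1 (tryadd t.+1 L' K) (K :|: at_time t); lia.
Qed.

(** Soundness, completeness up to signature, and absence of repetitions; the last one bounds the
    length of the list by the number of signatures. *)
Definition dpinv t (L : seq {set 'I_n}) :=
  [/\ forall K : {set 'I_n}, K \in L -> K \subset before t /\ valid K,
      forall K : {set 'I_n}, K \subset before t -> valid K ->
        sig t K \in map (sig t) L &
      uniq (map (sig t) L)].

Lemma before_step t : before t.+1 = before t :|: at_time t.
Proof.
by apply/setP => u; rewrite !inE ltnS leq_eqVlt; case: (u \in R) => //=;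
  rewrite orbC.
Qed.

Lemma dpstep_inv t L : dpinv t L -> dpinv t.+1 (dpstep t L [::]).
Proof.
move=> [sub cov _].
(* [L1] is the part of [L] already extended, [L'] the list built so far. *)
pose P (L1 L' : seq {set 'I_n}) :=
  [/\ forall K : {set 'I_n}, K \in L' -> K \subset before t.+1 /\ valid K,
     forall K X : {set 'I_n}, K \in L1 -> X = set0 \/ X = at_time t ->
       valid (K :|: X) ->
       sig t.+1 (K :|: X) \in map (sig t.+1) L' &
     uniq (map (sig t.+1) L')].
have main L1 L2 L' : P L1 L' -> L = L1 ++ L2 -> P L (dpstep t L2 L').
  elim: L2 L1 L' => [|K0 L2 IH] L1 L' PL EL /=; first by rewrite EL cats0.
  apply: (IH (rcons L1 K0)); last by rewrite cat_rcons.
  have K0L : K0 \in L by rewrite EL mem_cat inE eqxx orbT.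
  have [sK0 vK0] := sub K0 K0L.
  case: PL => [sL' cL' uL']; split.
  - move=> K; rewrite !mem_tryadd => /orP[/orP[/sL' //|]|] /and3P[/eqP-> vK _].
      by rewrite before_step (subset_trans sK0 (subsetUl _ _)).
    by rewrite before_step setSU.
  - move=> K X; rewrite mem_rcons inE => /orP[/eqP->|KL1] EX vKX.
      case: EX => EX; rewrite EX; last by apply: sig_tryadd; rewrite -EX.
      rewrite setU0; have := sig_tryadd t.+1 L' vK0.
      case/mapP => K' K'L ->; apply: map_f; by rewrite mem_tryadd K'L.
    have /mapP[K' K'L ->] := cL' K X KL1 EX vKX.
    by apply: map_f; rewrite !mem_tryadd K'L.
  - by do 2!apply: uniq_tryadd.
have [sL' cL' uL'] : P L (dpstep t L [::]).
  by apply: (main [::]).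
split=> // K sK vK.
(* The past part of [K] is replaced by its representative. The new part is empty or all of
   [at_time t], since that set has at most one element, so the step has tried it. *)
pose K0 := K :&: before t; pose X := K :&: at_time t.
have EK : K = K0 :|: X by rewrite -setIUr -before_step; symmetry;
  apply/setIidPl.
have vK0 : valid K0 by apply: valid_sub vK; apply: subsetIl.
have sK0 : K0 \subset before t := subsetIr _ _.
have sX : X \subset at_time t := subsetIr _ _.
have /mapP[K' K'L Es] := cov K0 sK0 vK0.
have [sK' vK'] := sub K' K'L.
rewrite EK in vK; have [v1 E1] := sig_step sK0 sK' sX Es vK' vK.
rewrite EK -E1; apply: cL' => //.
case: (set_0Vmem X) => [|[x xX]]; first by left.
right; apply/eqP; rewrite eqEcard sX /=.
apply: leq_trans (at_time_le1 t) _; by apply/card_gt0P; exists x.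
Qed.

Lemma dp_inv t : dpinv t (dp t).
Proof.
elim: t => [|t IH]; last exact: dpstep_inv.
have b0 : before 0 = set0 by apply/setP => u; rewrite !inE ltn0 andbF.
split=> //= K; rewrite ?b0.
  by rewrite inE => /eqP->; rewrite sub0set; split=> //; apply/forall_inP => u;
    rewrite inE.
by rewrite subset0 => /eqP-> _; rewrite inE.
Qed.

(** A cell is a clique and degrees are at most two, so a valid set keeps at most three points in it.
    A kept point has one of three nonzero values, so [card_local_functions] applies with both
    parameters equal to 3; the factor [n.+1] counts the sizes. The exponent [g c] is the number of
    bits granted to the cell [c]. *)
Lemma size_dp (C : finType) (cell : 'I_n -> C) (g : C -> nat) t :
  (forall u v, cell u = cell v -> u != v -> e u v) ->
  (forall c, (3 * #|[set u in front t | cell u == c]|).+1 ^ 3 <= 2 ^ g c) ->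
  size (dp t) <= n.+1 * 2 ^ (\sum_c g c).
Proof.
move=> clique Hg; have [sub _ uq] := dp_inv t.
rewrite -(size_map (sig t)).
set FF := [set f : {ffun 'I_n -> 'I_4} |
      [forall u, (f u != ord0) ==> (u \in front t)] &&
      [forall c, #|[set u | (cell u == c) && (f u != ord0)]| <= 3]].
have cFF : #|FF| <= 2 ^ (\sum_c g c).
  apply: leq_trans (card_local_functions _ _ _ _) _.
  by rewrite expn_sum; apply: leq_prod => c _.
pose h (z : 'I_n.+1 * {ffun 'I_n -> 'I_4}) : nat * {ffun 'I_n -> nat} :=
  (nat_of_ord z.1, [ffun u => nat_of_ord (z.2 u)]).
pose Z := setX [set: 'I_n.+1] FF.
have cZ : #|Z| <= n.+1 * 2 ^ (\sum_c g c).
  by rewrite cardsX cardsT card_ord leq_mul.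
apply: leq_trans cZ; rewrite cardE -(size_map h); apply: uniq_leq_size => //.
move=> _ /mapP[K KL ->]; have [sK vK] := sub K KL.
have v3 u : (if u \in front t then dval K u else 0) < 4.
  case: ifP => // _; rewrite /dval; case: ifP => // uK.
  by rewrite !ltnS; apply: (forall_inP vK).
have cK : #|K| < n.+1 by rewrite ltnS -[X in _ <= X]card_ord; apply: max_card.
apply/mapP; exists (Ordinal cK, [ffun u => Ordinal (v3 u)]); last first.
  by congr pair; apply/ffunP => u; rewrite !ffunE.
rewrite mem_enum in_setX inE /= inE; apply/andP; split.
  apply/forallP => u; rewrite ffunE; apply/implyP;
    apply: contraNT => /negbTE uf.
  by apply/eqP/val_inj; rewrite /= uf.
apply/forallP => c; set A := [set u | _].
have sA : A \subset K.
  apply/subsetP => u; rewrite inE ffunE => /andP[_]; apply: contraNT => uK.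
  by apply/eqP/val_inj; rewrite /= /dval (negbTE uK) if_same.
case: (set_0Vmem A) => [->|[u uA]]; first by rewrite cards0.
rewrite (cardsD1 u) uA add1n ltnS.
apply: leq_trans (forall_inP vK u (subsetP sA u uA)).
apply/subset_leq_card/subsetP => w; rewrite in_setD1 => /andP[nwu wA].
rewrite inE (subsetP sA) //=; apply: clique; last by rewrite eq_sym.
by move: uA wA; rewrite !inE => /andP[/eqP-> _] /andP[/eqP->].
Qed.

End DynamicProgram.

(** * Grid coordinates and kernel *)

Lemma sum_bool_le (P : pred nat) B : (\sum_(i < B) P i <= B)%N.
Proof.
rewrite -[X in (_ <= X)%N]card_ord -sum1_card; apply: leq_sum => i _.
exact: leq_b1.
Qed.

(** A downward closed predicate is a threshold at its count. Columns and logarithms are defined as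
    such counts because the program evaluates them as sums of tests. *)
Lemma sum_downward (P : pred nat) B r :
  (forall i, P i.+1 -> P i) -> (r < B)%N -> P r = (r < \sum_(i < B) P i)%N.
Proof.
move=> down.
have downle i j : (i <= j)%N -> P j -> P i.
  by move=> /subnK <-; elim: (j - i)%N => // k IH /down.
have eqm m : (forall i, (i < m)%N -> P i) -> (\sum_(i < m) P i = m)%N.
  move=> H; rewrite (eq_bigr (fun=> 1%N)) => [|i _]; last by rewrite H.
  by rewrite sum_nat_const card_ord muln1.
elim: B => // B IH; rewrite ltnS leq_eqVlt big_ord_recr /= => /orP[/eqP->|ltr].
  case: (boolP (P B)) => PB.
    rewrite eqm ?addn1 ?ltnSn // => i ltiB; exact: downle (ltnW ltiB) PB.
  rewrite addn0; symmetry; apply/negbTE; rewrite -leqNgt.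
  exact: sum_bool_le.
case: (boolP (P B)) => PB; last by rewrite addn0 IH.
rewrite (downle r B (ltnW ltr) PB) eqm => [|i ltiB];
  first by rewrite addn1 ltnS ltnW.
exact: downle (ltnW ltiB) PB.
Qed.

(* The greedy decomposition of the line into half-open intervals of length at
   least 1/2, in a form which needs no rounding: the column of a point is the
   length of the longest chain of points with gaps greater than 1/2 ending
   there. *)
Section Columns.
Variables (R : realType) (n : nat) (x : 'I_n -> R).

Definition xlt (u v : 'I_n) : bool := ~~ (x v + x v <= x u + x u + 1).

Fixpoint chain (r : nat) : {set 'I_n} :=
  if r is r'.+1 then [set v | [exists u in chain r', xlt u v]] else setT.

Definition column (B : nat) (v : 'I_n) : nat := (\sum_(r < B) (v \in chain
  r.+1))%N.

Lemma xltE u v : xlt u v = (x u + 2^-1 < x v).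
Proof. by rewrite /xlt -ltNge; apply/idP/idP => H; lra. Qed.

Lemma chainS r : chain r.+1 \subset chain r.
Proof.
elim: r => [|r IH]; first by rewrite subsetT.
apply/subsetP => v; rewrite !inE => /exists_inP[u uD lt].
by apply/exists_inP; exists u => //; apply: (subsetP IH).
Qed.

(** Coordinates strictly increase along a chain, so its earlier points are distinct and lie to the
    left of [v]. Hence [n] rounds exhaust all chains. *)
Lemma chain_rank r v : v \in chain r -> (r <= #|[set w | (x w < x v)%R]|)%N.
Proof.
elim: r v => // r IH v; rewrite inE => /exists_inP[u /IH le];
  rewrite xltE => lt.
apply: leq_trans (_ : #|u |: [set w | (x w < x u)%R]| <= _)%N.
  by rewrite cardsU1 inE ltxx.
apply/subset_leq_card/subsetP => w; rewrite !inE => /orP[/eqP->|lt']; lra.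
Qed.

Lemma chain_lt r v : v \in chain r -> (r < n)%N.
Proof.
move=> /chain_rank le; apply: leq_ltn_trans le _.
rewrite -[X in (_ < X)%N]card_ord; apply: (@leq_trans #|v |: [set w | (x w < x
  v)%R]|).
  by rewrite cardsU1 inE ltxx.
exact: max_card.
Qed.

Lemma chain_column B r v : (n <= B)%N -> (v \in chain r) = (r <= column B v)%N.
Proof.
move=> leB; case: r => [|r]; first by rewrite inE.
have down i : v \in chain i.+2 -> v \in chain i.+1
  by apply: (subsetP (chainS _)).
case: (ltnP r B) => ltr; first exact: (@sum_downward (fun i =>
  v \in chain i.+1)).
have -> : v \in chain r.+1 = false.
  by apply/negbTE/negP => /chain_lt; lia.
symmetry; apply/negbTE; rewrite -ltnNge ltnS; apply: leq_trans ltr.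
exact: (@sum_bool_le (fun i => v \in chain i.+1)).
Qed.

Lemma column_lt B v : (n <= B)%N -> (column B v < n)%N.
Proof. by move=> leB; apply: (@chain_lt _ v);
  rewrite (chain_column _ _ leB). Qed.

(** With a gap above 1/2, a longest chain ending at [u] could be prolonged by [v]. *)
Lemma column_eq B u v : (n <= B)%N -> column B u = column B v ->
  x v - x u <= 2^-1.
Proof.
move=> leB E; rewrite leNgt; apply/negP => lt.
suff : ((column B v).+1 <= column B v)%N by rewrite ltnn.
rewrite -chain_column // inE; apply/exists_inP; exists u; last by rewrite xltE;
  lra.
by rewrite (chain_column _ _ leB) E.
Qed.

(** Going back two links from [v] along a longest chain moves left by more than 1, hence to a point
    not to the right of [u]; the remaining links then lead to [u] as well. *)
Lemma column_near B u v : (n <= B)%N -> x v - x u <= 1 ->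
  (column B v <= column B u + 2)%N.
Proof.
move=> leB le.
have : v \in chain (column B v) by rewrite (chain_column _ _ leB).
case: (column B v) => [|[|r]] //; try lia.
rewrite inE => /exists_inP[w1 + lt1]; rewrite inE => /exists_inP[w2 w2D lt2].
rewrite addn2 !ltnS -chain_column //.
have lex : x w2 <= x u by rewrite !xltE in lt1 lt2; lra.
case: r w2D => [|r]; first by rewrite !inE.
rewrite !inE => /exists_inP[w3 w3D lt3]; apply/exists_inP; exists w3 => //.
by rewrite !xltE in lt3 *; lra.
Qed.
End Columns.

(** * Relevant points and their number *)

Section Kernel.
Local Open Scope nat_scope.

Lemma leq_card_bigcup (I T : finType) (P : pred I) (F : I -> {set T}) :
  #|\bigcup_(i | P i) F i| <= \sum_(i | P i) #|F i|.
Proof.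
elim/big_rec2: _ => [|i m X _ le]; first by rewrite cards0.
by apply: leq_trans (leq_card_setU _ _) _; rewrite leq_add2l.
Qed.

Variables (n : nat) (e : rel 'I_n) (cx cy : 'I_n -> nat).
Hypothesis esym : symmetric e.
Hypothesis clique : forall u v, cx u = cx v -> cy u = cy v -> u != v -> e u v.
Hypothesis local : forall u v, e u v ->
  [/\ cx v <= cx u + 2, cx u <= cx v + 2, cy v <= cy u + 2 & cy u <= cy v + 2].

Definition heavy (v : 'I_n) : bool := 3 <= dg e setT v.
Definition relevant : {set 'I_n} :=
  [set v | heavy v || [exists w, heavy w && e v w]].

Lemma max_degree_valid S : (max_degree e (~: S) <= 2) = valid e (~: S).
Proof.
apply/bigmax_leqP/forall_inP => H v vS; first exact: H.
by apply: H.
Qed.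

Lemma valid_relevant S : valid e (~: S) -> valid e (relevant :\: S).
Proof. by apply: valid_sub; apply/subsetP => u; rewrite !inE => /andP[]. Qed.

(** All neighbours of a heavy vertex are relevant, so its degree after the deletion is its degree
    inside [K]. Every other vertex has degree at most two from the start. *)
Lemma relevant_valid (K : {set 'I_n}) : K \subset relevant -> valid e K ->
  valid e (~: (relevant :\: K)).
Proof.
move=> sK /forall_inP vK; apply/forall_inP => u.
rewrite !inE negb_and negbK => uK.
case: (boolP (heavy u)) => hu; last first.
  by rewrite -leqNgt in hu; apply: leq_trans hu; apply: dg_mono; apply: subsetT.
rewrite hu /= orbF in uK; apply: leq_trans (vK u uK).
apply/subset_leq_card/subsetP => w; rewrite !inE negb_and negbK => /andP[+ euw].
rewrite euw andbT => /orP[//|]; rewrite negb_or => /andP[_ /existsP[]].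
by exists u; rewrite hu esym.
Qed.

Lemma card_cell_valid (K : {set 'I_n}) a b : valid e K ->
  #|[set u in K | (cx u == a) && (cy u == b)]| <= 3.
Proof.
move=> /forall_inP vK; set A := [set u in K | _].
case: (set_0Vmem A) => [->|[u uA]]; first by rewrite cards0.
have uK : u \in K by move: uA; rewrite inE => /andP[].
rewrite (cardsD1 u) uA add1n ltnS; apply: leq_trans (vK u uK).
apply/subset_leq_card/subsetP => w; rewrite in_setD1 => /andP[nwu].
move: uA; rewrite !inE => /and3P[_ /eqP ax /eqP ay] /and3P[-> /eqP bx /eqP by_]
  /=.
by apply: clique; rewrite ?ax ?ay // eq_sym.
Qed.

(** A heavy vertex is deleted or loses a neighbour, so a relevant vertex is at most two edges away
    from [S], and an edge changes each grid coordinate by at most 2. *)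
Lemma relevant_near S v : valid e (~: S) -> v \in relevant ->
  exists2 s, s \in S &
  [/\ cx v <= cx s + 4, cx s <= cx v + 4, cy v <= cy s + 4 & cy s <= cy v + 4].
Proof.
move=> /forall_inP vS.
have heavy_near w : heavy w -> exists2 s, s \in S & (s == w) || e w s.
  move=> hw; case: (boolP (w \in S)) => wS; first by exists w => //;
    rewrite eqxx.
  have le2 : dg e (~: S) w <= 2 by apply: vS; rewrite inE.
  have : ~~ ([set x in setT | e w x] \subset [set x in ~: S | e w x]).
    by apply/negP => /subset_leq_card => le; have := leq_trans hw (leq_trans le
      le2).
  case/subsetPn => s; rewrite !inE /= => ews; rewrite ews andbT negbK => sS.
  by exists s => //; rewrite ews orbT.
have loc u w : (w == u) || e u w ->
  [/\ cx w <= cx u + 2, cx u <= cx w + 2, cy w <= cy u + 2 & cy u <= cy w + 2].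
  by case/orP => [/eqP->|/local //]; split; lia.
rewrite inE => /orP[hv|/existsP[w /andP[hw evw]]].
  have [s sS /loc[? ? ? ?]] := heavy_near v hv; exists s => //; split; lia.
have [s sS /loc[? ? ? ?]] := heavy_near w hw; have [? ? ? ?] := local evw.
by exists s => //; split; lia.
Qed.

Lemma card_relevant S : valid e (~: S) -> #|relevant| <= 244 * #|S|.
Proof.
move=> vS.
(* The 9 by 9 window around [s], with offsets moved up by 4 to be natural numbers. Each of its 81
   cells has at most 3 points outside [S]; together with [s] itself this makes 1 + 243 = 244. *)
pose Z (s : 'I_n) (i : 'I_9 * 'I_9) :=
  [set u in ~: S | (cx u == cx s + i.1 - 4) && (cy u == cy s + i.2 - 4)].
have sub : relevant \subset S :|: \bigcup_(s in S) \bigcup_i Z s i.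
  apply/subsetP => v vR; rewrite inE; case: (boolP (v \in S)) => //= vnS.
  have [s sS [? ? ? ?]] := relevant_near vS vR.
  apply/bigcupP; exists s => //.
  have l1 : cx v + 4 - cx s < 9 by lia.
  have l2 : cy v + 4 - cy s < 9 by lia.
  apply/bigcupP; exists (Ordinal l1, Ordinal l2) => //.
  by rewrite !inE vnS /=; lia.
apply: leq_trans (subset_leq_card sub) _.
apply: leq_trans (leq_card_setU _ _) _.
suff : #|\bigcup_(s in S) \bigcup_i Z s i| <= \sum_(s in S) \sum_(i : 'I_9 *
  'I_9) 3.
  move=> le; apply: leq_trans (leq_add (leqnn _) le) _.
  by rewrite !sum_nat_const card_prod !card_ord; move: #|S| => q; lia.
apply: leq_trans (leq_card_bigcup _ _) _; apply: leq_sum => s _.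
apply: leq_trans (leq_card_bigcup _ _) _; apply: leq_sum => i _.
exact: card_cell_valid.
Qed.

End Kernel.

(** * Shifted dyadic grids *)

Section Residues.
Local Open Scope nat_scope.

(** The residue of [a + y] modulo [d] determines that of [a + z]; with the quotient of [a + z] it
    determines [a]. *)
Lemma card_residues m d z y k0 K h : 0 < d ->
  #|[set a : 'I_m | [&& k0 <= (a + z) %/ d, (a + z) %/ d < k0 + K &
                        (a + y) %% d < h]]| <= K * h.
Proof.
move=> d0; case: (posnP K) => [->|K0].
  rewrite mul0n leqn0 cards_eq0; apply/eqP/setP => a; rewrite !inE addn0.
  by apply/negbTE; rewrite !negb_and -!leqNgt -!ltnNge; lia.
case: (posnP h) => [->|h0].
  by rewrite muln0 leqn0 cards_eq0; apply/eqP/setP => a;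
    rewrite !inE ltn0 !andbF.
case: K K0 => // K _; case: h h0 => // h _; set A := [set a | _].
pose f (a : 'I_m) : 'I_K.+1 * 'I_h.+1 :=
  (inord ((a + z) %/ d - k0), inord ((a + y) %% d)).
have inj : {in A &, injective f}.
  move=> a b; rewrite !inE => /and3P[la1 la2 la3] /and3P[lb1 lb2 lb3] [].
  move=> /(congr1 (fun i : 'I_K.+1 => i : nat)).
  rewrite !inordK ?ltn_subLR // => Eq.
  move=> /(congr1 (fun i : 'I_h.+1 => i : nat)); rewrite !inordK // => /eqP.
  rewrite eqn_modDr -(eqn_modDr z) => /eqP Em; apply/val_inj/eqP => /=.
  rewrite -(eqn_add2r z) (divn_eq (a + z) d) (divn_eq (b + z) d) Em eqn_add2r.
  by apply/eqP; congr (_ * _); lia.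
by rewrite -(card_in_imset inj); apply: leq_trans (max_card _) _;
  rewrite card_prod !card_ord.
Qed.

(** Dyadic lines are nested: a line of level [j] is also one of level [i]. *)
Lemma near_coarse x i j : i <= j -> x %% 2 ^ j < 4 -> x %% 2 ^ i < 4.
Proof.
move=> le; apply: leq_ltn_trans.
by rewrite -(@modn_dvdm (2 ^ j) x) ?dvdn_exp2l // leq_mod.
Qed.

(** A multiple of [d] separates [x] from [y], so it lies within distance two of [x]. Adding 2 turns
    this two-sided condition into the single test [< 4]. *)
Lemma near_boundary x y d : 0 < d -> x <= y + 2 -> y <= x + 2 ->
  x %/ d != y %/ d ->
  (x + 2) %% d < 4.
Proof.
move=> d0 lexy leyx ne.
have dx := divn_eq x d; have dy := divn_eq y d.
have mx : x %% d < d by rewrite ltn_mod.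
have my : y %% d < d by rewrite ltn_mod.
move: (x %/ d) (y %/ d) (x %% d) (y %% d) dx dy ne mx my =>
  p q r s dx dy ne mr ms.
have [lt|lt] : p < q \/ q < p by lia.
  have E : d + p * d <= q * d by rewrite -mulSn leq_mul2r lt orbT.
  have -> : x + 2 = 1 * d + p * d + (r + 2 - d) by lia.
  by rewrite -mulnDl modnMDl; apply: leq_ltn_trans (leq_mod _ _) _; lia.
have E : d + q * d <= p * d by rewrite -mulSn leq_mul2r lt orbT.
have -> : x + 2 = p * d + (r + 2) by lia.
by rewrite modnMDl; apply: leq_ltn_trans (leq_mod _ _) _; lia.
Qed.

Fixpoint zorder (B x y : nat) : nat :=
  if B is B'.+1 then odd x * 2 + odd y + 4 * zorder B' x./2 y./2 else 0.

Lemma zorderE B x y :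
  zorder B x y = \sum_(j < B) (odd (x %/ 2 ^ j) * 2 + odd (y %/ 2 ^ j)) * 4 ^ j.
Proof.
elim: B x y => [|B IH] x y /=; first by rewrite big_ord0.
rewrite big_ord_recl /= expn0 !divn1 muln1 IH big_distrr /=; congr (_ + _).
apply: eq_bigr => j _; rewrite /bump /= !add1n !expnS !divnMA !divn2.
by rewrite mulnCA.
Qed.

Lemma zorder_div B x y j : j <= B ->
  zorder B x y %/ 4 ^ j = zorder (B - j) (x %/ 2 ^ j) (y %/ 2 ^ j).
Proof.
elim: j B x y => [|j IH] [|B] x y // le; rewrite ?expn0 ?divn1 ?subn0 //.
rewrite !expnS !divnMA subSS !divn2 -IH //=; congr (_ %/ _).
by rewrite addnC mulnC divnMDl // divn_small ?addn0 //; case: (odd x);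
  case: (odd y).
Qed.

Lemma zorder_inj B x y x' y' : x < 2 ^ B -> y < 2 ^ B -> x' < 2 ^ B ->
  y' < 2 ^ B ->
  zorder B x y = zorder B x' y' -> x = x' /\ y = y'.
Proof.
elim: B x y x' y' => [|B IH] x y x' y'; first by rewrite expn0 !ltnS !leqn0 =>
  /eqP-> /eqP-> /eqP-> /eqP->.
rewrite expnS => lx ly lx' ly' /= E.
have half z : z < 2 * 2 ^ B -> z./2 < 2 ^ B by rewrite -divn2 ltn_divLR //
  mulnC.
have [|||||Ex Ey] := IH x./2 y./2 x'./2 y'./2; try exact: half.
  move: E; case: (odd x); case: (odd y); case: (odd x'); case: (odd y'); lia.
rewrite -(odd_double_half x) -(odd_double_half x') -(odd_double_half y)
  -(odd_double_half y').
rewrite Ex Ey in E *; move: E; case: (odd x); case: (odd y); case: (odd x');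
  case: (odd y'); lia.
Qed.

(** Dividing a Z-order value by 4^j yields the Z-order value of the enclosing square of side 2^j, so
    these squares are intervals of the order. *)
Lemma zorder_sandwich B j x y x' y' x2 y2 : j <= B ->
  x < 2 ^ B -> y < 2 ^ B -> x' < 2 ^ B -> y' < 2 ^ B ->
  x2 < 2 ^ B -> y2 < 2 ^ B ->
  zorder B x y <= zorder B x' y' -> zorder B x' y' <= zorder B x2 y2 ->
  x %/ 2 ^ j = x2 %/ 2 ^ j -> y %/ 2 ^ j = y2 %/ 2 ^ j ->
  x' %/ 2 ^ j = x %/ 2 ^ j /\ y' %/ 2 ^ j = y %/ 2 ^ j.
Proof.
move=> le lx ly lx' ly' lx2 ly2 le1 le2 Ex Ey.
have lt z : z < 2 ^ B -> z %/ 2 ^ j < 2 ^ (B - j).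
  by rewrite ltn_divLR ?expn_gt0 // -expnD subnK.
apply: (@zorder_inj (B - j)); try exact: lt.
rewrite -!zorder_div //.
have := leq_div2r (4 ^ j) le1; have := leq_div2r (4 ^ j) le2.
rewrite !zorder_div // -Ex -Ey; lia.
Qed.

End Residues.

Section Levels.
Local Open Scope nat_scope.

(** For [m <= B], [log4] is the number of base 4 digits of [m] (0 for 0), and [log4up] is the
    logarithm rounded up. *)
Definition log4 (B m : nat) : nat := \sum_(i < B) (4 ^ i <= m).
Definition log4up (B m : nat) : nat := \sum_(i < B) (4 ^ i < m).

Lemma log4P B m i : i < B -> (4 ^ i <= m) = (i < log4 B m).
Proof.
apply: (@sum_downward (fun i => 4 ^ i <= m)) => j; apply: leq_trans.
by rewrite leq_exp2l.
Qed.

Lemma log4upP B m i : i < B -> (4 ^ i < m) = (i < log4up B m).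
Proof.
apply: (@sum_downward (fun i => 4 ^ i < m)) => j; apply: leq_ltn_trans.
by rewrite leq_exp2l.
Qed.

Lemma log4_gt0 B m : 0 < B -> 0 < m -> 0 < log4 B m.
Proof. by move=> B0 m0; rewrite -(@log4P B) // expn0. Qed.

Lemma log4_ltB B m : m <= B -> log4 B m <= m.
Proof.
move=> le; case: (ltnP m B) => [lt|ge].
  by rewrite leqNgt -log4P // -ltnNge; apply: ltn_expl.
have -> : m = B by lia.
exact: (@sum_bool_le (fun i => 4 ^ i <= B)).
Qed.

Lemma ltn_log4 B m : m < B -> m < 4 ^ log4 B m.
Proof.
move=> lt; have le := log4_ltB (ltnW lt).
by rewrite ltnNge (@log4P B) ?ltnn //; lia.
Qed.

Lemma log4_leq B m : 0 < log4 B m -> 4 ^ (log4 B m) <= 4 * m.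
Proof.
have le : log4 B m <= B := @sum_bool_le (fun i => 4 ^ i <= m) B.
case E: (log4 B m) le => [//|l] le _; rewrite expnS leq_mul2l /=.
by rewrite (@log4P B) ?E.
Qed.

Lemma card_set_sum (T : finType) (P : pred T) : #|[set x | P x]| = \sum_x P x.
Proof.
by rewrite -sum1dep_card big_mkcond; apply: eq_bigr => x _; case: (P x).
Qed.
End Levels.

(** * Bits on the frontier for a good shift *)

Section Frontier.
Local Open Scope nat_scope.
Variables (n B : nat) (e : rel 'I_n) (R : {set 'I_n}) (cx cy : 'I_n -> nat).
Hypothesis nB : n + 4 <= B.
Hypothesis cxn : forall v, cx v < n.
Hypothesis cyn : forall v, cy v < n.
Hypothesis local : forall u v, e u v ->
  [/\ cx v <= cx u + 2, cx u <= cx v + 2, cy v <= cy u + 2 & cy u <= cy v + 2].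

Definition same_cell (u v : 'I_n) : bool := (cx u == cx v) && (cy u == cy v).
Definition weight (v : 'I_n) : nat := log4 B #|[set u in R | same_cell u v]|.
Definition order4 : nat := log4up B #|R|.
Definition level (v : 'I_n) : nat := order4.+1 - weight v.
(** The 2 and the 4 express a distance of about two on either side of a line, which is how far an
    edge reaches. *)
Definition near (a : nat) (v : 'I_n) : bool :=
  ((cx v + (a + 2)) %% 2 ^ level v < 4) || ((cy v + (a + 2)) %% 2 ^ level v <
    4).
(** The point of least index represents its cell, so that sums over nonempty cells become sums over
    points, which the program can compute. *)
Definition leader (v : 'I_n) : bool :=
  (v \in R) && (\sum_u ((u \in R) && (same_cell u v && (u < v))) == 0).
Definition shift_weight (a : nat) : nat :=
  \sum_v (if leader v && near a v then weight v else 0).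
(** The successor reserves 0 for the separator. *)
Definition key (a : nat) (v : 'I_n) : nat :=
  if near a v then 0 else (zorder B (cx v + a) (cy v + a)).+1.

Definition cell (v : 'I_n) : 'I_n.+1 * 'I_n.+1 := (inord (cx v), inord (cy v)).

Lemma cellE u v : (cell u == cell v) = same_cell u v.
Proof.
by rewrite /cell /same_cell xpair_eqE -!val_eqE /= !inordK // ltnS ltnW.
Qed.

Lemma cardR : #|R| <= n.
Proof. by rewrite -[X in _ <= X]card_ord max_card. Qed.

Lemma order4_le : order4 <= n.
Proof.
rewrite leqNgt -(@log4upP B); last by lia.
by rewrite -leqNgt (leq_trans cardR) // ltnW // ltn_expl.
Qed.

Lemma card_le_order4 : #|R| <= 4 ^ order4.
Proof.
by rewrite leqNgt (@log4upP B) ?ltnn //; have := order4_le; lia.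
Qed.

Lemma weight_gt0 v : v \in R -> 0 < weight v.
Proof.
move=> vR; apply: log4_gt0; first by lia.
by apply/card_gt0P; exists v; rewrite inE vR /same_cell !eqxx.
Qed.

Lemma card_same v : #|[set u in R | same_cell u v]| < 4 ^ weight v.
Proof.
apply: ltn_log4; apply: leq_ltn_trans (_ : n < B); last by lia.
by rewrite -[X in _ <= X]card_ord max_card.
Qed.

Lemma weight_le v : v \in R -> 4 ^ weight v <= 4 * #|[set u in R | same_cell u
  v]|.
Proof. by move=> vR; apply: log4_leq; apply: weight_gt0. Qed.

Lemma weight_order4 v : v \in R -> weight v <= order4.+1.
Proof.
move=> vR; rewrite -(@leq_exp2l 4) // expnS; apply: leq_trans (weight_le vR) _.
rewrite leq_mul2l /=; apply: leq_trans card_le_order4.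
by apply/subset_leq_card/subsetP => u; rewrite inE => /andP[].
Qed.

(** Each nonempty cell has exactly one leader, and [P] is constant on cells. *)
Lemma sum_leaders (P : pred 'I_n) (f : 'I_n -> nat) (g : 'I_n.+1 * 'I_n.+1 ->
  nat) :
  (forall u v, same_cell u v -> P u = P v) ->
  (forall v, f v = g (cell v)) ->
  \sum_v (if leader v && P v then f v else 0) =
  \sum_(c in [set cell v | v in [set v in R | P v]]) g c.
Proof.
move=> PC Ef.
have inj : {in [set v | leader v && P v] &, injective cell}.
  move=> u v; rewrite !inE => /andP[/andP[uR /eqP u0] _] /andP[/andP[vR /eqP
    v0] _].
  move=> /eqP; rewrite cellE => suv.
  have svu : same_cell v u by move: suv; rewrite /same_cell ![cx u == _]eq_sym
    ![cy u == _]eq_sym.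
  have n1 : ~~ (u < v).
    move: v0 => /eqP; rewrite sum_nat_eq0 => /forallP/(_ u).
    by rewrite uR suv /= eqb0.
  have n2 : ~~ (v < u).
    move: u0 => /eqP; rewrite sum_nat_eq0 => /forallP/(_ v).
    by rewrite vR svu /= eqb0.
  by apply/val_inj => /=; lia.
rewrite -big_mkcond /= (eq_bigr (fun v => g (cell v))) => [|v _];
  last exact: Ef.
rewrite -(eq_bigl _ _ (fun v => in_set (fun v => leader v && P v) v)).
rewrite -(big_imset _ inj) /=; apply: eq_bigl => c.
apply/imsetP/imsetP => -[v]; rewrite !inE.
  by move=> /andP[/andP[vR _] Pv] ->; exists v => //; rewrite inE vR.
move=> /andP[vR Pv] ->.
have exv : exists i, [exists u : 'I_n, [&& u \in R,
  same_cell u v & u == i :> nat]].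
  by exists v; apply/existsP; exists v; rewrite vR /same_cell !eqxx.
case: (ex_minnP exv) => i /existsP[u /and3P[uR suv /eqP Eu]] min.
exists u; last by apply/esym/eqP; rewrite cellE.
rewrite inE (PC _ _ suv) Pv andbT /leader uR sum_nat_eq0.
apply/forallP => w; apply/implyP => _; rewrite eqb0; apply/negP.
move=> /and3P[wR swu ltwu]; have := min w; rewrite -Eu leqNgt ltwu => H.
suff : false by []; apply: H; apply/existsP; exists w.
move: swu suv; rewrite wR /same_cell => /andP[/eqP-> /eqP->] /andP[-> ->].
by rewrite eqxx.
Qed.

Lemma same_weight u v : same_cell u v -> weight u = weight v.
Proof.
by move=> /andP[/eqP Ex /eqP Ey]; rewrite /weight /same_cell Ex Ey.
Qed.

Lemma same_near a u v : same_cell u v -> near a u = near a v.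
Proof.
move=> s; rewrite /near /level (same_weight s).
by move: s => /andP[/eqP-> /eqP->].
Qed.

(** On one axis the shifts have 2^(weight - 1) possible quotients by the spacing 2^level, and 4
    residues are near a line; there are two axes. *)
Lemma count_near v : v \in R ->
  \sum_(a < 2 ^ order4) near a v <= 4 * 2 ^ weight v.
Proof.
move=> vR; have w0 := weight_gt0 vR; have wJ := weight_order4 vR.
have one z : \sum_(a < 2 ^ order4) ((z + (a + 2)) %% 2 ^ level v < 4)
     <= 2 ^ (weight v).-1 * 4.
  rewrite -(@card_set_sum 'I__ (fun a => (z + (a + 2)) %% 2 ^ level v < 4)).
  apply: leq_trans (@card_residues _ (2 ^ level v) 0 (z + 2) 0 _ 4 _);
    last by rewrite expn_gt0.
  apply/subset_leq_card/subsetP => a; rewrite !inE add0n addn0 leq0n addnCA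
    addnA /=.
  move=> ->; rewrite andbT ltn_divLR ?expn_gt0 // -expnD /level.
  by apply: leq_trans (ltn_ord a) _; rewrite leq_exp2l //; lia.
have -> : 4 * 2 ^ weight v = 2 ^ (weight v).-1 * 4 + 2 ^ (weight v).-1 * 4.
  by rewrite -{1}(prednK w0) expnS; lia.
apply: leq_trans (leq_add (one (cx v)) (one (cy v))).
by rewrite -big_split; apply: leq_sum => a _; rewrite /near; do 2!case: (_ < 4).
Qed.

(** Double counting: a cell with m points and weight w contributes at most 4 w 2^w, hence at most 4
    times 4^w and so at most 16 m; the cells partition [R]. *)
Lemma sum_shift_weight : \sum_(a < 2 ^ order4) shift_weight a <= 16 * 4 ^
  order4.
Proof.
rewrite /shift_weight exchange_big /=.
apply: (@leq_trans (\sum_v (if leader v && true then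
    16 * #|[set u in R | same_cell u v]| else 0))).
  apply: leq_sum => v _; rewrite andbT; case: (boolP (leader v)) => [lv|_];
    last first.
    by rewrite big1.
  have vR : v \in R by case/andP: lv.
  apply: (@leq_trans (\sum_(a < 2 ^ order4) near a v * weight v)).
    by apply: leq_sum => a _ /=; case: (near a v); rewrite ?mul1n.
  rewrite -big_distrl /=; apply: leq_trans (leq_mul (count_near vR) (leqnn _))
    _.
  have : weight v <= 2 ^ weight v by rewrite ltnW // ltn_expl.
  have E4 : 4 ^ weight v = 2 ^ weight v * 2 ^ weight v by rewrite -expnMn.
  have := weight_le vR; rewrite E4.
  move: #|[set u in R | same_cell u v]| (weight v) (2 ^ weight v) =>
    m w x H1 H2 /=.
  apply: (@leq_trans (4 * (x * x))); last by lia.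
  by rewrite -mulnA leq_mul2l /= leq_mul2l H2 orbT.
rewrite (@sum_leaders xpredT _ (fun c => 16 * #|[set u in R | cell u == c]|))
  //; last first.
  by move=> v; congr (16 * _); apply: eq_card => u; rewrite !inE cellE.
rewrite -big_distrr /=; apply: (@leq_trans (16 * #|R|)); last first.
  by rewrite leq_mul2l card_le_order4.
rewrite leq_mul2l /=; set C := imset _ _.
rewrite -[X in _ <= X]sum1_card (partition_big cell (mem C)) /=; last first.
  by move=> v vR; apply: imset_f; rewrite inE vR.
by apply: leq_sum => c _; rewrite sum1dep_card.
Qed.

(** The minimum is at most the average over the 2^order4 shifts. *)
Lemma min_shift_weight a0 : (forall a, a < 2 ^ order4 ->
  shift_weight a0 <= shift_weight a) ->
  shift_weight a0 <= 16 * 2 ^ order4.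
Proof.
move=> min; rewrite -(@leq_pmul2l (2 ^ order4)) ?expn_gt0 //.
apply: (@leq_trans (\sum_(a < 2 ^ order4) shift_weight a)).
  by rewrite -[X in X * _](card_ord (2 ^ order4)) -sum_nat_const;
    apply: leq_sum => a _; apply: min.
apply: leq_trans sum_shift_weight _.
by rewrite mulnCA -expnD addnn -mul2n expnM.
Qed.

(** Since [u] is outside the separator its key is positive, so the keys of [c] and [w], being at
    least as large, come from the Z-order too. *)
Lemma key_sandwich a u c w j : a <= 2 ^ order4 -> near a u = false ->
  key a u <= key a c -> key a c <= key a w -> j <= B ->
  (cx u + a) %/ 2 ^ j = (cx w + a) %/ 2 ^ j ->
  (cy u + a) %/ 2 ^ j = (cy w + a) %/ 2 ^ j ->
  (cx c + a) %/ 2 ^ j = (cx u + a) %/ 2 ^ j /\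
  (cy c + a) %/ 2 ^ j = (cy u + a) %/ 2 ^ j.
Proof.
move=> lea nu; rewrite /key nu; case: (near a c) => //; case: (near a w) => //.
rewrite !ltnS => le1 le2 leB Ex Ey.
have lt z : z < n -> z + a < 2 ^ B.
  move=> ltz; have : 2 ^ n.+1 <= 2 ^ B by rewrite leq_exp2l //; lia.
  have : 2 ^ order4 <= 2 ^ n by rewrite leq_exp2l // order4_le.
  have := ltn_expl n (isT : 1 < 2); rewrite expnS; lia.
by apply: zorder_sandwich leB _ _ _ _ _ _ le1 le2 Ex Ey; apply: lt.
Qed.

Variables (pos : 'I_n -> nat) (a : nat).
Hypothesis lea : a <= 2 ^ order4.
Hypothesis pos_key : {in R &, forall u v, pos u < pos v -> key a u <= key a v}.
Hypothesis pos_inj : {in R &, injective pos}.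

(** A neighbour [w] of [u] comes after the current point [c]. The smallest dyadic square containing
    [u] and [w] also contains [c], being an interval of the order; one level below, [u] and [w] are
    separated, so [u] is near a line of that level. *)
Lemma frontP t c u : c \in R -> pos c = t -> u \in front e R pos t.+1 ->
  [\/ near a u, cell u = cell c |
    exists j, [/\ j + weight u <= order4,
      ((cx u + (a + 2)) %% 2 ^ j < 4) || ((cy u + (a + 2)) %% 2 ^ j < 4),
      (cx u + a) %/ 2 ^ j.+1 = (cx c + a) %/ 2 ^ j.+1 &
      (cy u + a) %/ 2 ^ j.+1 = (cy c + a) %/ 2 ^ j.+1]].
Proof.
move=> cR pc; rewrite !inE => /andP[/andP[uR ltu] /existsP[w /and3P[wR ltw
  euw]]].
case: (boolP (near a u)) => [|/negbTE nu]; first by constructor 1.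
have k1 : key a u <= key a c.
  move: ltu; rewrite ltnS leq_eqVlt => /orP[/eqP E|lt];
    last by apply: pos_key => //; rewrite pc.
  by rewrite (pos_inj uR cR) // pc.
have k2 : key a c <= key a w by apply: pos_key => //; rewrite pc.
have sand := key_sandwich lea nu k1 k2.
pose same j := ((cx u + a) %/ 2 ^ j == (cx w + a) %/ 2 ^ j) &&
               ((cy u + a) %/ 2 ^ j == (cy w + a) %/ 2 ^ j).
have sameB : same B.
  have lt z : z < n -> z + a < 2 ^ B.
    move=> ltz; have : 2 ^ n.+1 <= 2 ^ B by rewrite leq_exp2l //; lia.
    have : 2 ^ order4 <= 2 ^ n by rewrite leq_exp2l // order4_le.
    have := ltn_expl n (isT : 1 < 2); rewrite expnS; lia.
  by rewrite /same !divn_small ?eqxx // lt.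
have exj : exists j, same j by exists B.
case: (ex_minnP exj) => -[|j] /andP[/eqP Ex /eqP Ey] min.
  have [E1 E2] := sand 0 (leq0n _) Ex Ey.
  constructor 2; rewrite !expn0 !divn1 in E1 E2; apply/eqP; rewrite cellE.
  by rewrite /same_cell; apply/andP; split; rewrite -(eqn_add2r a) ?E1 ?E2.
constructor 3; exists j.
have leB : j < B by apply: min.
have [E1 E2] := sand j.+1 leB Ex Ey.
have nearj : ((cx u + (a + 2)) %% 2 ^ j < 4) || ((cy u + (a + 2)) %% 2 ^ j < 4).
  have : ~~ same j by apply/negP => /min; rewrite ltnn.
  have [l1 l2 l3 l4] := local euw; rewrite !addnA.
  have d0 : 0 < 2 ^ j by rewrite expn_gt0.
  rewrite /same negb_and => /orP[ne|ne].
    by rewrite (@near_boundary _ (cx w + a)) //; rewrite addnAC leq_add2r.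
  by rewrite (@near_boundary (cy u + a) (cy w + a)) ?orbT //;
    rewrite addnAC leq_add2r.
split=> //.
have wJ := weight_order4 uR.
(* If [level u] were at most [j], nearness to a line of level [j] would put [u] in the separator. *)
rewrite leqNgt; apply/negP => lt; move: nu.
have le : level u <= j by rewrite /level leq_subLR addnC.
by case/orP: nearj => /(near_coarse le) H; rewrite /near H ?orbT.
Qed.

Definition cell_weight (c : 'I_n.+1 * 'I_n.+1) : nat :=
  log4 B #|[set u in R | cell u == c]|.

Lemma cell_weightE v : weight v = cell_weight (cell v).
Proof.
by rewrite /weight /cell_weight; congr log4; apply: eq_card => u;
  rewrite !inE cellE.
Qed.

(** The cells near a line of level [j] in the square of side 2^(j + 1) around [c]: in [block], [h]
    equal to 4 keeps a coordinate near the lines, and [h] equal to 2^j leaves it free. *)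
Definition cross (c : 'I_n) (j : nat) : {set 'I_n.+1 * 'I_n.+1} :=
  let block (b z : nat) h := [set x : 'I_n.+1 | [&& 2 * (b %/ 2 ^ j.+1) <= (x +
    a) %/ 2 ^ j,
    (x + a) %/ 2 ^ j < 2 * (b %/ 2 ^ j.+1) + 2 & (x + (a + 2)) %% 2 ^ j < h]] in
  setX (block (cx c + a) a 4) (block (cy c + a) a (2 ^ j)) :|:
  setX (block (cx c + a) a (2 ^ j)) (block (cy c + a) a 4).

Lemma card_cross c j : #|cross c j| <= 32 * 2 ^ j.
Proof.
apply: leq_trans (leq_card_setU _ _) _; rewrite !cardsX.
have -> : 32 * 2 ^ j = (2 * 4) * (2 * 2 ^ j) + (2 * 2 ^ j) * (2 * 4) by lia.
by apply: leq_add; apply: leq_mul; apply: card_residues; rewrite expn_gt0.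
Qed.

Lemma mem_cross c u j :
  ((cx u + (a + 2)) %% 2 ^ j < 4) || ((cy u + (a + 2)) %% 2 ^ j < 4) ->
  (cx u + a) %/ 2 ^ j.+1 = (cx c + a) %/ 2 ^ j.+1 ->
  (cy u + a) %/ 2 ^ j.+1 = (cy c + a) %/ 2 ^ j.+1 -> cell u \in cross c j.
Proof.
move=> nearj Ex Ey; rewrite inE !in_setX /cell /= !inE !inordK ?ltnS ?(ltnW
  (cxn _)) ?(ltnW (cyn _)) //.
rewrite -Ex -Ey !ltn_mod !expn_gt0 /= !andbT.
have blk z : (2 * (z %/ 2 ^ j.+1) <= z %/ 2 ^ j) && (z %/ 2 ^ j < 2 * (z %/ 2 ^
  j.+1) + 2).
  rewrite expnSr divnMA; move: (z %/ 2 ^ j) => q.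
  have := divn_eq q 2; have := ltn_pmod q (isT : 0 < 2).
  by move: (q %/ 2) (q %% 2) => k r; clear; lia.
have /andP[-> ->] := blk (cx u + a); have /andP[-> ->] := blk (cy u + a).
by rewrite /= !andbT.
Qed.

Lemma sum_geometric J : \sum_(j < J) (J - j) * 2 ^ j <= 2 * 2 ^ J.
Proof.
(* The inequality itself is not inductive; this identity is. *)
suff : \sum_(j < J) (J - j) * 2 ^ j + J + 2 = 2 * 2 ^ J by lia.
elim: J => [|J IH]; first by rewrite big_ord0.
rewrite big_ord_recr /= subSnn mul1n.
have -> : \sum_(j < J) (J.+1 - j) * 2 ^ j = \sum_(j < J) (J - j) * 2 ^ j +
  \sum_(j < J) 2 ^ j.
  by rewrite -big_split; apply: eq_bigr => j _ /=;
    rewrite subSn 1?ltnW // mulSn addnC.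
have -> : \sum_(j < J) 2 ^ j = 2 ^ J - 1.
  by rewrite subn1 predn_exp mul1n.
by have : 0 < 2 ^ J; rewrite ?expn_gt0 // expnS; lia.
Qed.


Hypothesis clique : forall u v, same_cell u v -> u != v -> e u v.
Hypothesis esym : symmetric e.
Hypothesis pos_onto : forall t, t < #|R| -> exists2 c, c \in R & pos c = t.
Hypothesis light : shift_weight a <= 16 * 2 ^ order4.

(** 972 is 12 (16 + 1 + 64): the separator, the cell of the current point and the crosses, at twelve
    bits per unit of weight. *)
Lemma size_dp_front t : t <= #|R| ->
  size (dp e R pos t) <= n.+1 * 2 ^ (972 * 2 ^ order4).
Proof.
case: t => [_|t ltt]; first by rewrite muln_gt0 expn_gt0.
have [c0 c0R pc0] := pos_onto ltt.
pose X := [set cell v | v in [set v in R | near a v]].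
(* The three terms match the three cases of [frontP]; in the last one [order4 - j] is at least the
   weight of the cell. *)
pose g c := 12 * ((if c \in X then cell_weight c else 0) +
  ((if c == cell c0 then cell_weight c else 0) +
   \sum_(j < order4) (if c \in cross c0 j then order4 - j else 0))).
have Hg : \sum_c g c <= 972 * 2 ^ order4.
  rewrite /g -big_distrr /= !big_split /= -!big_mkcond /= big_pred1_eq.
  rewrite -cell_weightE.
  have -> : 972 * 2 ^ order4 = 12 * (16 * 2 ^ order4 + (2 ^ order4 + 32 * (2 *
    2 ^ order4))) by lia.
  rewrite leq_mul2l /=; apply: leq_add; last apply: leq_add.
  - apply: leq_trans light; rewrite /shift_weight.
    rewrite (sum_leaders (same_near a) cell_weightE).
    exact: leqnn.
  - by apply: leq_trans (weight_order4 c0R) _; apply: ltn_expl.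
  - apply: leq_trans (leq_mul (leqnn 32) (sum_geometric order4)).
    rewrite exchange_big big_distrr /=; apply: leq_sum => j _.
    rewrite -big_mkcond sum_nat_const mulnCA mulnC leq_mul2l.
    by apply/orP; right; apply: card_cross.
apply: leq_trans (leq_mul (leqnn _) (leq_pexp2l (isT : 0 < 2) Hg)).
apply: (size_dp esym pos_inj (cell := cell)).
  by move=> u v /eqP; rewrite cellE; apply: clique.
move=> c; set F := [set u in _ | _].
case: (set_0Vmem F) => [->|[u]]; first by rewrite cards0 muln0 exp1n expn_gt0.
rewrite inE => /andP[uf /eqP uc].
have uR : u \in R by move: uf; rewrite !inE => /andP[/andP[]].
have w0 := weight_gt0 uR.
have Hw : 12 * weight u <= g c.
  rewrite /g leq_mul2l /=; case: (frontP c0R pc0 uf) =>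
    [nu|Ec|[j [lej nj Ex Ey]]].
  - have -> : c \in X by rewrite -uc; apply: imset_f; rewrite inE uR.
    by rewrite -uc -cell_weightE leq_addr.
  - by rewrite -uc Ec eqxx -Ec -cell_weightE addnCA leq_addr.
  - have ltj : j < order4 by apply: leq_trans lej; rewrite -addn1 leq_add2l.
    rewrite addnA; apply: leq_trans (leq_addl _ _).
    rewrite (bigD1 (Ordinal ltj)) //= -{1}uc (mem_cross nj Ex Ey).
    by apply: leq_trans (leq_addr _ _); rewrite /= leq_subRL // ltnW.
apply: leq_trans (leq_pexp2l (isT : 0 < 2) Hw).
have mF : #|F| < 4 ^ weight u.
  apply: leq_ltn_trans (card_same u); apply/subset_leq_card/subsetP => v.
  rewrite inE => /andP[vf /eqP vc]; rewrite inE -cellE vc uc eqxx andbT.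
  by move: vf; rewrite !inE => /andP[/andP[]].
(* With w the weight, 3 m + 1 is at most 4^(w + 1), hence at most 4^(2 w) because w is positive; the
   cube takes 12 w bits. *)
have -> : 2 ^ (12 * weight u) = (4 ^ (2 * weight u)) ^ 3.
  by rewrite -[4]/(2 ^ 2) -!expnM; congr expn; clear; lia.
rewrite leq_exp2r //; apply: (@leq_trans (4 * 4 ^ weight u)).
  by move: #|F| mF => m; clear; lia.
by rewrite -expnS leq_exp2l //; clear -w0; lia.
Qed.

End Frontier.

(** * Expressions used by the algorithm *)

Definition sumE (b x : nat) (e : ex) := EFold b x 9 (EC 0) (EAdd (EV 9) e).
Definition leE (a b : ex) := EIf a b (EC 1) (EC 0).
Definition ifE (c a b : ex) := EIf (EC 1) c a b.
Definition andE (a b : ex) := ifE a b (EC 0).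
Definition orE (a b : ex) := ifE a (EC 1) b.
Definition notE (a : ex) := ESub (EC 1) a.
Definition eqE (a b : ex) := andE (leE a b) (leE b a).
Definition ltE (a b : ex) := leE (EAdd a (EC 1)) b.
(** The number of rounds must be a variable, so the loop runs over variable 1 and idles once the
    index reaches [j]. *)
Definition pow2E (j : ex) :=
  EFold 1 10 9 (EC 1) (ifE (ltE (EV 10) j) (EAdd (EV 9) (EV 9)) (EV 9)).
Definition pow4E (j : ex) :=
  EFold 1 10 9 (EC 1) (ifE (ltE (EV 10) j)
    (EAdd (EAdd (EV 9) (EV 9)) (EAdd (EV 9) (EV 9))) (EV 9)).
(** Reduction modulo 2^j by long division: 2^t is subtracted when it fits, for t going down to [j]
    from one less than variable 1. *)
Definition modE (z j : ex) :=
  let t := ESub (ESub (EV 1) (EC 1)) (EV 11) in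
  EFold 1 11 9 z (ifE (andE (leE j t) (leE (pow2E t) (EV 9)))
    (ESub (EV 9) (pow2E t)) (EV 9)).
Definition bitE (z j : ex) := leE (pow2E j) (modE z (EAdd j (EC 1))).
Definition adjE (u v : ex) := andE (notE (eqE u v)) (ER TAdj u v).

Section Denotation.
Variables (R : realType) (r : int -> R).
Implicit Types (arr : name -> int -> int) (env : nat -> int).

Definition scratch (x : nat) : bool := (9 <= x <= 11)%N.

(* The variables 9, 10 and 11 are rebound by the constructions above, so an
   expression plugged into them must not look at those. *)
Definition den arr env (e : ex) (z : int) : Prop :=
  forall env', (forall x, ~~ scratch x -> env' x = env x) ->
    ev r arr env' e = z.

Definition dn arr env (e : ex) (m : nat) : Prop := den arr env e m%:Z.

Lemma den_ev arr env e z : den arr env e z -> ev r arr env e = z.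
Proof. exact. Qed.

Lemma dn_c arr env (m : nat) : dn arr env (EC m%:Z) m. Proof. by []. Qed.

Lemma dn_v arr env x m : ~~ scratch x -> env x = m%:Z -> dn arr env (EV x) m.
Proof. by move=> sx E env' H /=; rewrite H. Qed.

Lemma dn_arr arr env a e m q : dn arr env e m -> arr a m%:Z = q%:Z ->
  dn arr env (EL a e) q.
Proof. by move=> H E env' H' /=; rewrite H. Qed.

Lemma dn_add arr env e1 e2 m1 m2 : dn arr env e1 m1 -> dn arr env e2 m2 ->
  dn arr env (EAdd e1 e2) (m1 + m2)%N.
Proof. by move=> H1 H2 env' H /=; rewrite H1 // H2 // PoszD. Qed.

Lemma dn_sub arr env e1 e2 m1 m2 : dn arr env e1 m1 -> dn arr env e2 m2 ->
  (m2 <= m1)%N -> dn arr env (ESub e1 e2) (m1 - m2)%N.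
Proof. by move=> H1 H2 le env' H /=; rewrite H1 // H2 // -subzn. Qed.

Lemma dn_le arr env e1 e2 m1 m2 : dn arr env e1 m1 -> dn arr env e2 m2 ->
  dn arr env (leE e1 e2) (m1 <= m2)%N.
Proof.
by move=> H1 H2 env' H /=; rewrite H1 // H2 // lez_nat; case: (_ <= _)%N.
Qed.

Lemma dn_if arr env c e1 e2 (b : bool) m1 m2 : dn arr env c b ->
  (b -> dn arr env e1 m1) -> (~~ b -> dn arr env e2 m2) ->
  dn arr env (ifE c e1 e2) (if b then m1 else m2).
Proof.
move=> Hc H1 H2 env' H /=; rewrite Hc //.
by case: b H1 H2 {Hc} => H1 H2; [apply: H1|apply: H2].
Qed.

(** The lazy form lets the second operand rely on the first, as for a subtraction guarded by a
    comparison. *)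
Lemma dn_and arr env e1 e2 (b1 b2 : bool) : dn arr env e1 b1 ->
  (b1 -> dn arr env e2 b2) -> dn arr env (andE e1 e2) (b1 && b2).
Proof.
move=> H1 H2; have -> : (b1 && b2 : nat) = (if b1 then b2 : nat else 0%N).
  by case: b1 {H1 H2}.
exact: dn_if.
Qed.

Lemma dn_or arr env e1 e2 (b1 b2 : bool) : dn arr env e1 b1 ->
  dn arr env e2 b2 -> dn arr env (orE e1 e2) (b1 || b2).
Proof.
move=> H1 H2; have -> : (b1 || b2 : nat) = (if b1 then 1%N else b2 : nat).
  by case: b1 {H1}.
exact: dn_if.
Qed.

Lemma dn_not arr env e (b : bool) : dn arr env e b ->
  dn arr env (notE e) (~~ b).
Proof. by move=> H env' H' /=; rewrite H //; case: b {H}. Qed.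

Lemma dn_eq arr env e1 e2 m1 m2 : dn arr env e1 m1 -> dn arr env e2 m2 ->
  dn arr env (eqE e1 e2) (m1 == m2).
Proof.
by move=> H1 H2; rewrite eqn_leq; apply: dn_and => [|_]; apply: dn_le.
Qed.

Lemma dn_lt arr env e1 e2 m1 m2 : dn arr env e1 m1 -> dn arr env e2 m2 ->
  dn arr env (ltE e1 e2) (m1 < m2)%N.
Proof.
move=> H1 H2; rewrite -addn1; apply: dn_le => //; exact: dn_add.
Qed.

Lemma scratch_setv arr env env' x i acc :
  (forall y, ~~ scratch y -> env' y = env y) ->
  forall y, ~~ scratch y -> setv 9 acc (setv x i env') y = setv x i env y.
Proof.
move=> H y sy; rewrite /setv; case: eqnP => [E|_]; first by rewrite E in sy.
by case: eqnP => // _; apply: H.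
Qed.

Lemma foldn_ext (A : Type) (f g : nat -> A -> A) a m :
  (forall i x, (i < m)%N -> f i x = g i x) -> foldn f a m = foldn g a m.
Proof.
elim: m => //= m IH H; rewrite H // IH // => i x lt; apply: H; exact: ltnW.
Qed.

Lemma dn_sum arr env b x e m (f : nat -> nat) :
  ~~ scratch b -> env b = m%:Z ->
  (forall i, (i < m)%N -> dn arr (setv x i%:Z env) e (f i)) ->
  dn arr env (sumE b x e) (\sum_(i < m) f i)%N.
Proof.
move=> sb Eb H env' H' /=; rewrite H' // Eb /=.
rewrite (@foldn_ext _ _ (fun i acc => acc + (f i)%:Z)); last first.
  move=> i acc lt; rewrite [setv 9 _ _ _]/= (H i lt) //.
  exact: scratch_setv.
by elim: (m) => [|q IH] /=; rewrite ?big_ord0 // big_ord_recr /= PoszD IH.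
Qed.

Lemma dn_sum_ord arr env b x e m (f : 'I_m -> nat) :
  ~~ scratch b -> env b = m%:Z ->
  (forall i : 'I_m, dn arr (setv x (i : nat)%:Z env) e (f i)) ->
  dn arr env (sumE b x e) (\sum_i f i)%N.
Proof.
move=> sb Eb H; pose g i := if insub i is Some j then f j else 0%N.
have Eg (i : 'I_m) : f i = g i by rewrite /g valK.
rewrite (eq_bigr _ (fun i _ => Eg i)); apply: (dn_sum (f := g)) => // i lt.
have := H (Ordinal lt); by rewrite Eg.
Qed.

Lemma dn_fold arr env b x y e0 e1 m (g : nat -> nat) :
  ~~ scratch b -> env b = m%:Z -> dn arr env e0 (g 0%N) ->
  (forall i, (i < m)%N -> dn arr (setv y (g i)%:Z (setv x i%:Z env)) e1 (g
    i.+1)) ->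
  dn arr env (EFold b x y e0 e1) (g m).
Proof.
move=> sb Eb H0 H1 env' H' /=; rewrite H' // Eb /= H0 //.
elim: {-2}m (leqnn m) => //= q IH lt; rewrite IH; last exact: ltnW.
apply: H1 => // w sw; rewrite /setv; case: eqnP => // _; case: eqnP => // _.
exact: H'.
Qed.

(** Separate from [dn_pow2] because inside [modE] the exponent reads variable 11, which [den]
    forbids. *)
Lemma ev_pow2 arr env j q B : env 1%N = B%:Z -> (q <= B)%N ->
  (forall i acc, ev r arr (setv 9 acc (setv 10 i env)) j = q%:Z) ->
  ev r arr env (pow2E j) = (2 ^ q)%N%:Z.
Proof.
move=> EB leq H /=; rewrite EB /=.
rewrite (@foldn_ext _ _ (fun i acc => if (i < q)%N then acc + acc else acc));
  last first.
  move=> i acc lt; rewrite [setv 9 _ _ _]/= [setv 9 _ _ 10%N]/= H.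
  have -> : (i%:Z + 1 <= q%:Z) = (i < q)%N by lia.
  by case: (i < q)%N.
suff : forall b, foldn (fun i acc => if (i < q)%N then acc + acc else acc) 1 b =
    (2 ^ minn b q)%N%:Z by move=> ->; rewrite (minn_idPr leq).
elim=> [|b IH] /=; first by rewrite min0n.
rewrite IH; case: ifP => lt.
  by rewrite (minn_idPl (ltnW lt)) (minn_idPl lt) expnS mul2n -addnn PoszD.
by rewrite !(minn_idPr _) //; lia.
Qed.

Lemma dn_pow2 arr env j q B : env 1%N = B%:Z -> (q <= B)%N -> dn arr env j q ->
  dn arr env (pow2E j) (2 ^ q)%N.
Proof.
move=> EB leq H env' H'; apply: (@ev_pow2 _ _ _ _ B) => //; first by rewrite H'.
move=> i acc; apply: H => y sy; rewrite /setv.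
case: eqnP => [E|_]; first by rewrite E in sy.
by case: eqnP => [E|_]; [rewrite E in sy|apply: H'].
Qed.

Lemma dn_pow4 arr env j q B : env 1%N = B%:Z -> (q <= B)%N -> dn arr env j q ->
  dn arr env (pow4E j) (4 ^ q)%N.
Proof.
move=> EB leq H env' H' /=; rewrite H' // EB /=.
rewrite (@foldn_ext _ _ (fun i acc => if (i < q)%N then 4 * acc else acc));
  last first.
  move=> i acc lt; rewrite [setv 9 _ _ _]/= [setv 9 _ _ 10%N]/= H; last first.
    move=> y sy; rewrite /setv; case: eqnP => [E|_]; first by rewrite E in sy.
    by case: eqnP => [E|_]; [rewrite E in sy|apply: H'].
  have -> : (i%:Z + 1 <= q%:Z) = (i < q)%N by lia.
  have -> : 4 * acc = acc + acc + (acc + acc) by lia.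
  by case: (i < q)%N.
suff : forall b, foldn (fun i acc => if (i < q)%N then 4 * acc else acc) 1 b =
    (4 ^ minn b q)%N%:Z by move=> ->; rewrite (minn_idPr leq).
elim=> [|b IH] /=; first by rewrite min0n.
rewrite IH; case: ifP => lt.
  by rewrite (minn_idPl (ltnW lt)) (minn_idPl lt) expnS PoszM.
by rewrite !(minn_idPr _) //; lia.
Qed.

Lemma modn_step z b :
  (if 2 ^ b <= z %% 2 ^ b.+1 then z %% 2 ^ b.+1 - 2 ^ b else z %% 2 ^ b.+1)%N
  = (z %% 2 ^ b)%N.
Proof.
have d0 : (0 < 2 ^ b)%N by rewrite expn_gt0.
rewrite -[in RHS](@modn_dvdm (2 ^ b.+1) z) ?dvdn_exp2l //.
have : (z %% 2 ^ b.+1 < 2 ^ b.+1)%N by rewrite ltn_mod expn_gt0.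
move: (z %% 2 ^ b.+1)%N => s; rewrite expnS => lt.
case: leqP => le; last by rewrite modn_small.
by rewrite -{2}(subnK le) modnDr modn_small //; lia.
Qed.

Lemma ev_fold arr env b x y e0 e1 : ev r arr env (EFold b x y e0 e1) =
  foldn (fun i acc => ev r arr (setv y acc (setv x i%:Z env)) e1)
    (ev r arr env e0) (iters (env b)).
Proof. by []. Qed.

Lemma ev_if arr env c e1 e2 : ev r arr env (ifE c e1 e2) =
  if 1 <= ev r arr env c then ev r arr env e1 else ev r arr env e2.
Proof. by []. Qed.

Lemma ev_le arr env e1 e2 : ev r arr env (leE e1 e2) =
  if ev r arr env e1 <= ev r arr env e2 then 1 else 0.
Proof. by []. Qed.

Lemma ev_sub arr env e1 e2 : ev r arr env (ESub e1 e2) =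
  ev r arr env e1 - ev r arr env e2.
Proof. by []. Qed.

Lemma dn_mod arr env e j z q B : env 1%N = B%:Z -> (z < 2 ^ B)%N ->
  dn arr env e z -> dn arr env j q -> (q <= B)%N ->
    dn arr env (modE e j) (z %% 2 ^ q)%N.
Proof.
move=> EB ltz Hz Hq leq.
rewrite /dn; have -> : (z %% 2 ^ q)%N%:Z = foldn (fun i acc =>
  if (q <= B - 1 - i)%N &&
    ((2 ^ (B - 1 - i))%N%:Z <= acc) then acc - (2 ^ (B - 1 - i))%N%:Z else acc)
      z%:Z B.
  suff : forall b, (b <= B)%N -> foldn (fun i acc => if (q <= B - 1 - i)%N &&
    ((2 ^ (B - 1 - i))%N%:Z <= acc) then acc - (2 ^ (B - 1 - i))%N%:Z else acc)
      z%:Z b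
    = (z %% 2 ^ maxn q (B - b))%N%:Z.
    by move=> -> //; rewrite subnn maxn0.
  elim=> [_|b IH ltb] /=; first by rewrite subn0 (maxn_idPr leq) modn_small.
  rewrite IH; last exact: ltnW.
  have -> : (B - b = (B - b.+1).+1)%N by lia.
  have -> : (B - 1 - b = B - b.+1)%N by lia.
  case: (boolP (q <= B - b.+1)%N) => le /=; last by rewrite !(maxn_idPl _) //;
    lia.
  rewrite (maxn_idPr le) (maxn_idPr (leqW le)) lez_nat -(modn_step z (B -
    b.+1)).
  by case: leqP => // le2; rewrite subzn.
move=> env' H'; set t := ESub (ESub (EV 1) (EC 1)) (EV 11).
rewrite [LHS]ev_fold Hz // H' // EB -[iters B%:Z]/B;
  apply: foldn_ext => i acc lt.
set env2 := setv 9 acc _.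
have Et env3 : env3 1%N = B%:Z -> env3 11%N = i%:Z ->
  ev r arr env3 t = (B - 1 - i)%N%:Z.
  by move=> E1 E2; rewrite /= E1 E2; clear -lt; lia.
have E1 : env2 1%N = B%:Z by rewrite /env2 /setv /= H'.
have Ep : ev r arr env2 (pow2E t) = (2 ^ (B - 1 - i))%N%:Z.
  apply: (ev_pow2 (B := B)) => //; first by clear -lt; lia.
  by move=> l acc2; apply: Et => //; rewrite /setv /= H'.
have Hj : ev r arr env2 j = q%:Z.
  apply: Hq => y sy; rewrite /env2 /setv; case: eqnP => [E|_];
    first by rewrite E in sy.
  by case: eqnP => [E|_]; [rewrite E in sy|apply: H'].
rewrite /andE !ev_if !ev_le Hj Et // ev_sub Ep lez_nat.
have -> : ev r arr env2 (EV 9) = acc by [].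
by case: (q <= _)%N => //=; case: (_ <= acc).
Qed.

Lemma dn_bit arr env e j z q B : env 1%N = B%:Z -> (z < 2 ^ B)%N ->
  dn arr env e z -> dn arr env j q -> (q < B)%N ->
  dn arr env (bitE e j) (odd (z %/ 2 ^ q)).
Proof.
move=> EB ltz Hz Hq ltq.
have -> : odd (z %/ 2 ^ q) = (2 ^ q <= z %% 2 ^ (q + 1))%N.
  by rewrite -[RHS]divn_gt0 ?expn_gt0 // addn1 expnS -modn_divl modn2 lt0b.
apply: dn_le; first by apply: (dn_pow2 EB (ltnW ltq) Hq).
apply: (dn_mod EB ltz Hz); last by rewrite addn1.
by apply: dn_add => //; apply: dn_c.
Qed.

End Denotation.

(** * Sets of points as integers *)

Section BitSets.
Local Open Scope nat_scope.

Lemma bits_sum (b : pred nat) m j :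
  \sum_(i < m) (if b i then 2 ^ i else 0) < 2 ^ m /\
  odd ((\sum_(i < m) (if b i then 2 ^ i else 0)) %/ 2 ^ j) = (j < m) && b j.
Proof.
elim: m => [|m [IH1 IH2]]; first by rewrite big_ord0 div0n.
rewrite big_ord_recr /=; set s := \sum_(i < m) _ in IH1 IH2 *; split.
  by rewrite expnS; case: (b m); clear -IH1; lia.
rewrite ltnS; case: (ltngtP j m) IH2 => [ltjm|ltmj|->] IH2 /=; last first.
- case: (b m); last by rewrite addn0 divn_small.
  by rewrite addnC divnDl ?dvdnn // divnn expn_gt0 divn_small.
- case: (b m); rewrite divn_small // ?addn0.
  + by apply: leq_trans (_ : 2 ^ m.+1 <= _); [rewrite expnS; clear -IH1;
      lia|rewrite leq_exp2l].
  + by apply: leq_trans IH1 _; rewrite leq_exp2l // ltnW.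
- case: (b m); last by rewrite addn0 IH2.
  rewrite divnDr ?dvdn_exp2l 1?ltnW // oddD IH2 /=.
  rewrite -expnB ?(ltnW ltjm) // -(prednK (_ : 0 < m - j)) ?subn_gt0 //.
  by rewrite expnS oddM /= addbF.
Qed.

Definition code_set n (K : {set 'I_n}) : nat := \sum_i (if i \in K then 2 ^ i
  else 0).

Lemma code_setE n (K : {set 'I_n}) :
  code_set K = \sum_(i < n) (if [exists v in K,
    v == i :> nat] then 2 ^ i else 0).
Proof.
apply: eq_bigr => i _; congr (if _ then _ else _); apply/idP/exists_inP.
  by move=> iK; exists i.
by case=> v vK /eqP/val_inj <-.
Qed.

Lemma code_set_lt n (K : {set 'I_n}) : code_set K < 2 ^ n.
Proof. by rewrite code_setE; have [] := bits_sum (fun i =>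
  [exists v in K, v == i :> nat]) n 0. Qed.

Lemma bit_code_set n (K : {set 'I_n}) (v : 'I_n) : odd (code_set K %/ 2 ^ v) =
  (v \in K).
Proof.
rewrite code_setE; have [_ ->] := bits_sum (fun i =>
  [exists v in K, v == i :> nat]) n v.
rewrite ltn_ord /=; apply/exists_inP/idP => [[w wK /eqP/val_inj <-] //|vK].
by exists v.
Qed.

Lemma code_setU n (K X : {set 'I_n}) : [disjoint K & X] ->
  code_set (K :|: X) = code_set K + code_set X.
Proof.
move=> dis; rewrite /code_set -big_split; apply: eq_bigr => i _ /=; rewrite inE.
case: (boolP (i \in K)) => iK; first by rewrite (disjointFr dis iK) addn0.
by case: (i \in X).
Qed.

End BitSets.

Section GraphExpressions.
Variables (R : realType) (n : nat) (p : 'I_n -> R * R) (k : int).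
Let r := rmem (input_state p k).
Let e := unit_disk_graph p.
Implicit Types (arr : name -> int -> int) (env : nat -> int).

Lemma rmem_input c (u : 'I_n) :
  reval (State (fun=> 0) r) (rxc c (IConst (u : nat)%:Z)) = if c then (p u).2
    else (p u).1.
Proof.
have E (b : bool) : r ((u + u)%N + b)%N%:Z = if b then (p u).2 else (p u).1.
  by rewrite /r /= addnn addnC half_bit_double valK oddD odd_double addbF;
    case: b.
case: c => /=; last by rewrite -PoszD -[X in X%:Z]addn0 (E false).
by rewrite -!PoszD (E true).
Qed.

Lemma rtest_adj (u v : 'I_n) :
  rtestv r TAdj (u : nat)%:Z (v : nat)%:Z = (edist (p u) (p v) <= 1).
Proof.
have := rmem_input false u; have := rmem_input false v.
have := rmem_input true u; have := rmem_input true v.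
rewrite /rtestv /rtestb /= => -> -> -> -> /=.
by rewrite /edist -[X in _ = (_ <= X)]sqrtr1 ler_sqrt // !expr2.
Qed.

Lemma rtest_X (u v : 'I_n) :
  rtestv r TX (u : nat)%:Z (v : nat)%:Z = xlt (fun i => (p i).1) u v.
Proof.
have := rmem_input false u; have := rmem_input false v.
by rewrite /rtestv /rtestb /= => -> ->.
Qed.

Lemma rtest_Y (u v : 'I_n) :
  rtestv r TY (u : nat)%:Z (v : nat)%:Z = xlt (fun i => (p i).2) u v.
Proof.
have := rmem_input true u; have := rmem_input true v.
by rewrite /rtestv /rtestb /= => -> ->.
Qed.

Lemma dn_test arr env t e1 e2 (u v : 'I_n) :
  dn r arr env e1 u -> dn r arr env e2 v ->
  dn r arr env (ER t e1 e2) (rtestv r t (u : nat)%:Z (v : nat)%:Z).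
Proof. by move=> H1 H2 env' H /=; rewrite H1 // H2. Qed.

Lemma dn_adj arr env e1 e2 (u v : 'I_n) :
  dn r arr env e1 u -> dn r arr env e2 v -> dn r arr env (adjE e1 e2) (e u v).
Proof.
move=> H1 H2; rewrite /e /unit_disk_graph -rtest_adj; apply: dn_and => [|_].
  by apply: dn_not; apply: dn_eq.
exact: dn_test.
Qed.

End GraphExpressions.

(* Variables: 0 holds n, 1 holds n + 4, 2 the number of relevant points, 3 the
   number 2 ^ order4 of shifts, 4 and 5 the number of states and its double,
   8 holds k, 13 order4, 14 the best shift, 15 and 16 the first cells of the old
   and new lists of states, 17 a solution (0 for none), 18 the answer,
   22 a candidate state and 23 the number of new states; 19, 20, 21 are loop
   counters and the variables from 30 on are indices of sums and folds. *)
Definition cE (m : nat) := EC m%:Z.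
Definition heavyE (l : nat) (v : ex) := leE (cE 3) (sumE 0 l (adjE v (EV l))).
Definition relE (v : ex) :=
  orE (heavyE 30 v) (leE (cE 1) (sumE 0 31 (andE (heavyE 30 (EV 31)) (adjE v
    (EV 31))))).
(** Chain sets as bit masks: starting from all points, each round keeps those that exceed some point
    of the mask by more than 1/2. *)
Definition maskE (t : rtest) (q : ex) :=
  EFold 1 32 33 (sumE 0 34 (pow2E (EV 34)))
    (ifE (ltE (EV 32) q)
      (sumE 0 34 (ifE (leE (cE 1) (sumE 0 35
          (andE (bitE (EV 33) (EV 35)) (ER t (EV 35) (EV 34)))))
        (pow2E (EV 34)) (cE 0)))
      (EV 33)).
Definition colE (t : rtest) (v : ex) :=
  sumE 0 36 (bitE (maskE t (EAdd (EV 36) (cE 1))) v).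
Definition sameE (u v : ex) :=
  andE (eqE (EL NX u) (EL NX v)) (eqE (EL NY u) (EL NY v)).
Definition orderE := sumE 1 30 (ltE (pow4E (EV 30)) (EV 2)).
Definition weightE (v : ex) :=
  sumE 1 31 (leE (pow4E (EV 31)) (sumE 0 30 (andE (EL NR (EV 30)) (sameE (EV
    30) v)))).
Definition leaderE (v : ex) :=
  andE (EL NR v) (eqE (sumE 0 30 (andE (EL NR (EV 30))
    (andE (sameE (EV 30) v) (ltE (EV 30) v)))) (cE 0)).
Definition levelE (v : ex) := ESub (EAdd (EV 13) (cE 1)) (EL NL v).
Definition nearE (a v : ex) :=
  orE (ltE (modE (EAdd (EL NX v) (EAdd a (cE 2))) (levelE v)) (cE 4))
      (ltE (modE (EAdd (EL NY v) (EAdd a (cE 2))) (levelE v)) (cE 4)).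
Definition shiftE (a : ex) :=
  sumE 0 31 (ifE (andE (EL ND (EV 31)) (nearE a (EV 31))) (EL NL (EV 31)) (cE
    0)).
Definition bestE :=
  EFold 3 37 38 (cE 0) (ifE (ltE (shiftE (EV 37)) (shiftE (EV 38))) (EV 37) (EV
    38)).
Definition dblE (e : ex) := EAdd e e.
Definition zorderEx (x y : ex) :=
  sumE 1 30 (EAdd (ifE (bitE x (EV 30)) (dblE (pow4E (EV 30))) (cE 0))
                  (ifE (bitE y (EV 30)) (pow4E (EV 30)) (cE 0))).
Definition keyE (a v : ex) :=
  ifE (nearE a v) (cE 0)
    (EAdd (zorderEx (EAdd (EL NX v) a) (EAdd (EL NY v) a)) (cE 1)).
(** Ties between keys are broken by the index, so that positions are distinct. *)
Definition rankE (v : ex) :=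
  sumE 0 30 (andE (EL NR (EV 30))
    (orE (ltE (EL NK (EV 30)) (EL NK v))
         (andE (eqE (EL NK (EV 30)) (EL NK v)) (ltE (EV 30) v)))).

(** * Values of the preprocessing expressions *)

Section Phases.
Variables (R : realType) (n : nat) (p : 'I_n -> R * R) (k : int).
Notation r := (rmem (input_state p k)).
Notation e := (unit_disk_graph p).
Notation B := (n + 4)%N.
Implicit Types (arr : name -> int -> int) (env : nat -> int).

Definition isarr arr a (f : 'I_n -> nat) : Prop :=
  forall v : 'I_n, arr a (v : nat)%:Z = (f v)%:Z.

Definition ind (K : {set 'I_n}) (v : 'I_n) : nat := v \in K.

Lemma dn_cE arr env m : dn r arr env (cE m) m. Proof. exact: dn_c. Qed.

Lemma dn_succ arr env x m : dn r arr env x m ->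
  dn r arr env (EAdd x (cE 1)) m.+1.
Proof. by move=> H; rewrite -[m.+1]addn1; apply: dn_add => //;
  apply: dn_cE. Qed.

Lemma setv_neq x y z env : x != y -> setv y z env x = env x.
Proof. by rewrite /setv; case: eqnP => // ->; rewrite eqxx. Qed.

Lemma lt0_sum (P : pred 'I_n) : (1 <= \sum_u P u)%N = [exists u, P u].
Proof.
rewrite lt0n sum_nat_eq0 negb_forall; apply: eq_existsb => u.
by rewrite eqb0 negbK.
Qed.

Lemma dgE (g : rel 'I_n) K u : dg g K u = (\sum_w ((w \in K) && g u w))%N.
Proof. by rewrite /dg card_set_sum. Qed.

Lemma isarr_dn arr env a f ve (v : 'I_n) : isarr arr a f -> dn r arr env ve v ->
  dn r arr env (EL a ve) (f v).
Proof. by move=> H Hv; apply: dn_arr Hv _; apply: H. Qed.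

Lemma dn_heavy arr env l x (v : 'I_n) : env 0%N = n%:Z -> ~~ scratch x ->
  ~~ scratch l -> x != l -> env x = (v : nat)%:Z ->
    dn r arr env (heavyE l (EV x)) (heavy e v).
Proof.
move=> E0 sx sl nxl Ex; apply: dn_le; first exact: dn_cE.
rewrite dgE; apply: dn_sum_ord => // w; rewrite in_setT.
apply: dn_adj; first by apply: dn_v; rewrite ?setv_neq.
by apply: dn_v => //; rewrite /setv eqnE eqxx.
Qed.

Lemma dn_relevant arr env (v : 'I_n) : env 0%N = n%:Z ->
  env 19%N = (v : nat)%:Z ->
  dn r arr env (relE (EV 19)) (v \in relevant e).
Proof.
move=> E0 E19; rewrite inE; apply: dn_or; first exact: dn_heavy.
rewrite -lt0_sum; apply: dn_le; first exact: dn_cE.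
apply: dn_sum_ord => // w; apply: dn_and => [|_]; first exact: dn_heavy.
by apply: dn_adj; apply: dn_v.
Qed.

Lemma dn_mask arr env t q m (x : 'I_n -> R) : env 0%N = n%:Z ->
  env 1%N = B%:Z -> (m <= B)%N ->
  (forall u v : 'I_n, rtestv r t (u : nat)%:Z (v : nat)%:Z = xlt x u v) ->
  (forall i z, dn r arr (setv 33 z (setv 32 i env)) q m) ->
  dn r arr env (maskE t q) (code_set (chain x m)).
Proof.
(* The loop always runs [B] rounds and idles after the first [m], whence the minimum. *)
move=> E0 E1 lem Ht Hq; have -> : code_set (chain x m) = code_set (chain x
  (minn B m)) by rewrite (minn_idPr lem).
have ltB (i : 'I_n) : (i <= B)%N by apply: leq_trans (leq_addr _ _);
  exact: ltnW.
apply: (dn_fold (g := fun i => code_set (chain x (minn i m)))) => //.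
  rewrite min0n /= /code_set; under eq_bigr do rewrite in_setT.
  by apply: dn_sum_ord => // i; apply: (dn_pow2 (B := B)) => //; apply: dn_v.
move=> i lti.
have -> : code_set (chain x (minn i.+1 m)) =
  (if (i < m)%N then \sum_(v < n) (if (1 <= \sum_(u < n) ((u \in chain x (minn
    i m)) && xlt x u v))%N
    then 2 ^ v else 0) else code_set (chain x (minn i m)))%N.
  case: (boolP (i < m)%N) => lt; last rewrite -leqNgt in lt.
    rewrite (minn_idPl (ltnW lt)) (minn_idPl lt); apply: eq_bigr => v _.
    by rewrite lt0_sum /= inE.
  by rewrite !(minn_idPr _) //; apply: leqW.
apply: dn_if; [by apply: dn_lt; [apply: dn_v|apply: Hq]| |] => _;
  last by apply: dn_v.
apply: dn_sum_ord => // v; apply: dn_if => [||_]; last exact: dn_cE.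
  apply: dn_le; first exact: dn_cE.
  apply: dn_sum_ord => // u; apply: dn_and => [|_].
    rewrite -bit_code_set; apply: (dn_bit (B := B)) => //; try by apply: dn_v.
      by apply: leq_trans (code_set_lt _) _; rewrite leq_exp2l // leq_addr.
    by apply: leq_trans (ltn_ord u) (leq_addr _ _).
  by rewrite -Ht; apply: dn_test; apply: dn_v.
by move=> _; apply: (dn_pow2 (B := B)) => //; apply: dn_v.
Qed.

Lemma dn_column arr env t (x : 'I_n -> R) (v : 'I_n) : env 0%N = n%:Z ->
  env 1%N = B%:Z ->
  (forall u v : 'I_n, rtestv r t (u : nat)%:Z (v : nat)%:Z = xlt x u v) ->
  env 19%N = (v : nat)%:Z -> dn r arr env (colE t (EV 19)) (column x n v).
Proof.
move=> E0 E1 Ht E19; rewrite /column.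
apply: (dn_sum (f := fun q => v \in chain x q.+1 : nat)) => // q ltq.
rewrite -bit_code_set; apply: (dn_bit (B := B)) => //.
- by apply: leq_trans (code_set_lt _) _; rewrite leq_exp2l // leq_addr.
- apply: dn_mask => //; first by apply: leq_trans ltq (leq_addr _ _).
  by move=> i z; apply: dn_succ; apply: dn_v.
- by apply: dn_v.
- by apply: leq_trans (ltn_ord v) (leq_addr _ _).
Qed.

Variable cx cy : 'I_n -> nat.
Hypothesis cxn : forall v, (cx v < n)%N.
Hypothesis cyn : forall v, (cy v < n)%N.
Variable S : {set 'I_n}.
Notation weight := (weight B S cx cy).
Notation order4 := (order4 B S).
Let nB : (n + 4 <= B)%N := leqnn _.

Lemma dn_cardR arr env : env 0%N = n%:Z -> isarr arr NR (ind S) ->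
  dn r arr env (sumE 0 30 (EL NR (EV 30))) #|S|.
Proof.
move=> E0 AR; rewrite -sum1_card big_mkcond /=.
apply: dn_sum_ord => // v.
have -> : (if v \in S then 1 else 0)%N = (v \in S) by case: (v \in S).
by apply: (isarr_dn AR); apply: dn_v.
Qed.

Lemma dn_order4 arr env : env 1%N = B%:Z -> env 2%N = #|S|%:Z ->
  dn r arr env orderE order4.
Proof.
move=> E1 E2; apply: (dn_sum (f := fun i => (4 ^ i < #|S|)%N : nat)) =>
  // i lti.
apply: dn_lt; last by apply: dn_v.
by apply: (dn_pow4 (B := B)) => //; [exact: ltnW|apply: dn_v].
Qed.

Lemma dn_same arr env e1 e2 (u v : 'I_n) : isarr arr NX cx -> isarr arr NY cy ->
  dn r arr env e1 u -> dn r arr env e2 v ->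
  dn r arr env (sameE e1 e2) (same_cell cx cy u v).
Proof.
move=> AX AY H1 H2; apply: dn_and => [|_]; apply: dn_eq; exact: isarr_dn.
Qed.

Lemma dn_weight arr env (v : 'I_n) : env 0%N = n%:Z -> env 1%N = B%:Z ->
  isarr arr NX cx -> isarr arr NY cy -> isarr arr NR (ind S) ->
  env 19%N = (v : nat)%:Z -> dn r arr env (weightE (EV 19)) (weight v).
Proof.
move=> E0 E1 AX AY AR E19; apply: (dn_sum (f := fun i =>
  (4 ^ i <= #|[set u in S | same_cell cx cy u v]|)%N : nat)) => // i lti.
apply: dn_le; first by apply: (dn_pow4 (B := B)) => //;
  [exact: ltnW|apply: dn_v].
rewrite card_set_sum; apply: dn_sum_ord => // u; apply: dn_and => [|_].
  by apply: (isarr_dn AR); apply: dn_v.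
by apply: dn_same => //; apply: dn_v.
Qed.

Lemma dn_leader arr env (v : 'I_n) : env 0%N = n%:Z ->
  isarr arr NX cx -> isarr arr NY cy -> isarr arr NR (ind S) ->
  env 19%N = (v : nat)%:Z -> dn r arr env (leaderE (EV 19)) (leader S cx cy v).
Proof.
move=> E0 AX AY AR E19; apply: dn_and => [|_].
  by apply: (isarr_dn AR); apply: dn_v.
apply: dn_eq; last exact: dn_cE.
apply: dn_sum_ord => // u; apply: dn_and => [|_].
  by apply: (isarr_dn AR); apply: dn_v.
apply: dn_and => [|_]; first by apply: dn_same => //; apply: dn_v.
by apply: dn_lt; apply: dn_v.
Qed.

(** Keys are computed for every point, so the subtraction in [levelE] must stay natural outside [S]
    as well. *)
Lemma weight_all v : (weight v <= order4.+1)%N.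
Proof.
case: (posnP (weight v)) => [->//|w0].
rewrite -(@leq_exp2l 4) // expnS; apply: leq_trans (log4_leq w0) _.
rewrite leq_mul2l /=; apply: leq_trans (card_le_order4 S nB).
by apply/subset_leq_card/subsetP => u; rewrite inE => /andP[].
Qed.

(** Shifted coordinates fit into the [B] bits that the bit operations inspect. *)
Lemma shifted_lt c a : (c < n)%N -> (a <= 2 ^ order4)%N ->
  (c + (a + 2) < 2 ^ B)%N.
Proof.
move=> ltc lea; have : (2 ^ order4 <= 2 ^ n)%N
  by rewrite leq_exp2l // (order4_le S nB).
have := ltn_expl n (isT : (1 < 2)%N); rewrite expnD; lia.
Qed.

Lemma dn_near arr env x y a (v : 'I_n) : env 1%N = B%:Z ->
  isarr arr NX cx -> isarr arr NY cy -> isarr arr NL weight ->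
  env 13%N = order4%:Z -> ~~ scratch x -> ~~ scratch y -> env x = a%:Z ->
  env y = (v : nat)%:Z -> (a <= 2 ^ order4)%N ->
  dn r arr env (nearE (EV x) (EV y)) (near B S cx cy a v).
Proof.
move=> E1 AX AY AL E13 sx sy Ex Ey lea.
have Hl : dn r arr env (levelE (EV y)) (level B S cx cy v).
  apply: dn_sub; last exact: weight_all.
    by apply: dn_succ; apply: dn_v.
  by apply: (isarr_dn AL); apply: dn_v.
have leB : (level B S cx cy v <= B)%N.
  apply: leq_trans (leq_subr _ _) _; have := order4_le S nB; clear; lia.
apply: dn_or; (apply: dn_lt; last exact: dn_cE); apply: (dn_mod (B := B)) => //.
- exact: shifted_lt.
- apply: dn_add; first by apply: (isarr_dn AX); apply: dn_v.
  by apply: dn_add; [apply: dn_v|apply: dn_cE].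
- exact: shifted_lt.
- apply: dn_add; first by apply: (isarr_dn AY); apply: dn_v.
  by apply: dn_add; [apply: dn_v|apply: dn_cE].
Qed.

Lemma dn_shift arr env x a : env 0%N = n%:Z -> env 1%N = B%:Z ->
  isarr arr NX cx -> isarr arr NY cy -> isarr arr NL weight ->
  isarr arr ND (leader S cx cy) ->
  env 13%N = order4%:Z -> ~~ scratch x -> x != 31 -> env x = a%:Z ->
  (a <= 2 ^ order4)%N -> dn r arr env (shiftE (EV x)) (shift_weight B S cx cy
    a).
Proof.
move=> E0 E1 AX AY AL AD E13 sx n31 Ex lea; apply: dn_sum_ord => // v.
have Hv : dn r arr (setv 31 (v : nat)%:Z env) (EV 31) v by apply: dn_v.
apply: dn_if => [||_]; last exact: dn_cE.
  apply: dn_and => [|_]; first exact: (isarr_dn AD).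
  by apply: dn_near => //; rewrite ?setv_neq.
by move=> _; apply: (isarr_dn AL).
Qed.

Definition best_shift (m : nat) : nat :=
  foldn (fun i a => if (shift_weight B S cx cy i < shift_weight B S cx cy a)%N
    then i else a) 0%N m.

Lemma best_shiftS m : best_shift m.+1 =
  if (shift_weight B S cx cy m < shift_weight B S cx cy (best_shift m))%N then
    m else best_shift m.
Proof. by []. Qed.

Lemma best_shift_lt m : (best_shift m < m.+1)%N.
Proof. elim: m => // m IH; rewrite best_shiftS; case: ifP => _;
  [exact: leqnSn|exact: leqW]. Qed.

Lemma best_shift_le m a : (a < m)%N ->
  (shift_weight B S cx cy (best_shift m) <= shift_weight B S cx cy a)%N.
Proof.
elim: m => // m IH; rewrite best_shiftS ltnS leq_eqVlt => /orP[/eqP->|/IH le].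
  by case: ltnP.
by case: ltnP => // lt; apply: leq_trans (ltnW lt) le.
Qed.

Lemma dn_best arr env : env 0%N = n%:Z -> env 1%N = B%:Z ->
  env 3%N = (2 ^ order4)%N%:Z ->
  isarr arr NX cx -> isarr arr NY cy -> isarr arr NL weight ->
  isarr arr ND (leader S cx cy) -> env 13%N = order4%:Z ->
  dn r arr env bestE (best_shift (2 ^ order4)).
Proof.
move=> E0 E1 E3 AX AY AL AD E13; apply: (dn_fold (g := best_shift)) =>
  // i lti; rewrite best_shiftS; apply: dn_if => [|_|_]; try by apply: dn_v.
apply: dn_lt; apply: dn_shift => //; first exact: ltnW.
by apply: ltnW; apply: leq_ltn_trans lti; have := best_shift_lt i; rewrite ltnS.
Qed.

Lemma dn_zorder arr env x y a b : env 1%N = B%:Z -> (a < 2 ^ B)%N ->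
  (b < 2 ^ B)%N ->
  (forall i, dn r arr (setv 30 i env) x a) ->
    (forall i, dn r arr (setv 30 i env) y b) ->
  dn r arr env (zorderEx x y) (zorder B a b).
Proof.
move=> E1 la lb Hx Hy; rewrite zorderE.
apply: (dn_sum (f := fun j => ((odd (a %/ 2 ^ j) * 2 + odd (b %/ 2 ^ j)) * 4 ^
  j)%N)) => // j ltj.
have -> : ((odd (a %/ 2 ^ j) * 2 + odd (b %/ 2 ^ j)) * 4 ^ j =
   (if odd (a %/ 2 ^ j) then 4 ^ j + 4 ^ j else 0) + (if odd (b %/ 2 ^ j) then
     4 ^ j else 0))%N.
  by case: (odd _); case: (odd _); clear; lia.
have H30 : dn r arr (setv 30 j%:Z env) (EV 30) j by apply: dn_v.
have H4 : dn r arr (setv 30 j%:Z env) (pow4E (EV 30)) (4 ^ j)%N.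
  by apply: (dn_pow4 (B := B)) => //; exact: ltnW.
apply: dn_add; apply: dn_if => [|_|_]; try exact: dn_cE; try exact: H4.
- by apply: (dn_bit (B := B)).
- exact: dn_add.
- by apply: (dn_bit (B := B)).
Qed.

Lemma dn_key arr env a (v : 'I_n) : env 1%N = B%:Z ->
  isarr arr NX cx -> isarr arr NY cy -> isarr arr NL weight ->
  env 13%N = order4%:Z -> env 14%N = a%:Z ->
  env 19%N = (v : nat)%:Z -> (a <= 2 ^ order4)%N ->
  dn r arr env (keyE (EV 14) (EV 19)) (key B S cx cy a v).
Proof.
move=> E1 AX AY AL E13 E14 E19 lea; apply: dn_if => [|_|_].
- exact: dn_near.
- exact: dn_cE.
have lt c : (c < n)%N -> (c + a < 2 ^ B)%N.
  by move=> ltc; apply: leq_ltn_trans (shifted_lt ltc lea);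
    rewrite leq_add2l leq_addr.
apply: dn_succ.
apply: dn_zorder => //; try exact: lt.
  by move=> i; apply: dn_add; [apply: (isarr_dn AX)|]; apply: dn_v.
by move=> i; apply: dn_add; [apply: (isarr_dn AY)|]; apply: dn_v.
Qed.

Definition rank (f : 'I_n -> nat) (v : 'I_n) : nat :=
  (\sum_u ((u \in S) && ((f u < f v) || ((f u == f v) && (u < v)))))%N.

Lemma dn_rank arr env f (v : 'I_n) : env 0%N = n%:Z ->
  isarr arr NR (ind S) -> isarr arr NK f ->
  env 19%N = (v : nat)%:Z -> dn r arr env (rankE (EV 19)) (rank f v).
Proof.
move=> E0 AR AK E19; apply: dn_sum_ord => // u.
have H30 : dn r arr (setv 30 (u : nat)%:Z env) (EV 30) u by apply: dn_v.
have H19 : dn r arr (setv 30 (u : nat)%:Z env) (EV 19) v by apply: dn_v.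
apply: dn_and => [|_]; first exact: (isarr_dn AR).
apply: dn_or; first by apply: dn_lt; apply: (isarr_dn AK).
apply: dn_and => [|_]; last exact: dn_lt.
by apply: dn_eq; apply: (isarr_dn AK).
Qed.

End Phases.

(** * Ranks as positions *)

Section Rank.
Local Open Scope nat_scope.
Variables (n : nat) (S : {set 'I_n}) (f : 'I_n -> nat).

Let before (u v : 'I_n) : bool := (f u < f v) || ((f u == f v) && (u < v)).

Lemma rank_lt u v : u \in S -> before u v -> rank S f u < rank S f v.
Proof.
move=> uS buv; rewrite /rank [X in _ < X](bigD1 u) //= uS -/(before u v) buv /=
  add1n ltnS.
rewrite (bigD1 u) //= !ltnn !andbF add0n; apply: leq_sum => w _.
case: (w \in S) => //=; rewrite -/(before w u) -/(before w v).
by case E: (before w u) => //; rewrite lt0b; move: E buv; rewrite /before; lia.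
Qed.

Lemma rank_key u v : u \in S -> v \in S -> rank S f u < rank S f v ->
  f u <= f v.
Proof.
move=> uS vS lt; rewrite leqNgt; apply/negP => ltf.
have : rank S f v < rank S f u by apply: rank_lt => //; rewrite /before ltf.
by clear -lt; lia.
Qed.

Lemma rank_inj : {in S &, injective (rank S f)}.
Proof.
move=> u v uS vS E; case: (boolP (before u v)) => [/(rank_lt uS)|nb];
  first by rewrite E ltnn.
case: (boolP (before v u)) => [/(rank_lt vS)|nb']; first by rewrite E ltnn.
by apply/val_inj; move: nb nb'; rewrite /before /=; clear; lia.
Qed.

Lemma rank_bound u : u \in S -> rank S f u < #|S|.
Proof.
move=> uS; rewrite (cardD1 u) uS add1n ltnS -sum1_card big_mkcond /=.
apply: leq_sum => w _; rewrite !inE; case: (eqVneq w u) => [->|_] /=;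
  first by rewrite !ltnn !andbF.
by case: (w \in S) => //=; apply: leq_b1.
Qed.

Lemma rank_onto t : t < #|S| -> exists2 u, u \in S & rank S f u = t.
Proof.
move=> ltt; pose h (u : 'I_n) : 'I_#|S| := insubd (Ordinal ltt) (rank S f u).
have hE u : u \in S -> h u = rank S f u :> nat.
  by move=> uS; rewrite /h val_insubd rank_bound.
have inj : {in S &, injective h}.
  by move=> u v uS vS /(congr1 (@nat_of_ord _)); rewrite !hE //;
    apply: rank_inj.
have : Ordinal ltt \in h @: S.
  suff -> : h @: S = setT by rewrite inE.
  by apply/eqP; rewrite eqEcard subsetT cardsT card_ord (card_in_imset inj)
    leqnn.
by case/imsetP => u uS /(congr1 (@nat_of_ord _)); rewrite hE //= => Et;
  exists u.
Qed.
End Rank.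

(** * The algorithm *)

Definition degE (z u : ex) := sumE 0 31 (andE (bitE z (EV 31)) (adjE u (EV
  31))).
Definition validE (z : ex) :=
  eqE (cE 0) (sumE 0 30 (andE (bitE z (EV 30)) (leE (cE 3) (degE z (EV 30))))).
(** The vertex is in variable 32 and the time t in variable 20. The comparisons are those of the
    frontier at t + 1, after the vertex of time t has been added. *)
Definition frontE :=
  andE (EL NR (EV 32)) (andE (leE (EL NP (EV 32)) (EV 20))
    (leE (cE 1) (sumE 0 33 (andE (EL NR (EV 33))
      (andE (ltE (EV 20) (EL NP (EV 33))) (adjE (EV 32) (EV 33))))))).
Definition valE (z : ex) :=
  ifE (bitE z (EV 32)) (EAdd (degE z (EV 32)) (cE 1)) (cE 0).
Definition sizeE (z : ex) := sumE 0 30 (bitE z (EV 30)).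
Definition eqvE (z z' : ex) :=
  andE (eqE (sizeE z) (sizeE z'))
    (eqE (cE 0) (sumE 0 32 (andE frontE (notE (eqE (valE z) (valE z')))))).
(** Variable 23, the length of the new list, may not bound a fold. The fold runs to variable 5,
    twice the length of the old list, and filters. *)
Definition dupE :=
  leE (cE 1) (sumE 5 36 (andE (ltE (EV 36) (EV 23))
    (eqvE (EL NT (EAdd (EV 16) (EV 36))) (EV 22)))).
Definition atE :=
  sumE 0 30 (ifE (andE (EL NR (EV 30)) (eqE (EL NP (EV 30)) (EV 20)))
    (pow2E (EV 30)) (cE 0)).
(** The successor distinguishes the empty set, of code 0, from the absence of a state. *)
Definition foundE :=
  EFold 4 37 38 (cE 0)
    (EIf (ESub (EV 2) (sizeE (EL NT (EAdd (EV 15) (EV 37))))) (EV 8)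
      (EAdd (EL NT (EAdd (EV 15) (EV 37))) (cE 1)) (EV 38)).

Definition sTry :=
  SIf (cE 1) (andE (validE (EV 22)) (notE dupE))
    (SSeq (SA NT (EAdd (EV 16) (EV 23)) (EV 22)) (SV 23 (EAdd (EV 23) (cE 1))))
    SSkip.
Definition sExtend :=
  SSeq (SV 22 (EL NT (EAdd (EV 15) (EV 21)))) (SSeq sTry
  (SSeq (SV 22 (EAdd (EL NT (EAdd (EV 15) (EV 21))) atE)) sTry)).
(** The new list is written right after the old one and becomes the old one; no cell of the table is
    reused. *)
Definition sStep :=
  SSeq (SV 5 (EAdd (EV 4) (EV 4))) (SSeq (SV 23 (cE 0)) (SSeq (SFor 4 21
    sExtend)
  (SSeq (SV 15 (EV 16)) (SSeq (SV 16 (EAdd (EV 16) (EV 23))) (SV 4 (EV 23)))))).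
Definition sDP :=
  SSeq (SA NT (cE 0) (cE 0)) (SSeq (SV 15 (cE 0)) (SSeq (SV 16 (cE 1)) (SSeq
    (SV 4 (cE 1))
  (SSeq (SFor 2 20 sStep) (SV 17 foundE))))).

(** * The dynamic program in memory *)

Section DPProgram.
Variables (R : realType) (n : nat) (p : 'I_n -> R * R) (k : int).
Notation r := (rmem (input_state p k)).
Notation e := (unit_disk_graph p).
Notation B := (n + 4)%N.
Implicit Types (arr : name -> int -> int) (env : nat -> int).
Variables (S : {set 'I_n}) (pos : 'I_n -> nat).
Notation sig := (sig e S pos).
Notation tryadd := (tryadd e S pos).
Notation dpstep := (dpstep e S pos).
Notation dp := (dp e S pos).

Definition wide (x : nat) : bool := scratch x || (30 <= x <= 35)%N.

(** Strengthens [dn] for expressions placed under sums over the variables 30 to 35. *)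
Definition dnw arr env (z : ex) (m : nat) : Prop :=
  forall env', (forall x, ~~ wide x -> env' x = env x) ->
    ev r arr env' z = m%:Z.

Lemma dnw_dn arr env z m : dnw arr env z m -> dn r arr env z m.
Proof.
move=> H env' H'; apply: H => x; rewrite negb_or => /andP[sx _]; exact: H'.
Qed.

Lemma dnw_setv arr env z m x i : wide x -> dnw arr env z m ->
  dnw arr (setv x i env) z m.
Proof.
move=> wx H env' H'; apply: H => y wy; rewrite H' // setv_neq //.
by apply: contraNneq wy => ->.
Qed.

Section Expressions.
Variables (arr : name -> int -> int) (env : nat -> int).
Hypotheses (E0 : env 0%N = n%:Z) (E1 : env 1%N = B%:Z).
Hypotheses (AR : isarr arr NR (ind S)) (AP : isarr arr NP pos).

Lemma dn_bit_set env' z (K : {set 'I_n}) x (u : 'I_n) : env' 1%N = B%:Z ->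
  dn r arr env' z (code_set K) -> ~~ scratch x -> env' x = (u : nat)%:Z ->
  dn r arr env' (bitE z (EV x)) (u \in K).
Proof.
move=> E1' Hz sx Ex; rewrite -bit_code_set; apply: (dn_bit (B := B)) => //.
- by apply: leq_trans (code_set_lt _) _; rewrite leq_exp2l // leq_addr.
- exact: dn_v.
- by apply: leq_trans (ltn_ord u) (leq_addr _ _).
Qed.

Lemma dn_deg env' z (K : {set 'I_n}) x (u : 'I_n) : env' 0%N = n%:Z ->
  env' 1%N = B%:Z ->
  dnw arr env' z (code_set K) -> ~~ scratch x -> x != 31 ->
    env' x = (u : nat)%:Z ->
  dn r arr env' (degE z (EV x)) (dg e K u).
Proof.
move=> E0' E1' Hz sx nx Ex; rewrite dgE; apply: dn_sum_ord => // w;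
  apply: dn_and => [|_].
  by apply: dn_bit_set => //; apply: dnw_dn; apply: dnw_setv.
by apply: dn_adj; [apply: dn_v; rewrite ?setv_neq|apply: dn_v].
Qed.

Lemma dn_valid z (K : {set 'I_n}) : dnw arr env z (code_set K) ->
  dn r arr env (validE z) (valid e K).
Proof.
move=> Hz.
have -> : valid e K = (0 == \sum_u ((u \in K) && (3 <= dg e K u)) :> nat)%N.
  rewrite eq_sym sum_nat_eq0; apply: eq_forallb => u.
  by rewrite eqb0 negb_and -ltnNge implybE.
apply: dn_eq; first exact: dn_cE.
apply: dn_sum_ord => // u; apply: dn_and => [|_].
  by apply: dn_bit_set => //; apply: dnw_dn; apply: dnw_setv.
by apply: dn_le; [exact: dn_cE|apply: dn_deg => //; apply: dnw_setv].
Qed.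

Lemma dn_size z (K : {set 'I_n}) : dnw arr env z (code_set K) ->
  dn r arr env (sizeE z) #|K|.
Proof.
move=> Hz; rewrite -sum1_card big_mkcond /=; apply: dn_sum_ord => // u.
have -> : (if u \in K then 1 else 0)%N = (u \in K) by case: (u \in K).
by apply: dn_bit_set => //; apply: dnw_dn; apply: dnw_setv.
Qed.

Lemma dn_front t env' (u : 'I_n) : env' 0%N = n%:Z -> env' 20%N = t%:Z ->
  env' 32%N = (u : nat)%:Z ->
  dn r arr env' frontE (u \in front e S pos t.+1).
Proof.
move=> E0' E20 E32; rewrite inE [u \in before _ _ _]inE -andbA.
apply: dn_and => [|_]; first by apply: (isarr_dn AR); apply: dn_v.
apply: dn_and => [|_].
  by rewrite ltnS; apply: dn_le; [apply: (isarr_dn AP)|]; apply: dn_v.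
rewrite -lt0_sum; apply: dn_le; first exact: dn_cE.
apply: dn_sum_ord => // w; apply: dn_and => [|_].
  by apply: (isarr_dn AR); apply: dn_v.
apply: dn_and => [|_].
  by apply: dn_lt; [|apply: (isarr_dn AP)]; apply: dn_v.
by apply: dn_adj; apply: dn_v.
Qed.

Lemma dn_val env' z (K : {set 'I_n}) (u : 'I_n) : env' 0%N = n%:Z ->
  env' 1%N = B%:Z ->
  dnw arr env' z (code_set K) -> env' 32%N = (u : nat)%:Z ->
  dn r arr env' (valE z) (dval e K u).
Proof.
move=> E0' E1' Hz E32; apply: dn_if => [|_|_]; last exact: dn_cE.
  by apply: dn_bit_set => //; apply: dnw_dn.
by apply: dn_succ; apply: dn_deg.
Qed.

Lemma sig_eqE t (K K' : {set 'I_n}) : (sig t K == sig t K') =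
  (#|K| == #|K'|) &&
  (0 == \sum_u ((u \in front e S pos t) && ~~ (dval e K u == dval e K' u)) :>
    nat)%N.
Proof.
rewrite eq_sym /sig xpair_eqE eq_sym; congr (_ && _).
rewrite [RHS]eq_sym sum_nat_eq0; apply/eqP/forallP => [E u|H].
  rewrite eqb0 negb_and negbK; have := congr1 (fun g : {ffun _} => g u) E.
  by rewrite !ffunE; case: (u \in front _ _ _ _) => //= ->; rewrite eqxx.
apply/ffunP => u; rewrite !ffunE; have := H u; rewrite eqb0 negb_and negbK.
by case: (u \in front _ _ _ _) => //= /eqP.
Qed.

Lemma dn_eqv t z z' (K K' : {set 'I_n}) : env 20%N = t%:Z ->
  dnw arr env z (code_set K) -> dnw arr env z' (code_set K') ->
  dn r arr env (eqvE z z') (sig t.+1 K == sig t.+1 K').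
Proof.
move=> E20 Hz Hz'; rewrite sig_eqE; apply: dn_and => [|_].
  by apply: dn_eq; apply: dn_size.
apply: dn_eq; first exact: dn_cE.
apply: dn_sum_ord => // u; apply: dn_and => [|_]; first exact: dn_front.
by apply: dn_not; apply: dn_eq; apply: dn_val => //; apply: dnw_setv.
Qed.

Lemma dn_at t : env 20%N = t%:Z -> dn r arr env atE (code_set (at_time S pos
  t)).
Proof.
move=> E20; apply: dn_sum_ord => // u; rewrite inE; apply: dn_if => [|_|_].
- apply: dn_and => [|_]; first by apply: (isarr_dn AR); apply: dn_v.
  by apply: dn_eq; [apply: (isarr_dn AP)|]; apply: dn_v.
- apply: (dn_pow2 (B := B)) => //; last exact: dn_v.
  by apply: leq_trans (ltnW (ltn_ord u)) (leq_addr _ _).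
- exact: dn_cE.
Qed.
End Expressions.

Definition listed arr (lo : nat) (L : seq {set 'I_n}) : Prop :=
  forall i, (i < size L)%N -> arr NT (lo + i)%N%:Z = (code_set (nth set0 L
    i))%:Z.

Lemma has_sum (P : pred {set 'I_n}) L m : (size L <= m)%N ->
  has P L = (1 <= \sum_(i < m) ((i < size L) && P (nth set0 L i)))%N.
Proof.
move=> le; rewrite lt0n sum_nat_eq0 negb_forall; apply/hasP/existsP.
  move=> [K KL PK]; have lt : (index K L < size L)%N by rewrite index_mem.
  by exists (Ordinal (leq_trans lt le)); rewrite /= lt nth_index // PK.
move=> [i]; rewrite eqb0 negbK => /andP[lt Pi].
by exists (nth set0 L i) => //; apply: mem_nth.
Qed.

Lemma dn_dup arr env t hi L m K : env 0%N = n%:Z -> env 1%N = B%:Z ->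
  isarr arr NR (ind S) -> isarr arr NP pos -> env 20%N = t%:Z ->
    env 16%N = hi%:Z ->
  env 23%N = (size L)%:Z -> env 5%N = m%:Z -> (size L <= m)%N ->
  listed arr hi L -> env 22%N = (code_set K)%:Z ->
  dn r arr env dupE (has (fun K' => sig t.+1 K' == sig t.+1 K) L).
Proof.
move=> E0 E1 AR AP E20 E16 E23 E5 lem HL E22; rewrite (has_sum _ lem).
apply: dn_le; first exact: dn_cE.
apply: (dn_sum (f := fun i => (i < size L)%N && (sig t.+1 (nth set0 L i) == sig
  t.+1 K)
   : nat)) => // i lti.
apply: dn_and => [|lts]; first by apply: dn_lt; apply: dn_v.
apply: dn_eqv => //; last by move=> env' H' /=; rewrite H'.
move=> env' H' /=; rewrite !H' // -HL // PoszD; congr (arr NT (_ + _)).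
by rewrite -E16.
Qed.

Variable Bd : nat.

Definition dbase arr env : Prop :=
  [/\ env 0%N = n%:Z, env 1%N = B%:Z, env 2%N = #|S|%:Z, env 8%N = k &
      [/\ isarr arr NR (ind S), isarr arr NP pos & bok Bd env]].

Lemma dbase_setv arr env x z : (8 < x)%N -> dbase arr env ->
  dbase arr (setv x z env).
Proof.
move=> lt [E0 E1 E2 E8 [AR AP Hb]]; split; rewrite ?setv_neq //;
  try by clear -lt; lia.
by split=> //; apply: bok_set => //; exact: ltnW.
Qed.

Lemma bok_setb x m env : (m <= Bd)%N -> bok Bd env -> bok Bd (setv x m%:Z env).
Proof. by move=> le Hb b ltb; rewrite /setv; case: eqnP => // _; apply: Hb. Qed.

Lemma dbase_setb arr env x m : (3 < x < 8)%N -> (m <= Bd)%N -> dbase arr env ->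
  dbase arr (setv x m%:Z env).
Proof.
move=> lt le [E0 E1 E2 E8 [AR AP Hb]]; split; rewrite ?setv_neq //;
  try by clear -lt; lia.
by split=> //; apply: bok_setb.
Qed.

Lemma dbase_seta arr env i z : dbase arr env -> dbase (seta NT i z arr) env.
Proof. by move=> [E0 E1 E2 E8 [AR AP Hb]]. Qed.

(** [L] is the finished list, stored from index [lo], [L'] the list under construction behind it,
    and [m] the bound used when searching [L'] for duplicates. *)
Definition inner t lo (L : seq {set 'I_n}) L' m arr env : Prop :=
  [/\ dbase arr env, env 20%N = t%:Z, env 15%N = lo%:Z,
    env 16%N = (lo + size L)%N%:Z &
   [/\ env 4%N = (size L)%:Z, env 5%N = m%:Z, env 23%N = (size L')%:Z,
       listed arr lo L & listed arr (lo + size L) L']].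

Lemma inner_setv t lo L L' m arr env x z : (23 < x)%N || (20 < x < 23)%N ->
  inner t lo L L' m arr env -> inner t lo L L' m arr (setv x z env).
Proof.
move=> lt [D E20 E15 E16 [E4 E5 E23 HL HL']]; split; rewrite ?setv_neq //;
  try by clear -lt; lia.
by apply: dbase_setv => //; clear -lt; lia.
Qed.

(** Variable 21 is tracked because the second attempt reads the same old state again. *)
Lemma ok_try t lo L L' m K arr env : inner t lo L L' m arr env ->
  env 22%N = (code_set K)%:Z -> (size L' <= m)%N ->
  ok r Bd sTry arr env (fun arr' env' =>
    inner t lo L (tryadd t.+1 L' K) m arr' env' /\ env' 21%N = env 21%N).
Proof.
move=> I0 E22 lem; have [D E20 E15 E16 [E4 E5 E23 HL HL']] := I0.
have [E0 E1 E2 E8 [AR AP Hb]] := D.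
set c := valid e K && ~~ has (fun K' => sig t.+1 K' == sig t.+1 K) L'.
have Et : tryadd t.+1 L' K = if c then rcons L' K else L' by [].
have Hv : dn r arr env (andE (validE (EV 22)) (notE dupE)) c.
  apply: dn_and => [|_].
    by apply: dn_valid => //; move=> env' H' /=; rewrite H'.
  by apply: dn_not; apply: dn_dup E5 lem HL' E22.
apply: ok_if => //; rewrite (den_ev Hv) [ev _ _ _ (cE 1)]/= lez_nat lt0b Et.
case: c {Hv Et}; last by apply: ok_skip; split; first exact: I0.
apply: ok_seq; apply: ok_sta => //; apply: ok_set => //.
split=> //; split=> //.
  by apply: dbase_setv => //; apply: dbase_seta.
split=> //.
- by rewrite size_rcons /= /setv /= E23; clear; lia.
- move=> i lti; rewrite /seta /= E16 E23.
  by case: eqP => [E|_]; [exfalso; move: E lti; clear; lia|apply: HL].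
- move=> i; rewrite size_rcons ltnS nth_rcons /seta /= E16 E23 E22 => lei.
  case: ltngtP lei => // [lti|->] _; last by rewrite PoszD eqxx.
  by case: eqP => [E|_]; [exfalso; move: E lti; clear; lia|apply: HL'].
Qed.

Lemma ok_extend t lo L L' m i arr env :
  inner t lo L L' m arr env -> (i < size L)%N -> env 21%N = i%:Z ->
  (size L' + 2 <= m)%N -> nth set0 L i \subset before S pos t ->
  ok r Bd sExtend arr env (inner t lo L
    (tryadd t.+1 (tryadd t.+1 L' (nth set0 L i)) (nth set0 L i :|: at_time S
      pos t)) m).
Proof.
move=> I0 lti E21 lem sK; have [D E20 E15 E16 [E4 E5 E23 HL HL']] := I0.
have [E0 E1 E2 E8 [AR AP Hb]] := D.
apply: ok_seq; apply: ok_set => //.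
have -> : ev r arr env (EL NT (EAdd (EV 15) (EV 21))) = (code_set (nth set0 L
  i))%:Z.
  by rewrite /= E15 E21 -HL // PoszD.
apply: ok_seq; apply: ok_conseq (@ok_try t lo L L' m (nth set0 L i) _ _ _ _ _)
  => //; first last.
- by apply: leq_trans lem; exact: leq_addr.
- exact: inner_setv.
move=> arr1 env1 [I1 Ei]; have E21' : env1 21%N = i%:Z := etrans Ei E21.
have [[F0 F1 F2 F8 [BR BP Hb1]] F20 F15 F16 [F4 F5 F23 GL GL']] := I1.
apply: ok_seq; apply: ok_set => //.
have -> : ev r arr1 env1 (EAdd (EL NT (EAdd (EV 15) (EV 21))) atE) =
    (code_set (nth set0 L i :|: at_time S pos t))%:Z.
  (* The new vertex is not in the old state, so adding codes forms the union. *)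
  rewrite code_setU; last first.
    rewrite disjoints_subset; apply/subsetP => u /(subsetP sK); rewrite !inE.
    by case/andP=> -> lt /=; rewrite neq_ltn lt.
  rewrite PoszD -(den_ev (dn_at F0 F1 BR BP F20)) -GL //.
  by rewrite [LHS]/= F15 E21' PoszD.
apply: ok_conseq (@ok_try t lo L (tryadd t.+1 L' (nth set0 L i)) m (nth set0 L
  i :|: at_time S pos t) _ _ _ _ _) => //.
- by move=> arr2 env2 [].
- exact: inner_setv.
- apply: leq_trans (size_tryadd _ _ _ _ _ _) _; clear -lem; lia.
Qed.

Definition outer t arr env : Prop :=
  exists lo, [/\ dbase arr env, env 15%N = lo%:Z,
    env 16%N = (lo + size (dp t))%N%:Z,
    env 4%N = (size (dp t))%:Z & listed arr lo (dp t)].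

Hypothesis esym : symmetric e.
Hypothesis pos_inj : {in S &, injective pos}.
Hypothesis bound : forall t, (t <= #|S|)%N -> (2 * size (dp t) <= Bd)%N.

Lemma ok_step t arr env : (t < #|S|)%N -> outer t arr env ->
  ok r Bd sStep arr (setv 20 t%:Z env) (outer t.+1).
Proof.
move=> ltt [lo [D0 E15 E16 E4 HL]].
set L := dp t in E16 E4 HL *; have [sub _ _] := dp_inv esym pos_inj t.
have bt := bound (ltnW ltt).
have D := dbase_setv t%:Z (isT : 8 < 20)%N D0.
have [E0 E1 E2 E8 [AR AP Hb]] := D.
apply: ok_seq; apply: ok_set => //.
have -> : ev r arr (setv 20 t%:Z env) (EAdd (EV 4) (EV 4)) = (2 * size L)%N%:Z.
  by rewrite /= /setv /= E4 mul2n -addnn PoszD.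
have D5 := dbase_setb (isT : 3 < 5 < 8)%N bt D.
have [_ _ _ _ [_ _ Hb5]] := D5.
apply: ok_seq; apply: ok_set => //.
have D6 := dbase_setv 0 (isT : 8 < 23)%N D5.
apply: ok_seq.
apply: (ok_for (I := fun i arr' env' => inner t lo L (dpstep t (take i L) [::])
  (2 * size L) arr' env')
   (N := size L)).
- by rewrite /setv /= E4.
- by apply: leq_trans bt; rewrite leq_pmull.
- rewrite take0; split=> //; split=> //.
- move=> i arr' env' lti I'.
  rewrite (take_nth set0 lti) /dpstep foldl_rcons -/(dpstep t (take i L) [::]).
  apply: ok_extend => //; first exact: inner_setv.
    have := size_dpstep e S pos t (take i L) [::];
      rewrite size_take lti add0n => le.
    by move: (size (foldl _ _ _)) le => q le; clear -le lti; lia.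
  by have [] := sub _ (mem_nth set0 lti).
move=> arr' env'; rewrite take_size => I'.
have [[F0 F1 F2 F8 [BR BP Hb1]] F20 F15 F16 [F4 F5 F23 GL GL']] := I'.
have ED : dpstep t L [::] = dp t.+1 by [].
rewrite ED in I' F23 GL'.
apply: ok_seq; apply: ok_set => //.
have D7 : dbase arr' (setv 15 (env' 16) env') by apply: dbase_setv => //;
  case: I'.
have [_ _ _ _ [_ _ Hb7]] := D7.
apply: ok_seq; apply: ok_set => //.
set env8 := setv 16 _ _; have D8 : dbase arr' env8 by apply: dbase_setv.
have [_ _ _ _ [_ _ Hb8]] := D8.
apply: ok_set => //; exists (lo + size L)%N; split=> //.
- have -> : ev r arr' env8 (EV 23) = (size (dp t.+1))%:Z
    by rewrite /= /env8 /setv /= F23.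
  apply: dbase_setb => //; apply: leq_trans (bound ltt); by rewrite leq_pmull.
- by rewrite /env8 /setv /= F16 F23 PoszD.
Qed.

Definition good (K : {set 'I_n}) : bool := #|S|%:Z - #|K|%:Z <= k.

Lemma dn_found arr env : outer #|S| arr env ->
  exists m, ev r arr env foundE = m%:Z /\
   ((m = 0%N /\ {in dp #|S|, forall K, ~~ good K}) \/
    exists2 K, K \in dp #|S| & good K /\ m = (code_set K).+1).
Proof.
move=> [lo [[E0 E1 E2 E8 [AR AP Hb]] E15 E16 E4 HL]]; set L := dp _ in HL E4 *.
pose g := foldn (fun i acc => if good (nth set0 L i) then (code_set (nth set0 L
  i)).+1 else acc) 0%N.
exists (g (size L)); split.
  apply: (den_ev (env := env)); apply: (dn_fold (g := g)) => // i lti.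
  have Hz : dnw arr (setv 38 (g i)%:Z (setv 37 i%:Z env)) (EL NT (EAdd (EV 15)
    (EV 37)))
       (code_set (nth set0 L i)).
    by move=> env' H' /=; rewrite !H' // -HL // PoszD; congr (arr NT (_ + _)).
  have Hs := dn_size (E0 : setv 38 (g i)%:Z (setv 37 i%:Z env) 0%N = n%:Z) E1
    Hz.
  move=> env' H'; rewrite [LHS]/= -/(sizeE (EL NT (EAdd (EV 15) (EV 37)))).
  have := Hs env' H'; rewrite /= => ->; rewrite !H' // [setv 38 _ _ 2%N]/=.
  have := dnw_dn Hz H'; rewrite /= !H' // => ->.
  have -> : g i.+1 = if good (nth set0 L i) then (code_set (nth set0 L i)).+1
    else g i by [].
  rewrite /setv /= E2 E8 -/(good (nth set0 L i)); case: (good _) => //.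
  by move: (code_set _) => q; clear; lia.
suff : forall q, (q <= size L)%N -> (g q = 0%N /\ forall i, (i < q)%N ->
  ~~ good (nth set0 L i)) \/
    exists2 K, K \in L & good K /\ g q = (code_set K).+1.
  move=> /(_ _ (leqnn _)) [[-> H]|]; [left|by right]; split=> // K KL.
  by rewrite -(nth_index set0 KL); apply: H; rewrite index_mem.
elim=> [|q IH] ltq; first by left.
have -> : g q.+1 = if good (nth set0 L q) then (code_set (nth set0 L q)).+1
  else g q by [].
case: ifP => gq; first by right; exists (nth set0 L q) => //; apply: mem_nth.
have [[-> H]|[K KL [gK ->]]] := IH (ltnW ltq); last by right; exists K.
left; split=> // i; rewrite ltnS leq_eqVlt => /orP[/eqP->|];
  first by rewrite gq.
exact: H.
Qed.

Lemma ok_dp arr env : dbase arr env -> (1 <= Bd)%N ->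
  ok r Bd sDP arr env (fun arr' env' =>
    dbase arr' env' /\ exists m, env' 17%N = m%:Z /\
   ((m = 0%N /\ {in dp #|S|, forall K, ~~ good K}) \/
    exists2 K, K \in dp #|S| & good K /\ m = (code_set K).+1)).
Proof.
move=> D0 B1; have [E0 E1 E2 E8 [AR AP Hb]] := D0.
apply: ok_seq; apply: ok_sta => //; set arr1 := seta _ _ _ _.
have D1 : dbase arr1 env by apply: dbase_seta.
apply: ok_seq; apply: ok_set => //.
have D2 := dbase_setv 0 (isT : 8 < 15)%N D1; have [_ _ _ _ [_ _ Hb2]] := D2.
apply: ok_seq; apply: ok_set => //.
have D3 := dbase_setv 1 (isT : 8 < 16)%N D2; have [_ _ _ _ [_ _ Hb3]] := D3.
apply: ok_seq; apply: ok_set => //.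
have D4 := dbase_setb (isT : 3 < 4 < 8)%N B1 D3; have [_ _ _ _ [_ _ Hb4]] := D4.
apply: ok_seq; apply: (ok_for (I := outer) (N := #|S|)).
- by rewrite /setv /= E2.
- by have := Hb 2%N isT; rewrite E2.
- exists 0%N; split=> // -[|//] _; rewrite /arr1 /seta /=.
  by rewrite /code_set big1 // => i _; rewrite inE.
- by move=> i arr' env' lti O'; apply: ok_step.
move=> arr' env' O'; have [lo [D' _ _ _ _]] := O'.
have [_ _ _ _ [_ _ Hb']] := D'.
apply: ok_set => //; split; first exact: dbase_setv.
by have [m [Em Hm]] := dn_found O'; exists m; rewrite Em.
Qed.

End DPProgram.

Definition sFill (a : name) (e : ex) := SFor 0 19 (SA a (EV 19) e).
Fixpoint seqS (s : seq stmt) : stmt :=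
  if s is c :: s' then SSeq c (seqS s') else SSkip.
Definition solE :=
  andE (leE (cE 1) (EV 17))
    (andE (EL NR (EV 19)) (notE (bitE (ESub (EV 17) (cE 1)) (EV 19)))).
(** Eight doublings give 256 k, the multiple by the first power of two above 244. Beyond it there is
    no solution and the dynamic program is not run. *)
Definition sMain := seqS
  [:: SV 1 (EAdd (EV 0) (cE 4)); sFill NX (colE TX (EV 19));
    sFill NY (colE TY (EV 19));
      sFill NR (relE (EV 19)); SV 2 (sumE 0 30 (EL NR (EV 30))); SV 13 orderE;
      SV 3 (pow2E (EV 13)); sFill NL (weightE (EV 19));
        sFill ND (leaderE (EV 19));
      SV 14 bestE; sFill NK (keyE (EV 14) (EV 19)); sFill NP (rankE (EV 19));
      SIf (EV 2) (iter 8 dblE (EV 8)) sDP (SV 17 (cE 0));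
      sFill NS solE; SV 18 (leE (cE 1) (EV 17))].

(** * The main program on unit disk graphs *)

Section Main.
Variables (R : realType) (n : nat) (p : 'I_n -> R * R) (k : int).
Notation r := (rmem (input_state p k)).
Notation e := (unit_disk_graph p).
Notation B := (n + 4)%N.
Implicit Types (arr : name -> int -> int) (env : nat -> int).
Variable Bd : nat.

Definition frame_arr (a : name) arr arr' : Prop :=
  forall b i, b <> a -> arr' b i = arr b i.
Definition frame_env (x : nat) env env' : Prop :=
  forall y, y <> x -> env' y = env y.

Lemma ok_fill a ea (f : 'I_n -> nat) arr env Q : wfe ea -> bok Bd env ->
  env 0%N = n%:Z ->
  (forall arr' env' (v : 'I_n), frame_arr a arr arr' -> frame_env 19 env env' ->
     env' 19%N = (v : nat)%:Z -> dn r arr' env' ea (f v)) ->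
  (forall arr' env', frame_arr a arr arr' -> frame_env 19 env env' ->
     isarr arr' a f -> Q arr' env') ->
  ok r Bd (sFill a ea) arr env Q.
Proof.
move=> wf Hb E0 He HQ.
apply: (ok_for (N := n) (I := fun i arr' env' =>
  [/\ frame_arr a arr arr', frame_env 19 env env' &
   forall v : 'I_n, (v < i)%N -> arr' a (v : nat)%:Z = (f v)%:Z])).
- by rewrite E0.
- by have := Hb 0%N isT; rewrite E0.
- by split.
- move=> i arr' env' lti [Fa Fe Hi].
  have Fe' : frame_env 19 env (setv 19 i%:Z env').
    by move=> y ny; rewrite setv_neq; [apply: Fe|apply/eqP].
  apply: ok_sta => //.
    by move=> b ltb; rewrite Fe' ?Hb // => E; rewrite E in ltb.
  rewrite (den_ev (He arr' _ (Ordinal lti) Fa Fe' erefl)); split=> //.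
    move=> b j nb; rewrite /seta -(Fa b j nb); case: eqP => [_|];
      rewrite ?andbF ?andbT //.
    rewrite /name_eqb; case: eqnP => // E; case: nb;
      by case: b a E {He HQ Fa Hi} => -[].
  move=> v; rewrite ltnS /seta /= /name_eqb leq_eqVlt => /orP[/eqP E|ltv].
    have -> : v = Ordinal lti by apply: val_inj.
    by rewrite /= !eqxx; case: eqnP.
  case: eqP => [[E]|_]; first by rewrite E ltnn in ltv.
  by rewrite andbF Hi.
move=> arr' env' [Fa Fe Hi]; apply: HQ => // v; exact: Hi.
Qed.

Definition cxp (v : 'I_n) := column (fun i => (p i).1) n v.
Definition cyp (v : 'I_n) := column (fun i => (p i).2) n v.
Definition rel_set : {set 'I_n} := relevant e.
Notation S := rel_set.
Notation order4 := (order4 B S).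
Definition best := best_shift cxp cyp S (2 ^ order4).
Definition posp := rank S (key B S cxp cyp best).

Lemma cxp_lt v : (cxp v < n)%N. Proof. exact: column_lt. Qed.
Lemma cyp_lt v : (cyp v < n)%N. Proof. exact: column_lt. Qed.

Lemma unit_disk_sym : symmetric e.
Proof.
by move=> u v; rewrite /unit_disk_graph /edist eq_sym -!(opprB (p v).1)
  -!(opprB (p v).2) !sqrrN.
Qed.

Lemma unit_disk_sq u v : e u v = (u != v) &&
  (((p u).1 - (p v).1) ^+ 2 + ((p u).2 - (p v).2) ^+ 2 <= 1).
Proof.
by rewrite /unit_disk_graph /edist -[X in _ <= X]sqrtr1 ler_sqrt.
Qed.

(** Both coordinates differ by at most 1/2, so the squared distance is at most 1/2. *)
Lemma unit_disk_clique u v : same_cell cxp cyp u v -> u != v -> e u v.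
Proof.
rewrite unit_disk_sq => /andP[/eqP Ex /eqP Ey] ->.
have := column_eq (leqnn n) Ex; have := column_eq (leqnn n) (esym Ex).
have := column_eq (leqnn n) Ey; have := column_eq (leqnn n) (esym Ey).
move: (p u).1 (p v).1 (p u).2 (p v).2 => a b c d H1 H2 H3 H4 /=.
have sq (z : R) : z <= 2^-1 -> - z <= 2^-1 -> z ^+ 2 <= 2^-1.
  by move=> h1 h2; rewrite expr2; nra.
have := sq (a - b); have := sq (c - d); rewrite !opprB =>
  /(_ H1 H2) h1 /(_ H3 H4) h2.
lra.
Qed.

Lemma unit_disk_local u v : e u v -> [/\ (cxp v <= cxp u + 2)%N,
  (cxp u <= cxp v + 2)%N,
  (cyp v <= cyp u + 2)%N & (cyp u <= cyp v + 2)%N].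
Proof.
rewrite unit_disk_sq => /andP[_].
move Ea: ((p u).1 - (p v).1) => a; move Eb: ((p u).2 - (p v).2) => b le.
have sq (z t : R) : z ^+ 2 + t ^+ 2 <= 1 -> z <= 1 /\ - z <= 1.
  by rewrite !expr2 => h; split; nra.
have [a1 a2] := sq a b le; rewrite addrC in le; have [b1 b2] := sq b a le.
by split; apply: column_near => //; lra.
Qed.

Hypothesis nBd : (2 * n + 5 <= Bd)%N.
Hypothesis DPBd : #|S|%:Z <= 256 * k -> forall t, (t <= #|S|)%N ->
  (2 * size (dp e S posp t) <= Bd)%N.

(** The loop over the shifts only has to be polynomial, so the crude comparison of 2^j with 4^j
    suffices. *)
Lemma pow_order4 : (2 ^ order4 <= 2 * n + 1)%N.
Proof.
case E: order4 => [|j]; first by rewrite addn1.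
have lt : (4 ^ j < #|S|)%N.
  rewrite (@log4upP B); first by rewrite -/order4 E.
  by have := order4_le S (leqnn B); rewrite E; clear; lia.
have := cardR S; have : (2 ^ j <= 4 ^ j)%N; first
  by rewrite -[4%N]/(2 * 2)%N expnMn leq_pmulr // expn_gt0.
by rewrite expnS; move: lt; clear; lia.
Qed.

Definition result arr env : Prop :=
  env 0%N = n%:Z /\
  ((env 18%N = 0 /\ (~~ (#|S|%:Z <= 256 * k) \/
     {in dp e S posp #|S|, forall K, ~~ good k S K})) \/
   (env 18%N = 1 /\ exists2 K, K \in dp e S posp #|S| &
     good k S K /\ isarr arr NS (ind (S :\: K)))).

Lemma bok_frame env env' : frame_env 19 env env' -> bok Bd env -> bok Bd env'.
Proof. by move=> Fe H b ltb; rewrite Fe ?H // => E; rewrite E in ltb. Qed.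

(** Transports the known values across a fill, which changes one array and variable 19. *)
Ltac frame Fa Fe arr env arr' env' :=
  repeat match goal with
  | H : isarr arr ?b ?f |- _ =>
      have {}H : isarr arr' b f by move=> ?; rewrite Fa
  | H : env ?x = _ |- _ => rewrite -(Fe x) // in H
  | H : bok Bd env |- _ =>
      have {}H : bok Bd env' := bok_frame Fe H
  end.

Lemma ok_main arr env : env 0%N = n%:Z -> env 8%N = k ->
  (forall b, (0 < b < 8)%N -> env b = 0) ->
  ok r Bd sMain arr env result.
Proof.
move=> E0 E8 Ez.
have Hb : bok Bd env.
  move=> b ltb; case: (posnP b) => [->|b0]; last by rewrite Ez // b0.
  by rewrite E0; move: nBd; clear; rewrite /=; lia.
have leS : (#|S| <= n)%N := cardR S.
apply: ok_seq; apply: ok_set => //.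
have -> : ev r arr env (EAdd (EV 0) (cE 4)) = B%:Z by rewrite /= E0 PoszD.
set env1 := setv 1 _ env; have E1 : env1 1%N = B%:Z by [].
have Hb1 : bok Bd env1 by apply: bok_setb => //; move: nBd; clear; lia.
change (env1 0%N = n%:Z) in E0; change (env1 8%N = k) in E8.
(* Once its values are recorded the environment is made opaque, here and after each assignment
   below, so that updates do not pile up. *)
clearbody env1; clear Ez Hb env; rename Hb1 into Hb; rename env1 into env.
apply: ok_seq; apply: (@ok_fill _ _ cxp) => // [arr' env' v Fa Fe E19|arr1 env1
  Fa Fe AX].
  by apply: dn_column => //; rewrite ?Fe // => u w; apply: rtest_X.
frame Fa Fe arr env arr1 env1; clear Fa Fe arr env.
apply: ok_seq; apply: (@ok_fill _ _ cyp) => // [arr' env' v Fa Fe E19|arr2 env2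
  Fa Fe AY].
  by apply: dn_column => //; rewrite ?Fe // => u w; apply: rtest_Y.
frame Fa Fe arr1 env1 arr2 env2; clear Fa Fe arr1 env1.
apply: ok_seq; apply: (@ok_fill _ _ (ind S)) =>
  // [arr' env' v Fa Fe E19|arr env Fa Fe AR].
  by apply: dn_relevant => //; rewrite Fe.
frame Fa Fe arr2 env2 arr env; clear Fa Fe arr2 env2.
apply: ok_seq; apply: ok_set => //; rewrite (den_ev (dn_cardR p k E0 AR)).
have Hb1 := bok_setb 2 (_ : #|S| <= Bd)%N Hb.
move/(_ ltac:(move: leS nBd; clear; lia)) in Hb1.
set env1 := setv 2 _ env in Hb1 *; have E2 : env1 2%N = #|S|%:Z by [].
change (env1 0%N = n%:Z) in E0; change (env1 8%N = k) in E8;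
  change (env1 1%N = B%:Z) in E1.
clearbody env1; clear Hb env.
apply: ok_seq; apply: ok_set => //; rewrite (den_ev (dn_order4 p k arr E1 E2)).
have {}Hb1 := bok_set order4%:Z (isT : 8 <= 13)%N Hb1.
set env := setv 13 _ env1 in Hb1 *; have E13 : env 13%N = order4%:Z by [].
change (env 0%N = n%:Z) in E0; change (env 8%N = k) in E8;
  change (env 1%N = B%:Z) in E1.
change (env 2%N = #|S|%:Z) in E2; clearbody env; clear env1.
have leJ : (order4 <= B)%N by apply: leq_trans (order4_le S (leqnn B))
  (leq_addr _ _).
apply: ok_seq; apply: ok_set => //.
rewrite (den_ev (dn_pow2 E1 leJ (dn_v r arr (isT : ~~ scratch 13) E13))).
have {}Hb1 := bok_setb 3 (_ : 2 ^ order4 <= Bd)%N Hb1.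
move/(_ ltac:(move: pow_order4 nBd; clear; lia)) in Hb1.
set env1 := setv 3 _ env in Hb1 *; have E3 : env1 3%N = (2 ^ order4)%N%:Z by [].
change (env1 0%N = n%:Z) in E0; change (env1 8%N = k) in E8;
  change (env1 1%N = B%:Z) in E1.
change (env1 2%N = #|S|%:Z) in E2; change (env1 13%N = order4%:Z) in E13;
  clearbody env1; clear env.
apply: ok_seq; apply: (@ok_fill _ _ (weight B S cxp cyp)) =>
  // [arr' env' v Fa Fe E19|arr2 env2 Fa Fe AL].
  by frame Fa Fe arr env1 arr' env'; apply: dn_weight.
frame Fa Fe arr env1 arr2 env2; clear Fa Fe arr env1.
apply: ok_seq; apply: (@ok_fill _ _ (leader S cxp cyp)) =>
  // [arr' env' v Fa Fe E19|arr env Fa Fe AD].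
  by frame Fa Fe arr2 env2 arr' env'; apply: dn_leader.
frame Fa Fe arr2 env2 arr env; clear Fa Fe arr2 env2.
apply: ok_seq; apply: ok_set => //.
rewrite (den_ev (dn_best p k cxp_lt cyp_lt E0 E1 E3 AX AY AL AD E13)).
have {}Hb1 := bok_set (best%:Z) (isT : 8 <= 14)%N Hb1.
set env1 := setv 14 _ env in Hb1 *; have E14 : env1 14%N = best%:Z by [].
change (env1 0%N = n%:Z) in E0; change (env1 8%N = k) in E8;
  change (env1 1%N = B%:Z) in E1.
change (env1 2%N = #|S|%:Z) in E2; change (env1 13%N = order4%:Z) in E13;
  clear E3; clearbody env1; clear env.
have bestle : (best <= 2 ^ order4)%N by have := best_shift_lt cxp cyp S (2 ^
  order4).
apply: ok_seq; apply: (@ok_fill _ _ (key B S cxp cyp best)) =>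
  // [arr' env' v Fa Fe E19|arr2 env2 Fa Fe AK].
  frame Fa Fe arr env1 arr' env'; apply: dn_key => //;
    [exact: cxp_lt|exact: cyp_lt].
frame Fa Fe arr env1 arr2 env2; clear Fa Fe arr env1.
apply: ok_seq; apply: (@ok_fill _ _ posp) => // [arr' env' v Fa Fe E19|arr env
  Fa Fe AP].
  by frame Fa Fe arr2 env2 arr' env'; apply: dn_rank.
frame Fa Fe arr2 env2 arr env; clear Fa Fe arr2 env2.
pose outcome (env' : nat -> int) := exists m, env' 17%N = m%:Z /\
   ((m = 0%N /\ (~~ (#|S|%:Z <= 256 * k) \/ {in dp e S posp #|S|, forall K,
     ~~ good k S K})) \/
    exists2 K, K \in dp e S posp #|S| & good k S K /\ m = (code_set K).+1).
have D : dbase k S posp Bd arr env by [].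
apply: ok_seq; apply: (@ok_conseq _ _ _ _ _ _ (fun arr' env' =>
   dbase k S posp Bd arr' env' /\ outcome env')); last first.
  apply: ok_if => //.
  have -> : ev r arr env (iter 8 dblE (EV 8)) = 256 * k by rewrite /= E8;
    clear; lia.
  rewrite [ev _ _ _ _]/= E2; case: ifP => Hk.
    have Bd1 : (1 <= Bd)%N by move: nBd; clear; lia.
    apply: ok_conseq (ok_dp unit_disk_sym _ (DPBd Hk) D Bd1);
      last exact: rank_inj.
    move=> arr' env' [D' [m [Em Hm]]]; split=> //; exists m; split=> //.
    by case: Hm => [[m0 H]|H]; [left; split=> //; right|right].
  apply: ok_set => //; split; first exact: dbase_setv.
  by exists 0%N; split=> //; left; split=> //; left; rewrite Hk.
move=> arr1 env1 [[F0 F1 F2 F8 [BR BP Hb2]] [m [Em Hm]]].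
apply: ok_seq; apply: (@ok_fill _ _ (fun v : 'I_n =>
  (0 < m)%N && ((v \in S) && ~~ (odd (m.-1 %/ 2 ^ v))) : nat)) => //.
  move=> arr' env' v Fa Fe E19; frame Fa Fe arr1 env1 arr' env'.
  apply: dn_and => [|m0]; first by apply: dn_le; [exact: dn_cE|apply: dn_v].
  apply: dn_and => [|_]; first by apply: (isarr_dn BR); apply: dn_v.
  apply: dn_not; apply: (dn_bit (B := B)) => //.
  + case: Hm => [[mz _]|[K _ [_ ->]]]; first by rewrite mz in m0.
    by apply: leq_trans (code_set_lt _) _; rewrite leq_exp2l // leq_addr.
  + by rewrite -subn1; apply: dn_sub => //; apply: dn_v.
  + exact: dn_v.
  + by apply: leq_trans (ltn_ord v) (leq_addr _ _).
move=> arr2 env2 Fa Fe AS; frame Fa Fe arr1 env1 arr2 env2.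
apply: ok_seq; apply: ok_set => //; apply: ok_skip.
have -> : ev r arr2 env2 (leE (cE 1) (EV 17)) = (0 < m)%N%:Z.
  by rewrite /= Em lez_nat; case: (0 < m)%N.
split=> //; case: Hm => [[m0 H]|[K KL [gK Em']]]; first by left; split;
  rewrite ?m0.
right; split; first by rewrite Em'.
exists K => //; split=> // v; rewrite AS Em' /= bit_code_set /ind in_setD.
by rewrite andbC.
Qed.
End Main.

(** * Input, output and the final time bound *)

Definition cInit : cmd := CSeq (store (vaddr 0) (ld 0)) (store (vaddr 8) (ld
  1)).
(** The answer overwrites cell 0, so [n] is read from the copy made by [cInit]. *)
Definition cOutput : cmd :=
  CSeq (store 0 (ld (vaddr 18))) (CSeq (store (vaddr 19) (IConst 0))
  (CWhile (BILe (IAdd (ld (vaddr 19)) (IConst 1)) (ld (vaddr 0)))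
    (CSeq (CIStore (IAdd (ld (vaddr 19)) (IConst 1)) (ILoad (aE (code NS) (ld
      (vaddr 19)))))
          (store (vaddr 19) (IAdd (ld (vaddr 19)) (IConst 1)))))).
Definition program : cmd := CSeq cInit (CSeq (scomp sMain 0) cOutput).
Definition program_cost (B : nat) : nat := (8 + (scost B sMain + (B * 200 +
  200)))%N.

Lemma wpx_output (R : realType) (S : state R) n arr env B : rel_st S arr env ->
  env 0%N = n%:Z -> (n <= B)%N ->
  wpx cOutput (B * 200 + 200)
    (fun S' => imem S' 0 = env 18%N /\
       forall i, (i < n)%N -> imem S' i.+1%:Z = arr NS i%:Z) S.
Proof.
move=> HS E0 leB.
apply: (@wpx_conseq _ _ (4 + (4 + (B * 200 + 20)))) => [||]; first by clear;
  lia.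
  by move=> S' H; exact: H.
have pos_v (j x : nat) : (j%:Z == vaddr x) = false.
  by apply/eqP; rewrite /vaddr /addr; clear; lia.
have v_pos (j x : nat) : (vaddr x == j%:Z) = false by rewrite eq_sym.
have pos_a (j : nat) (i : nat) : (addr (code NS) i%:Z == j%:Z) = false.
  by apply/eqP; rewrite /addr /=; clear; lia.
pose I i (S' : state R) := [/\ imem S' 0 = env 18%N, imem S' (vaddr 19) = i%:Z,
  imem S' (vaddr 0) = n%:Z, forall j : nat, imem S' (addr (code NS) j%:Z) = arr
    NS j%:Z &
  forall j, (j < i)%N -> imem S' j.+1%:Z = arr NS j%:Z].
have [hv ha] := HS.
apply: wpx_seq; apply: wpx_st => //; apply: wpx_seq; apply: wpx_st => //.
apply: (@wpx_conseq _ _ (n * (7 + 100 + 1) + (7 + 1)) _ (I n)) => [|S' [] //|].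
  by rewrite leq_add // leq_mul.
apply: (@wpx_while _ _ _ I n 100) => //.
- move=> i S' lti [H0 H19 Hn Ha Hi]; split.
    by rewrite /= H19 Hn; clear -lti; lia.
  apply: (@wpx_conseq _ _ (90 + 10)) => // [S'' H''|]; first exact: H''.
  apply: wpx_seq; eexists; eexists; split; [exact: ExecIStore|by []|].
  apply: wpx_st => //=.
  have Eaddr := ieval_aE S' (code NS) (ld (vaddr 19)); rewrite /= in Eaddr.
  rewrite Eaddr H19 -PoszD addn1 Ha.
  split; rewrite /= /upd ?v_pos ?eqxx ?vaddr_eq //.
  + by rewrite H19 -PoszD addn1.
  + by move=> j; rewrite (arr_vaddr NS) pos_a Ha.
  + move=> j; rewrite ltnS leq_eqVlt pos_v => /orP[/eqP->|ltj];
      first by rewrite eqxx.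
    by case: eqP => [[->]|_] //; apply: Hi.
- by move=> S' [_ H19 Hn _ _] /=; rewrite H19 Hn; clear; lia.
- split=> //=; rewrite /upd ?eqxx ?vaddr_eq ?v_pos ?pos_v //=.
  + by rewrite hv E0.
  + by move=> j; rewrite (arr_vaddr NS) pos_a (ha NS).
Qed.

Section Correctness.
Variables (R : realType) (n : nat) (p : 'I_n -> R * R) (k : int).
Notation e := (unit_disk_graph p).
Notation B := (n + 4)%N.
Notation S := (rel_set p).
Notation J := (order4 B S).

Lemma size_dp_unit_disk t : (t <= #|S|)%N ->
  (size (dp e S (posp p) t) <= n.+1 * 2 ^ (972 * 2 ^ J))%N.
Proof.
move=> let_; apply: (@size_dp_front n B e S (cxp p) (cyp p) (leqnn _)
  (cxp_lt p) (cyp_lt p) (@unit_disk_local _ _ p) (posp p) (best p)) => //.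
- by have := best_shift_lt (cxp p) (cyp p) S (2 ^ J); rewrite ltnS.
- by move=> u v uS vS; apply: rank_key.
- exact: rank_inj.
- exact: unit_disk_clique.
- exact: unit_disk_sym.
- by move=> t'; apply: rank_onto.
- apply: (@min_shift_weight n B S (cxp p) (cyp p) (leqnn _) (cxp_lt p) (cyp_lt
    p)) => // a lta.
  exact: best_shift_le.
Qed.

Lemma posp_inj : {in S &, injective (posp p)}.
Proof. exact: rank_inj. Qed.

Lemma before_all : before S (posp p) #|S| = S.
Proof.
apply/setP => u; rewrite inE; case: (boolP (u \in S)) => /= uS; last by [].
by rewrite /posp rank_bound.
Qed.

Lemma good_solution K : K \in dp e S (posp p) #|S| -> good k S K ->
  bdd_solution 2 e k (S :\: K).
Proof.
have [sub _ _] := dp_inv (@unit_disk_sym R n p) posp_inj #|S|.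
move=> KL gK; have [] := sub K KL; rewrite before_all => sK vK.
rewrite /bdd_solution max_degree_valid; apply/andP; split.
  apply: le_trans gK; rewrite cardsD (setIidPr sK) -subzn //;
    exact: subset_leq_card.
by apply: relevant_valid => //; apply: unit_disk_sym.
Qed.

(** A representative of [S :\: X] has the same size, so it deletes from [S] only as many points as
    [X] does. *)
Lemma solution_good X : bdd_solution 2 e k X ->
  #|S|%:Z <= 256 * k /\ exists2 K, K \in dp e S (posp p) #|S| & good k S K.
Proof.
rewrite /bdd_solution max_degree_valid => /andP[leX vX].
have le244 : (#|S| <= 244 * #|X|)%N.
  apply: (@card_relevant n e (cxp p) (cyp p)) vX => [u v Ex Ey|].
    by apply: unit_disk_clique; rewrite /same_cell Ex Ey !eqxx.
  exact: unit_disk_local.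
split; first by move: le244 leX; clear; lia.
have [_ cov _] := dp_inv (@unit_disk_sym R n p) posp_inj #|S|.
have /mapP[K KL [cK _]] : sig e S (posp p) #|S| (S :\: X) \in map (sig e S
  (posp p) #|S|) (dp e S (posp p) #|S|).
  by apply: cov; [rewrite before_all subsetDl|apply: valid_relevant].
exists K => //; rewrite /good -cK.
have := cardsID X S; have : (#|S :&: X| <= #|X|)%N
  by apply/subset_leq_card/subsetIr.
by move: leX; move: #|S :&: X| #|S :\: X| #|S| #|X| => a b c d; clear; lia.
Qed.

(** The linear term covers [n + 4] and the number of shifts, at most 2 n + 1; the first term covers
    twice the number of states. *)
Definition loop_bound : nat :=
  if #|S|%:Z <= 256 * k then (2 * (n.+1 * 2 ^ (972 * 2 ^ J)) + (2 * n + 5))%N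
  else (2 * n + 5)%N.

Lemma program_ok :
  wpx program (program_cost loop_bound)
    (correct_output (bdd_solution 2 e k)) (input_state p k).
Proof.
apply: wpx_seq; apply: (@wpx_conseq _ _ (4 + 4)) => // [S' H|]; first exact: H.
apply: wpx_seq; apply: wpx_st => //; apply: wpx_st => //.
set S0 := State _ _; apply: wpx_seq.
pose arr a z := imem S0 (addr (code a) z); pose env x := imem S0 (vaddr x).
have HS : rel_st S0 arr env by [].
have E0 : env 0%N = n%:Z by [].
have E8 : env 8%N = k by [].
have Ez b : (0 < b < 8)%N -> env b = 0 by case: b => [|[|[|[|[|[|[|[|b]]]]]]]].
have nB : (2 * n + 5 <= loop_bound)%N.
  by rewrite /loop_bound; case: ifP => // _; apply: leq_addl.
have DPB : #|S|%:Z <= 256 * k -> forall t, (t <= #|S|)%N ->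
    (2 * size (dp e S (posp p) t) <= loop_bound)%N.
  move=> le t let_; rewrite /loop_bound le; apply: leq_trans (leq_addr _ _).
  by rewrite leq_mul2l size_dp_unit_disk.
have rS0 : rmem S0 = rmem (input_state p k) by [].
have Hmain := @ok_main R n p k _ nB DPB arr env E0 E8 Ez.
apply: wpx_conseq (Hmain 0%N S0 rS0 HS) => // S1 [r1 _ [arr1 [env1 [HS1 [F0
  Hres]]]]].
have leB : (n <= loop_bound)%N by move: nB; clear; lia.
apply: wpx_conseq (wpx_output HS1 F0 leB) => // S2 [H0 Hi].
case: Hres => [[E18 none]|[E18 [K KL [gK HK]]]].
  have no : ~ exists X, bdd_solution 2 e k X.
    case=> X /solution_good[le [K KL gK]]; case: none => [|none];
      first by rewrite le.
    by have := none K KL; rewrite gK.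
  split=> [ex|_]; first by case: (no ex).
  by rewrite H0 E18.
have sol := good_solution KL gK.
have out : output_set n S2 = S :\: K.
  by apply/setP => v; rewrite [LHS]inE Hi // HK /ind; case: (v \in _).
split=> [_|[]]; last by exists (S :\: K).
by rewrite H0 E18 out.
Qed.

(** For positive J, 4^(J - 1) is less than the number of relevant points, hence at most 256 k, so
    2^J is at most 2 times 16 sqrt k. The added 1 covers J = 0. *)
Lemma pow_order4_sqrt : #|S|%:Z <= 256 * k ->
  (2 ^ J)%:R <= 32 * Num.sqrt (k%:~R) + 1 :> R.
Proof.
move=> le; case EJ: J => [|j].
  by rewrite expn0 lerDr mulr_ge0 ?sqrtr_ge0.
have lt : (4 ^ j < #|S|)%N.
  rewrite (@log4upP B); first by rewrite -/(order4 B S) EJ.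
  by have := order4_le S (leqnn B); rewrite EJ; clear; lia.
have lt' : (4 ^ j)%:R <= 256 * (k%:~R) :> R.
  have : (4 ^ j)%:Z <= 256 * k by apply: le_trans le; rewrite lez_nat ltnW.
  by rewrite -(ler_int R) rmorphM /=.
have -> : (2 ^ j.+1)%:R = 2 * Num.sqrt ((4 ^ j)%:R : R).
  have -> : (4 ^ j)%:R = (2 ^ j)%:R ^+ 2 :> R
    by rewrite -natrX -expnM mulnC expnM.
  by rewrite sqrtr_sqr ger0_norm ?ler0n // expnS natrM.
have : Num.sqrt ((4 ^ j)%:R : R) <= Num.sqrt (256 * k%:~R) by apply: ler_wsqrtr.
have -> : (256 : R) = 16 ^+ 2 by rewrite -natrX.
rewrite sqrtrM ?sqr_ge0 // sqrtr_sqr ger0_norm //; lra.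
Qed.

(** [A] and [a] are tied by equations so that the numeral 2^972 is never computed. That factor comes
    from the added 1 in [pow_order4_sqrt], and the 8 absorbs the linear term. *)
Lemma loop_bound_le (A a : nat) :
  A%:R = 8 * powR 2 972%:R :> R -> a%:R = 972%:R * 32 :> R ->
  (loop_bound.+1)%:R <= A%:R * powR 2 (a%:R * Num.sqrt (k%:~R)) * n.+1%:R :> R.
Proof.
move=> -> ->.
have p1 (y : R) : 0 <= y -> 1 <= powR 2 y.
  have one2 : 1 <= 2 :> R by rewrite ler1n.
  by move=> y0; have := ler_powR one2 y0; rewrite powRr0.
have s0 : 0 <= 972%:R * 32 * Num.sqrt (k%:~R : R).
  by rewrite !mulr_ge0 ?sqrtr_ge0 ?ler0n.
set P := powR 2 (_ * Num.sqrt _); have P1 : 1 <= P by apply: p1.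
have x1 : 1 <= n.+1%:R :> R by rewrite ler1n.
have q1 : 1 <= powR 2 972%:R :> R by apply: p1; apply: ler0n.
rewrite /loop_bound; case: ifP => [le|_]; last first.
  have le8 : ((2 * n + 5).+1%:R : R) <= 8 * n.+1%:R by rewrite -natrM ler_nat;
    clear; lia.
  apply: le_trans le8 _; apply: ler_wpM2r; first exact: ler0n.
  rewrite -[X in X <= _]mulr1 -mulrA; apply: ler_wpM2l; first exact: ler0n.
  exact: mulr_ege1.
set Z := (2 ^ (972 * 2 ^ J))%N.
have EZ : (Z%:R : R) = powR 2 (972%:R * (2 ^ J)%:R).
  by rewrite -natrM powR_mulrn ?ler0n // natrX.
have Z0 : (0 < Z)%N by rewrite expn_gt0.
clearbody Z.
apply: (@le_trans _ _ (8 * Z%:R * n.+1%:R)).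
  rewrite -!natrM ler_nat.
  have : (n.+1 <= n.+1 * Z)%N by rewrite leq_pmulr.
  by move: (n.+1 * Z)%N (mulnC Z n.+1) => m; rewrite -mulnA => ->; clear; lia.
apply: ler_wpM2r; first exact: ler0n.
rewrite -mulrA; apply: ler_wpM2l; first exact: ler0n.
rewrite EZ /P -powRD; last by apply/implyP => _; rewrite pnatr_eq0.
apply: ler_powR; first by rewrite ler1n.
have := pow_order4_sqrt le; lra.
Qed.

End Correctness.

Lemma loop_bound_poly (R : realType) : exists A a : nat, forall n (p : 'I_n ->
  R * R) k,
  ((loop_bound p k).+1)%:R <= A%:R * powR 2 (a%:R * Num.sqrt (k%:~R)) * n.+1%:R
    :> R.
Proof.
exists (8 * 2 ^ 972)%N, (972 * 32)%N => n p k.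
apply: loop_bound_le; last by rewrite natrM.
by rewrite natrM natrX powR_mulrn ?ler0n.
Qed.

(* [Num.sqrt] is 0 on negative numbers, so the bound also makes sense for
   k < 0; [n.+1] instead of [n] only matters for the empty graph and for
   constant factors. *)
Theorem theorem36 (R : realType) :
  exists (prog : cmd) (C c d : nat),
    forall (n : nat) (p : 'I_n -> R * R) (k : int),
      injective p ->
      exists (t : nat) (s : state R),
        [/\ exec prog (input_state p k) t s,
            correct_output (bdd_solution 2 (unit_disk_graph p) k) s
          & t%:R <= C%:R * powR 2 (c%:R * Num.sqrt (k%:~R : R)) * n.+1%:R ^+ d].
Proof.
have [K [d Hpoly]] : polyb program_cost.
  by do ?[exact: polyb_cst|exact: polyb_id|exact: polyb_scost|apply:
    polyb_add|apply: polyb_mul].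
have [A [a Hbound]] := loop_bound_poly R.
(* The time is at most [K] times the d-th power of the loop bound plus one; raising [Hbound] to the
   power [d] yields these constants. *)
exists program, (K * A ^ d)%N, (a * d)%N, d => n p k _.
have [t [s [E le ok]]] := program_ok p k; exists t, s; split=> //.
have le1 : (t <= K * (loop_bound p k).+1 ^ d)%N := leq_trans le (Hpoly _).
rewrite -(ler_nat R) natrM natrX in le1; apply: le_trans le1 _.
rewrite natrM natrX -!mulrA; apply: ler_wpM2l; first exact: ler0n.
have -> : powR 2 ((a * d)%:R * Num.sqrt k%:~R) = powR 2 (a%:R * Num.sqrt k%:~R)
  ^+ d :> R.
  by rewrite -powR_mulrn ?powR_ge0 // -powRrM natrM mulrAC.
rewrite mulrA -!exprMn; apply: lerXn2r; rewrite ?nnegrE ?ler0n //.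
by rewrite !mulr_ge0 ?powR_ge0 ?ler0n.
Qed.
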